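(* Let $q$ be a power of an odd prime. Let $n\ge 2$ be even and let $k\equiv 2\pmod 4$ be a positive divisor of $n/2$. Let $r\ge 1$ be an integer and let $f(x)=\sum_{i=0}^{2r}a_ix^i\in\mathbb{F}_q[x]$ be such that $f(x)\mid x^k-1$ and $a_{r-i}=a_{r+i}$ for all $i=1,\dots,r$. Let $$G(x)=\sum_{i=1}^{r}a_{r+i}x^{q^{k/2-i}}+a_rx^{q^{k/2}}+\sum_{i=1}^{r}a_{r+i}x^{q^{k/2+i}}.$$ Then the curve $\mathcal{X}_{f,k}$ defined by the affine equation $$y^q-y=x\sum_{j=0}^{\frac{n}{2k}-1}G(x)^{q^{jk}}$$ is minimal over $\mathbb{F}_{q^n}$.
   Context: A curve given by an affine equation $y^q-y=xS(x)$ means the smooth, projective, geometrically irreducible curve with that function field; it has exactly one point at infinity, which is rational, so its number of rational points over a finite field is one plus the number of affine solutions over that field. A curve of genus $g$ defined over $\mathbb{F}_{q^{N}}$ is called minimal over $\mathbb{F}_{q^{N}}$ if its number of $\mathbb{F}_{q^N}$-rational points equals $q^N+1-2g\sqrt{q^N}$. *)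

(* Defs.v *)
From HB Require Import structures.
From mathcomp Require Import all_boot all_order all_algebra all_field.
From mathcomp Require Import boolp classical_sets functions cardinality fsbigop.

Set Implicit Arguments.
Unset Strict Implicit.
Unset Printing Implicit Defensive.

Import Order.TTheory GRing.Theory Num.Theory.

Local Open Scope classical_set_scope.
Local Open Scope ring_scope.

(* A function field F over the constant field K is given by the embedding
   [iota : K -> F]; K acts on F through [iota].  *)

(* [quotient_dim iota V W d]: for K-subspaces W of V in F, dim_K (V / W) = d,
   i.e. V / W has a basis with d elements (b i modulo W). *)
Definition quotient_dim (K F : fieldType) (iota : {rmorphism K -> F})
    (V W : set F) (d : nat) : Prop :=
  exists b : 'I_d -> F, (forall i, V (b i)) /\
    forall z, V z ->
      exists! c : {ffun 'I_d -> K}, W (z - \sum_i iota (c i) * b i).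

(* dim_K (V / W), with value 0 when V / W is infinite-dimensional; the spaces
   below are all finite-dimensional when F / K is a function field in one
   variable. *)
Definition qdim (K F : fieldType) (iota : {rmorphism K -> F})
    (V W : set F) : nat :=
  xget 0%N [set d | quotient_dim iota V W d].

(* Normalized discrete valuation of F trivial on K. The value at 0, which
   should be +oo, is the placeholder 0, so that a valuation is determined by
   its values on nonzero elements. *)
Definition is_place (K F : fieldType) (iota : {rmorphism K -> F})
    (v : F -> int) : Prop :=
  [/\ v 0 = 0,
      forall z w, z != 0 -> w != 0 -> v (z * w) = v z + v w,
      forall z w, z != 0 -> w != 0 -> z + w != 0 ->
        Num.min (v z) (v w) <= v (z + w),
      forall c, v (iota c) = 0 &
      exists z, z != 0 /\ v z = 1].

Record place (K F : fieldType) (iota : {rmorphism K -> F}) := Place {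
  place_val :> F -> int;
  place_valP : is_place iota place_val }.

HB.instance Definition _ (K F : fieldType) (iota : {rmorphism K -> F}) :=
  gen_eqMixin (place iota).
HB.instance Definition _ (K F : fieldType) (iota : {rmorphism K -> F}) :=
  gen_choiceMixin (place iota).

Definition valuation_ring (K F : fieldType) (iota : {rmorphism K -> F})
    (P : place iota) : set F := [set z | z = 0 \/ 0 <= P z].

Definition maximal_ideal (K F : fieldType) (iota : {rmorphism K -> F})
    (P : place iota) : set F := [set z | z = 0 \/ 0 < P z].

Definition place_degree (K F : fieldType) (iota : {rmorphism K -> F})
    (P : place iota) : nat :=
  qdim iota (valuation_ring P) (maximal_ideal P).

Definition is_divisor (K F : fieldType) (iota : {rmorphism K -> F})
    (D : place iota -> int) : Prop :=
  finite_set [set P | D P != 0].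

Definition divisor_degree (K F : fieldType) (iota : {rmorphism K -> F})
    (D : place iota -> int) : int :=
  \sum_(P \in [set: place iota]) D P * (place_degree P)%:Z.

Definition riemann_roch_space (K F : fieldType) (iota : {rmorphism K -> F})
    (D : place iota -> int) : set F :=
  [set z | z = 0 \/ forall P : place iota, - D P <= P z].

Definition riemann_roch_dim (K F : fieldType) (iota : {rmorphism K -> F})
    (D : place iota -> int) : nat :=
  qdim iota (riemann_roch_space D) [set 0].

(* The genus of F / K is the maximum of deg D - l(D) + 1 over all divisors D. *)
Definition has_genus (K F : fieldType) (iota : {rmorphism K -> F})
    (g : nat) : Prop :=
  (forall D : place iota -> int, is_divisor D ->
     divisor_degree D - (riemann_roch_dim D)%:Z + 1 <= g%:Z) /\
  (exists D : place iota -> int, is_divisor D /\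
     divisor_degree D - (riemann_roch_dim D)%:Z + 1 = g%:Z).

(* The K-rational points of the smooth projective curve with function field
   F / K are the places of degree one. *)
Definition rational_points (K F : fieldType) (iota : {rmorphism K -> F}) :
    set (place iota) :=
  [set P | place_degree P = 1%N].

Definition minimal_curve (K : finFieldType) (F : fieldType)
    (iota : {rmorphism K -> F}) : Prop :=
  exists g N : nat,
    [/\ has_genus iota g,
        (@rational_points K F iota #= `I_N)%card &
        N%:R = #|K|%:R + 1 - 2 * g%:R * sqrtC #|K|%:R :> algC].

(* The value at (x, y) of a polynomial in two variables with coefficients
   in K. *)
Definition eval2 (K F : fieldType) (iota : {rmorphism K -> F}) (x y : F)
    (u : {poly {poly K}}) : F :=
  (map_poly (fun c : {poly K} => (map_poly iota c).[x]) u).[y].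

(* F / K, with the coordinate functions x and y, is the function field of the
   affine curve y^q - y = x S(x) over K.  When K contains the field with q
   elements and x S(x) has a pole of order prime to q at infinity, the
   polynomial Y^q - Y - x S(x) is irreducible over K(x), so that F is determined
   up to isomorphism by the conditions below. *)
Definition is_curve_function_field (K F : fieldType)
    (iota : {rmorphism K -> F}) (q : nat) (S : {poly K}) (x y : F) : Prop :=
  [/\ ~ algebraicOver iota x,
      forall z : F, exists u w : {poly {poly K}},
        eval2 iota x y w != 0 /\ z = eval2 iota x y u / eval2 iota x y w &
      y ^+ q - y = x * (map_poly iota S).[x]].

(* The exponents k./2 - i involve truncated subtraction; it is the true one
   when r <= k./2, which holds as soon as \sum_(i <= 2r) a i 'X^i is palindromic
   and divides 'X^k - 1 (a 0 is then nonzero). *)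
Definition G_poly (k0 : finFieldType) (q k r : nat) (a : nat -> k0) :
    {poly k0} :=
  \sum_(1 <= i < r.+1) a (r + i)%N *: 'X^(q ^ (k./2 - i))
  + a r *: 'X^(q ^ k./2)
  + \sum_(1 <= i < r.+1) a (r + i)%N *: 'X^(q ^ (k./2 + i)).

Definition S_poly (k0 : finFieldType) (q n k r : nat) (a : nat -> k0) :
    {poly k0} :=
  \sum_(0 <= j < n %/ (2 * k)) G_poly q k r a ^+ (q ^ (j * k)).

(* Main.v *)
(* Put h = n/2 - k/2 + r.  The right-hand side beta of y^q - y = beta(x) has degree q^h + 1,
   prime to q, so x and y have poles of coprime orders q and q^h + 1 at a single place at
   infinity, which is rational.  The monomials x^i y^j with j < q are a basis of the functions
   regular elsewhere, and counting those with a pole of order at most m gives the genus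
   (q - 1) q^h / 2.  The other rational places are the affine points, and their number is q
   times the number of zeros of the quadratic form z |-> Tr(z S(z)) on F_(q^n).

   Let F_q[X] act on F_(q^n), X being the q-Frobenius.  The adjoint of X for the trace form
   is 1/X, and f and (X^n - 1)/(X^k - 1) are palindromic; their product c has degree 2h, and
   2 Tr(z S(z)) = Tr(z (X^(n/2 - h) c)(z)).  The radical of this form is the kernel of c, of
   dimension 2h.  Modulo X^n - 1, a palindromic polynomial is a power of X times a polynomial
   in Y = X + 1/X.  Applied to a normal element, the powers of Y and their products with
   X - 1/X span a complement of the radical, on which the Gram matrix consists of two
   Hankel blocks whose determinants are proportional.  The signed discriminant comes out as
   w^2 up to squares of F_q, where w is a nonzero element with w^q = -w, hence is not a
   square: the form is elliptic, and the number of its zeros is the smallest possible one. *)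
Require Import Defs.
From HB Require Import structures.
From mathcomp Require Import all_boot all_order all_fingroup all_algebra all_field.
From mathcomp Require Import boolp classical_sets functions cardinality fsbigop.
From mathcomp Require Import zify ring.

Set Implicit Arguments.
Unset Strict Implicit.
Unset Printing Implicit Defensive.

Import Order.TTheory GRing.Theory Num.Theory.

Local Open Scope ring_scope.

(** * Dimensions of quotients of subspaces *)

Section QuotientDimension.
Variables (K : finFieldType) (F : fieldType) (iota : {rmorphism K -> F}).

(** The genus is a maximum over all divisors of an abstractly given field, so that every place has
    to be classified. Where [x] is finite, two facts replace local computations: modulo
    ['X^(#|K| ^ N) - 'X] every element of the coordinate ring is fixed by a power map, which makes
    this polynomial a uniformizer wherever it vanishes and makes inverses powers; and a nonzero
    element has a nonzero norm in [K[x]]. The upper bound for the genus uses only one inequality on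
    principal divisors: the zeros of [c(x)] have total degree at most [q] times the degree of [c],
    by a dimension count.

    On the arithmetic side, let [n = 2 (h + D + 1)]. The cofactor of [c] in [X^n - 1] is
    [(X^2 - 1) e] with [e] palindromic of degree [2 D]; its factor [X + 1] supplies [w], while
    [X - 1] supplies a trace that enters squared. An elliptic form of rank [2 (D + 1)] with a
    radical of dimension [2 h] has [q^(2h) (q^(2D+1) - (q-1) q^D)] zeros. Multiplying by [q] and
    adding the point at infinity gives [q^n + 1 - (q-1) q^h q^(n/2)], in which [(q-1) q^h] is twice
    the genus. *)

Definition subspace (V : set F) :=
  V 0 /\ forall c z w, V z -> V w -> V (iota c * z + w).

Lemma subspace_sub (V : set F) z w : subspace V -> V z -> V w -> V (z - w).
Proof.
by case=> V0 VD Vz Vw; rewrite addrC -mulN1r -(rmorph1 iota) -rmorphN; apply: VD.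
Qed.

Lemma subspace_add (V : set F) z w : subspace V -> V z -> V w -> V (z + w).
Proof. by case=> V0 VD Vz Vw; rewrite -[z]mul1r -(rmorph1 iota); apply: VD. Qed.

Lemma subspace_opp (V : set F) z : subspace V -> V z -> V (- z).
Proof. by move=> sV Vz; rewrite -[- z]add0r; apply: subspace_sub=> //; case: sV. Qed.

Lemma subspace_scale (V : set F) c z : subspace V -> V z -> V (iota c * z).
Proof. by case=> V0 VD Vz; rewrite -[_ * _]addr0; apply: VD. Qed.

Lemma subspace_sum (V : set F) (I : finType) (c : I -> K) (b : I -> F) :
  subspace V -> (forall i, V (b i)) -> V (\sum_i iota (c i) * b i).
Proof.
move=> sV Vb; elim/big_ind: _ => [|z w|i _]; first by case: sV.
  exact: subspace_add.
exact: subspace_scale.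
Qed.

Lemma subspace0 : subspace [set 0].
Proof. by split=> // c z w -> ->; rewrite mulr0 addr0. Qed.

Definition independent_mod (V W : set F) (n : nat) :=
  exists b : 'I_n -> F, (forall i, V (b i)) /\
    forall c : {ffun 'I_n -> K}, W (\sum_i iota (c i) * b i) -> c = 0.

Lemma comb_sub (I : finType) (c e : {ffun I -> K}) (b : I -> F) :
  \sum_i iota ((c - e) i) * b i =
  \sum_i iota (c i) * b i - \sum_i iota (e i) * b i.
Proof.
by rewrite -sumrB; apply: eq_bigr=> i _; rewrite !ffunE rmorphB mulrBl.
Qed.

(** Sending a combination of the [n] independent vectors to coordinates of its image under [phi] on
    the family [b] is injective, from [#|K| ^ n] elements to [#|K| ^ #|I|]. As [K] is finite, this
    bounds [n] without elimination. *)
Lemma independent_mod_le (V W W' : set F) (phi : {additive F -> F}) n (I : finType)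
    (b : I -> F) :
  subspace V -> subspace W' ->
  (forall c z, phi (iota c * z) = iota c * phi z) ->
  (forall z, V z -> W' (phi z) -> W z) ->
  (forall z, V z ->
     exists c : {ffun I -> K}, W' (phi z - \sum_i iota (c i) * b i)) ->
  independent_mod V W n -> (n <= #|I|)%N.
Proof.
move=> sV sW' philin phiW spanV [b' [Vb' ind]].
pose z (c : {ffun 'I_n -> K}) := \sum_i iota (c i) * b' i.
have Vz c : V (z c) by exact: subspace_sum.
have [f fP] := choice (fun c => spanV _ (Vz c)).
have finj : injective f.
  move=> c e fce; apply/eqP; rewrite -subr_eq0; apply/eqP.
  apply: ind; rewrite comb_sub; apply: phiW.
    by apply: subspace_sub => //; apply: Vz.
  rewrite raddfB /= -/(z c) -/(z e).
  have := subspace_sub sW' (fP c) (fP e).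
  by rewrite fce opprB addrA subrK.
have := leq_card f finj; rewrite !card_ffun card_ord leq_exp2l //.
exact: finNzRing_gt1.
Qed.

(** An independent family of maximal size is a basis; the bound makes a maximal size exist. *)
Lemma quotient_dim_bounded (V W : set F) (N : nat) :
  subspace V -> subspace W ->
  (forall n, independent_mod V W n -> (n <= N)%N) ->
  exists2 d, (d <= N)%N & quotient_dim iota V W d.
Proof.
move=> sV sW bnd.
have ex0 : exists n, `[< independent_mod V W n >].
  exists 0%N; apply/asboolP; exists (fun=> 0); split=> [[]//|c _].
  by apply/ffunP=> -[].
have bnd' n : `[< independent_mod V W n >] -> (n <= N)%N.
  by move/asboolP/bnd.
case: (ex_maxnP ex0 bnd') => d /asboolP[b [Vb ind]] dmax.
exists d; first by apply: bnd; exists b.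
exists b; split=> // z Vz.
suff [c cP] : exists c : {ffun 'I_d -> K}, W (z - \sum_i iota (c i) * b i).
  exists c; split=> // e eP; apply/eqP; rewrite -subr_eq0; apply/eqP/ind.
  rewrite comb_sub.
  have := subspace_sub sW eP cP.
  by rewrite opprB addrC addrA subrK.
apply: contrapT => nspan.
suff : (d.+1 <= d)%N by rewrite ltnn.
apply: dmax; apply/asboolP.
exists (fun i => if unlift ord0 i is Some j then b j else z); split.
  by move=> i; case: (unlift _ _).
move=> c; rewrite big_ord_recl unlift_none.
under eq_bigr do rewrite liftK.
have [c0|c0] := eqVneq (c ord0) 0.
  rewrite c0 rmorph0 mul0r add0r => Wc.
  have := ind [ffun i => c (lift ord0 i)].
  rewrite (eq_bigr (fun i => iota (c (lift ord0 i)) * b i)); last first.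
    by move=> i _; rewrite ffunE.
  move=> /(_ Wc) /ffunP cz; apply/ffunP=> i; rewrite [RHS]ffunE.
  case: (unliftP ord0 i) => [j ->|->//].
  by have := cz j; rewrite !ffunE.
(* The coefficient [c ord0] is nonzero, so the relation can be solved for [z], against the
   assumption that [z] is not spanned. *)
move=> Wc; exfalso; apply: nspan.
exists [ffun i => - (c ord0)^-1 * c (lift ord0 i)].
have := subspace_scale (c ord0)^-1 sW Wc.
rewrite mulrDr mulrA -rmorphM mulVf // rmorph1 mul1r mulr_sumr.
congr (W _); congr (_ + _); rewrite -sumrN; apply: eq_bigr => i _.
by rewrite ffunE mulNr rmorphN mulNr opprK rmorphM mulrA.
Qed.

Lemma quotient_dim_independent (V W : set F) d : subspace V -> subspace W ->
  quotient_dim iota V W d -> independent_mod V W d.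
Proof.
move=> [V0 _] sW [b [Vb bP]]; exists b; split=> // c Wc.
have [e [_ eU]] := bP 0 V0.
rewrite -(eU c); last by rewrite sub0r; apply: subspace_opp.
apply: eU; rewrite big1 ?subr0; first by case: sW.
by move=> i _; rewrite ffunE rmorph0 mul0r.
Qed.

Lemma quotient_dim_le_span (V W W' : set F) d (I : finType) (b : I -> F) :
  subspace V -> subspace W -> subspace W' -> (forall z, W' z -> W z) ->
  (forall z, V z -> exists c : {ffun I -> K}, W' (z - \sum_i iota (c i) * b i)) ->
  quotient_dim iota V W d -> (d <= #|I|)%N.
Proof.
move=> sV sW sW' W'W span /(quotient_dim_independent sV sW).
apply: (@independent_mod_le V W W' idfun d I b) => // z Vz.
exact: W'W.
Qed.

Lemma quotient_dim_uniq (V W : set F) d e : subspace V -> subspace W ->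
  quotient_dim iota V W d -> quotient_dim iota V W e -> d = e.
Proof.
move=> sV sW hd he; apply/eqP; rewrite eqn_leq; apply/andP.
have le d1 d2 : quotient_dim iota V W d1 -> quotient_dim iota V W d2 ->
    (d1 <= d2)%N.
  move=> h1 [b [Vb bP]]; rewrite -[d2]card_ord.
  apply: (@quotient_dim_le_span V W W d1 _ b) h1 => // z /bP[c [cP _]].
  by exists c.
by split; apply: le.
Qed.

Lemma qdimE (V W : set F) d : subspace V -> subspace W ->
  quotient_dim iota V W d -> qdim iota V W = d.
Proof.
move=> sV sW hd; apply: (quotient_dim_uniq sV sW) => //.
exact: (xgetI 0%N hd).
Qed.

(** Used with [phi] an inclusion or the multiplication by a function, to compare spaces of functions
    with each other and with residue fields. *)
Lemma quotient_dim_embed (V W V' W' : set F) (phi : {additive F -> F}) d' :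
  subspace V -> subspace W -> subspace V' -> subspace W' ->
  (forall c z, phi (iota c * z) = iota c * phi z) ->
  (forall z, V z -> V' (phi z)) ->
  (forall z, V z -> W' (phi z) -> W z) ->
  quotient_dim iota V' W' d' ->
  exists2 d, (d <= d')%N & quotient_dim iota V W d.
Proof.
move=> sV sW sV' sW' philin phiV phiW [b [Vb bP]].
apply: quotient_dim_bounded => // n; rewrite -[d']card_ord.
apply: (@independent_mod_le V W W' phi _ _ b) => // z /phiV/bP[c [cP _]].
by exists c.
Qed.

Lemma quotient_dim_trans (U V W : set F) d e :
  subspace U -> subspace V -> subspace W ->
  (forall z, U z -> V z) -> (forall z, V z -> W z) ->
  quotient_dim iota V U d -> quotient_dim iota W V e ->
  quotient_dim iota W U (d + e).
Proof.
move=> sU sV sW UV VW hd he.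
have indd := quotient_dim_independent sV sU hd.
have inde := quotient_dim_independent sW sV he.
case: hd indd => b [Vb bP] _; case: he inde => b' [Wb' b'P] _.
pose bb (i : 'I_(d + e)) := match fintype.split i with inl j => b j | inr j => b' j end.
have bbE (c : {ffun 'I_(d + e) -> K}) : \sum_i iota (c i) * bb i =
    \sum_i iota ([ffun i => c (lshift e i)] i) * b i +
    \sum_i iota ([ffun i => c (rshift d i)] i) * b' i.
  rewrite big_split_ord; congr (_ + _); apply: eq_bigr => i _; rewrite ffunE /bb.
    by case: split_ordP => j /eqP; rewrite (eq_lshift, eq_lrshift) // => /eqP->.
  by case: split_ordP => j /eqP; rewrite (eq_rlshift, eq_rshift) // => /eqP->.
exists bb; split.
  by move=> i; rewrite /bb; case: fintype.split => j; [apply: VW|].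
move=> z Wz; have [c' [c'P c'U]] := b'P z Wz.
have [c [cP cU]] := bP _ c'P.
exists [ffun i => match fintype.split i with inl j => c j | inr j => c' j end].
split.
  rewrite bbE opprD addrA addrAC.
  congr (U (z - _ - _)): cP; apply: eq_bigr=> i _; rewrite !ffunE.
    by rewrite -[rshift _ _]/(unsplit (inr _)) unsplitK.
  by rewrite -[lshift _ _]/(unsplit (inl _)) unsplitK.
move=> f; rewrite bbE opprD addrA addrAC => fP.
have e1 : c' = [ffun i => f (rshift d i)].
  apply: c'U.
  have VV : V (\sum_i iota ([ffun i => f (lshift e i)] i) * b i) by exact: subspace_sum.
  by have := subspace_add sV (UV _ fP) VV; rewrite subrK.
have e2 : c = [ffun i => f (lshift e i)] by apply: cU; rewrite e1.
apply/ffunP=> i; rewrite ffunE; case: split_ordP => j ->.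
  by rewrite e2 ffunE.
by rewrite e1 ffunE.
Qed.

Lemma quotient_dim_fin (V W : set F) (I : finType) (b : I -> F) :
  (forall i, V (b i)) ->
  (forall z, V z -> exists! c : {ffun I -> K}, W (z - \sum_i iota (c i) * b i)) ->
  quotient_dim iota V W #|I|.
Proof.
move=> Vb bP; exists (fun i => b (enum_val i)); split=> // z /bP[c [cP cU]].
have sumE (e : {ffun 'I_#|I| -> K}) : \sum_i iota (e i) * b (enum_val i) =
    \sum_i iota ([ffun i => e (enum_rank i)] i) * b i.
  rewrite (reindex (@enum_rank I)) /=; last first.
    by exists enum_val => i _; rewrite ?enum_rankK ?enum_valK.
  by apply: eq_bigr=> i _; rewrite ffunE enum_rankK.
exists [ffun i => c (enum_val i)]; split.
  rewrite sumE (_ : [ffun _ => _] = c) //.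
  by apply/ffunP=> i; rewrite !ffunE enum_rankK.
move=> e; rewrite sumE => /cU ->.
by apply/ffunP=> i; rewrite !ffunE enum_valK.
Qed.

End QuotientDimension.

(** * Weights and norms in the coordinate ring *)

Section WeightedDegree.
Variables (K : fieldType) (q d : nat) (beta : {poly K}).
Hypotheses (q_gt1 : (1 < q)%N) (d_gt0 : (0 < d)%N) (co_qd : coprime q d).
Hypothesis (size_beta : size beta = d.+1).

Let q_gt0 : (0 < q)%N. Proof. exact: ltnW. Qed.

(* The substitution [x := X ^ q, Y := Y X ^ d]; the new variable [X], which is
   the outer one, records the weighted_degree. *)
Definition weight_poly : {rmorphism {poly {poly K}} -> {poly {poly K}}} :=
  horner_eval ('X%:P * 'X^d) \o map_poly (map_poly polyC \o comp_poly 'X^q).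

(** For reduced [u] this will be the order of the pole of [u(x, y)] at infinity, where [x] and [y]
    have poles of orders [q] and [d]. The zero polynomial gets 0. *)
Definition weighted_degree (u : {poly {poly K}}) : nat := (size (weight_poly u)).-1.

Definition curve_poly : {poly {poly K}} := 'X^q - 'X - beta%:P.

Definition is_reduced (u : {poly {poly K}}) : bool := (size u <= q)%N.

Definition reduce_mod (u : {poly {poly K}}) := Pdiv.Ring.rmodp u curve_poly.

Lemma coef_weight_poly u m j :
  (weight_poly u)`_m`_j =
  if (d * j <= m)%N && (q %| m - d * j)%N then u`_j`_((m - d * j) %/ q) else 0.
Proof.
rewrite /weight_poly /= /horner_eval.
rewrite (@horner_coef_wide _ (maxn (size u) j.+1)); last first.
  by rewrite (leq_trans (size_poly _ _)) // leq_maxl.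
rewrite coef_sum coef_sum.
have jlt : (j < maxn (size u) j.+1)%N by rewrite leq_max ltnSn orbT.
rewrite (bigD1 (Ordinal jlt)) //= big1 ?addr0 => [|i nij].
  rewrite coef_map_id0 /=; last by rewrite comp_poly0 rmorph0.
  rewrite exprMn -exprM -rmorphXn mulrA coefMXn ltnNge.
  case: leqP => //= le_djm; last by rewrite coef0.
  by rewrite coefMC coef_map /= coefCM coefXn eqxx mulr1 coef_comp_poly_Xn.
rewrite coef_map_id0 /=; last by rewrite comp_poly0 rmorph0.
rewrite exprMn -exprM -rmorphXn mulrA coefMXn; case: ifP; first by rewrite coef0.
rewrite coefMC coef_map /= coefCM coefXn.
have /negbTE-> : j != i; last by rewrite mulr0.
by apply: contra nij => /eqP e; apply/eqP/val_inj/esym.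
Qed.

Lemma coef_weight_poly_monomial u i j : (weight_poly u)`_(q * i + d * j)`_j = u`_j`_i.
Proof.
by rewrite coef_weight_poly leq_addl addnK dvdn_mulr // mulKn.
Qed.

Lemma weight_poly_eq0 u : (weight_poly u == 0) = (u == 0).
Proof.
apply/eqP/eqP => [u0|->]; last by rewrite rmorph0.
by apply/polyP=> j; apply/polyP=> i; rewrite -coef_weight_poly_monomial u0 !coef0.
Qed.

Lemma weight_le u m :
  (weighted_degree u <= m)%N <-> (forall i j, u`_j`_i != 0 -> (q * i + d * j <= m)%N).
Proof.
have -> : (weighted_degree u <= m)%N = (size (weight_poly u) <= m.+1)%N.
  by rewrite /weighted_degree; case: (size _).
split=> [/leq_sizeP le_um i j|le_um].
  apply: contraR; rewrite -ltnNge => lt_m.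
  by rewrite -coef_weight_poly_monomial le_um // coef0.
apply/leq_sizeP => l lt_ml; apply/polyP=> j; rewrite coef0 coef_weight_poly.
case: ifP => // /andP[le_djl q_dv]; apply/eqP/negP => /negP/le_um.
by rewrite mulnC divnK // subnK // leqNgt lt_ml.
Qed.

Lemma weight_eq_inj i j i' j' : (j < q)%N -> (j' < q)%N ->
  (q * i + d * j = q * i' + d * j')%N -> i = i' /\ j = j'.
Proof.
move=> jq j'q e.
(* Modulo [q] only the terms in [d] remain, and [d] is invertible there. *)
have key a b : (b < q)%N -> (a <= b)%N -> d * a = d * b %[mod q] -> a = b.
  move=> bq le_ab /eqP; rewrite eq_sym eqn_mod_dvd ?leq_mul2l ?le_ab ?orbT //.
  rewrite -mulnBr Gauss_dvdr // => q_dv; apply/eqP; rewrite eqn_leq le_ab /=.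
  rewrite -subn_eq0 -[_ == _]negbK -lt0n; apply/negP => /dvdn_leq/(_ q_dv).
  by rewrite leqNgt (leq_ltn_trans (leq_subr _ _)).
have ejj : j = j'.
  have cong : d * j = d * j' %[mod q].
    by move/(congr1 (modn^~ q)): e; rewrite !(mulnC q) !modnMDl.
  have [le|/ltnW le] := leqP j j'; first exact: key cong.
  exact/esym/(key _ _ jq le (esym cong)).
split=> //; move: e; rewrite ejj => /addIn /eqP.
by rewrite eqn_mul2l -[q == 0%N]negbK -lt0n q_gt0 => /eqP.
Qed.

(* Since [q] and [d] are coprime, a polynomial of degree less than [q] in [Y] has at
   most one monomial of any given weighted_degree. *)
Lemma reduced_top u : is_reduced u -> u != 0 -> exists i j,
  [/\ weighted_degree u = (q * i + d * j)%N, (j < q)%N, u`_j`_i != 0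
    & lead_coef (weight_poly u) = u`_j`_i *: 'X^j].
Proof.
move=> ru u0; have lc0 : lead_coef (weight_poly u) != 0.
  by rewrite lead_coef_eq0 weight_poly_eq0.
have mono m : {j | forall j', (weight_poly u)`_m`_j' != 0 -> j' = j}.
  have key j1 j2 : (weight_poly u)`_m`_j1 != 0 -> (weight_poly u)`_m`_j2 != 0 -> j1 = j2.
    rewrite !coef_weight_poly.
    case: andP => [[le1 dv1] h1|]; last by rewrite eqxx.
    case: andP => [[le2 dv2] h2|]; last by rewrite eqxx.
    have lt j i : u`_j`_i != 0 -> (j < q)%N.
      apply: contraR; rewrite -leqNgt => lqj.
      by rewrite (nth_default _ (leq_trans ru lqj)) coef0.
    have [] // := @weight_eq_inj ((m - d * j1) %/ q) j1 ((m - d * j2) %/ q) j2.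
    - exact: lt h1.
    - exact: lt h2.
    - by rewrite ![(q * _)%N]mulnC !divnK // !subnK.
  exists (size ((weight_poly u)`_m)).-1 => j' h; apply: key => //.
  rewrite -/(lead_coef _) lead_coef_eq0; apply: contraNneq h => ->.
  by rewrite coef0.
have [j jU] := mono (weighted_degree u).
have lcj : (weight_poly u)`_(weighted_degree u) = (weight_poly u)`_(weighted_degree u)`_j *: 'X^j.
  apply/polyP=> j'; rewrite coefZ coefXn.
  have [->|nj] := eqVneq j' j; first by rewrite mulr1.
  by rewrite mulr0; apply/eqP; apply: contraNT nj => /jU->.
have lcE : lead_coef (weight_poly u) = (weight_poly u)`_(weighted_degree u)`_j *: 'X^j.
  by rewrite lead_coefE -/(weighted_degree u).
have : (weight_poly u)`_(weighted_degree u)`_j != 0.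
  by apply: contraNneq lc0 => c0; rewrite lcE c0 scale0r.
rewrite {}lcE coef_weight_poly.
case: andP => [[le dv] ne0|]; last by rewrite eqxx.
exists ((weighted_degree u - d * j) %/ q)%N, j; split=> //.
- by rewrite mulnC divnK // subnK.
- apply: contraR ne0; rewrite -leqNgt => lqj.
  by rewrite (nth_default _ (leq_trans ru lqj)) coef0.
Qed.

Lemma weightB_le u v m : (weighted_degree u <= m)%N -> (weighted_degree v <= m)%N -> (weighted_degree (u - v) <= m)%N.
Proof.
rewrite !weight_le => hu hv i j; rewrite !coefB => h.
have [u0|u0] := eqVneq (u`_j`_i) 0; last exact: hu.
by apply: hv; apply: contraNneq h => v0; rewrite u0 v0 subr0.
Qed.

Lemma weightN u : weighted_degree (- u) = weighted_degree u.
Proof. by rewrite /weighted_degree rmorphN size_polyN. Qed.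

Lemma weight_monomial c i j : c != 0 ->
  weighted_degree ((c *: 'X^i) *: 'X^j) = (q * i + d * j)%N.
Proof.
move=> c0; have cf j' i' : ((c *: 'X^i) *: 'X^j : {poly {poly K}})`_j'`_i' =
    if (j' == j) && (i' == i) then c else 0.
  rewrite coefZ coefXn; case: eqP => _; rewrite ?mulr1 ?mulr0 ?coef0 //.
  by rewrite coefZ coefXn; case: eqP => _; rewrite ?mulr1 ?mulr0.
apply/eqP; rewrite eqn_leq; apply/andP; split.
  apply/weight_le => i' j'; rewrite cf; case: andP => [[/eqP-> /eqP->] //|].
  by rewrite eqxx.
by have /weight_le := leqnn (weighted_degree ((c *: 'X^i) *: 'X^j)); apply; rewrite cf !eqxx.
Qed.

Lemma reduced_monomial c i j : (j < q)%N -> is_reduced ((c *: 'X^i) *: 'X^j).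
Proof.
by move=> jq; apply: leq_trans (size_scale_leq _ _) _; rewrite size_polyXn.
Qed.

Lemma weightZ c u : (weighted_degree (c%:P *: u) <= weighted_degree u)%N.
Proof.
apply/weight_le => i j; rewrite coefZ coefCM => h.
have := leqnn (weighted_degree u); rewrite {1}weight_le; apply.
by apply: contraNneq h => ->; rewrite mulr0.
Qed.

Lemma reducedB u v : is_reduced u -> is_reduced v -> is_reduced (u - v).
Proof.
by move=> ru rv; rewrite /is_reduced (leq_trans (size_polyD _ _)) // size_polyN geq_max; apply/andP.
Qed.

Lemma reducedZ c u : is_reduced u -> is_reduced (c *: u).
Proof. by move=> ru; apply: leq_trans ru; apply: size_scale_leq. Qed.

(** Equal weights force equal leading monomials, so a constant multiple removes the top. This is why
    the residue field at infinity is [K]. *)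
Lemma weight_cancel u v : is_reduced u -> is_reduced v -> u != 0 -> v != 0 ->
  weighted_degree u = weighted_degree v ->
  exists2 c : K, c != 0 & u - c%:P *: v = 0 \/ (weighted_degree (u - c%:P *: v) < weighted_degree u)%N.
Proof.
move=> ru rv u0 v0 e.
have [i [j [wu jq uij lu]]] := reduced_top ru u0.
have [i' [j' [wv j'q vij lv]]] := reduced_top rv v0.
have [ei ej] := weight_eq_inj jq j'q (etrans (esym wu) (etrans e wv)).
subst i' j'.
exists (u`_j`_i / v`_j`_i); first by rewrite mulf_neq0 // invr_neq0.
set w := u - _.
have [->|w0] := eqVneq w 0; first by left.
right.
have le : (weighted_degree w <= weighted_degree u)%N.
  by apply: weightB_le => //; rewrite e; apply: weightZ.
rewrite ltn_neqAle le andbT; apply/negP => /eqP ew.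
have rw : is_reduced w by apply: reducedB => //; apply: reducedZ.
have [i1 [j1 [ww j1q wij _]]] := reduced_top rw w0.
have [ei ej] := weight_eq_inj j1q jq (etrans (esym ww) (etrans ew wu)).
by move: wij; rewrite ei ej coefB coefZ coefB coefCM divfK // subrr eqxx.
Qed.

Lemma size_curve_poly : size curve_poly = q.+1.
Proof.
rewrite /curve_poly -addrA -opprD size_polyDl ?size_polyXn // size_polyN.
rewrite (leq_ltn_trans (size_polyD _ _)) // gtn_max size_polyX ltnS q_gt1.
by rewrite (leq_ltn_trans (size_polyC_leq1 _)) // ltnS ltnW.
Qed.

Lemma curve_poly_monic : curve_poly \is monic.
Proof.
rewrite monicE /lead_coef size_curve_poly /= !coefB coefXn eqxx coefX coefC.
by rewrite gtn_eqF // gtn_eqF // !subr0.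
Qed.

Lemma reduced_red u : is_reduced (reduce_mod u).
Proof.
have := Pdiv.Ring.ltn_rmodp u curve_poly; rewrite monic_neq0 ?curve_poly_monic //.
by rewrite size_curve_poly ltnS.
Qed.

Lemma red_id u : is_reduced u -> reduce_mod u = u.
Proof. by move=> ru; rewrite /reduce_mod Pdiv.Ring.rmodp_small // size_curve_poly. Qed.

Lemma redE u : u = Pdiv.Ring.rdivp u curve_poly * curve_poly + reduce_mod u.
Proof. exact: (Pdiv.RingMonic.rdivp_eq curve_poly_monic). Qed.

Lemma red_uniq u v w : is_reduced w -> u = v * curve_poly + w -> reduce_mod u = w.
Proof.
move=> rw ->; apply: (Pdiv.RingMonic.rmodp_addl_mul_small curve_poly_monic).
by rewrite size_curve_poly.
Qed.

(** Since [l] is nonzero, ['X^q - l%:P] is coprime to ['X]. This keeps a multiple of [curve_poly]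
    from having the same top as a reduced polynomial or a product of two. *)
Lemma monomial_no_multiple (c l : K) J (t : {poly K}) :
  c != 0 -> l != 0 -> c *: 'X^J = ('X^q - l%:P) * t -> False.
Proof.
move=> c0 l0 e.
have co : coprimep ('X^q - l%:P) (c *: 'X^J).
  rewrite coprimepZr // coprimep_expr // coprimepX /root !hornerE.
  by rewrite expr0n -[q == 0%N]negbK -lt0n q_gt0 sub0r oppr_eq0.
have dv : 'X^q - l%:P %| c *: 'X^J by rewrite e dvdp_mulr.
have := coprimep_dvdl dv co.
by rewrite coprimepp size_XnsubC // => /eqP[q0]; move: q_gt0; rewrite q0.
Qed.

Let l := lead_coef beta.

Let l_neq0 : l != 0.
Proof. by rewrite lead_coef_eq0 -size_poly_gt0 size_beta. Qed.

Lemma weight_curve_poly : (size (weight_poly curve_poly) = (q * d).+1)%N /\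
  lead_coef (weight_poly curve_poly) = 'X^q - l%:P.
Proof.
have cf j i : curve_poly`_j`_i =
    ((j == q) && (i == 0%N))%:R - ((j == 1%N) && (i == 0%N))%:R
    - if j == 0%N then beta`_i else 0.
  rewrite /curve_poly !coefB coefXn coefX coefC.
  congr (_ - _ - _); last by case: eqP => //; rewrite coef0.
    by case: eqP => /= _; rewrite ?coef1 ?coef0.
  by case: eqP => /= _; rewrite ?coef1 ?coef0.
have lc : (weight_poly curve_poly)`_(q * d) = 'X^q - l%:P.
  apply/polyP=> j; rewrite coef_weight_poly cf [RHS]coefB coefXn coefC.
  have [->|j0] := eqVneq j 0%N.
    rewrite muln0 subn0 leq0n dvdn_mulr // mulKn //=.
    by rewrite eq_sym gtn_eqF //= subr0 /l lead_coefE size_beta.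
  have [->|jq] := eqVneq j q.
    by rewrite mulnC leqnn subnn dvdn0 div0n eqxx /= gtn_eqF //= !subr0.
  rewrite /= !(mulr0n, sub0r, subr0, oppr0); case: ifP => // /andP[h1 h2].
  have [j1|_] := eqVneq j 1%N; last by rewrite mulr0n oppr0.
  (* The term [- Y] of weight [d] would interfere only if [q] divided [q * d - d], hence [q - 1]. *)
  rewrite j1 muln1 in h1 h2 *; move: h2.
  rewrite -{2}[d]mul1n -mulnBl Gauss_dvdl // => /dvdn_leq.
  by rewrite subn_gt0 q_gt1 => /(_ isT); rewrite leqNgt subn1 ltn_predL q_gt0.
have lc0 : 'X^q - l%:P != 0 :> {poly K} by rewrite -size_poly_gt0 size_XnsubC.
have sz : size (weight_poly curve_poly) = (q * d).+1.
  apply/eqP; rewrite eqn_leq; apply/andP; split; last first.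
    rewrite ltnNge; apply: contra lc0 => /leq_sizeP/(_ _ (leqnn _)).
    by rewrite lc => ->.
  apply/leq_sizeP => m lt_m; apply/polyP=> j; rewrite coef_weight_poly coef0 cf.
  case: ifP => // /andP[le1 dv].
  have [j0|j0] := eqVneq j 0%N.
    move: dv; rewrite j0 muln0 subn0 eq_sym gtn_eqF //= => dv.
    by rewrite nth_default ?subr0 // size_beta ltn_divRL // mulnC.
  have [le_jq|lt_qj] := leqP j q.
    rewrite (_ : ((m - d * j) %/ q == 0)%N = false); last first.
      apply/negbTE; rewrite -lt0n divn_gt0 //; apply: dvdn_leq => //.
      by rewrite subn_gt0 (leq_ltn_trans _ lt_m) // mulnC leq_mul.
    by rewrite !andbF !subr0.
  by rewrite (gtn_eqF lt_qj) (gtn_eqF (ltn_trans q_gt1 lt_qj)) !subr0.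
by split=> //; rewrite lead_coefE sz.
Qed.

(** This is the multiplicativity of the valuation at infinity. The top of [u * v] is a monomial in
    [Y], the top of a multiple of [curve_poly] is a multiple of ['X^q - l%:P], so the top of [u * v]
    survives in the remainder. *)
Lemma weight_redM u v : is_reduced u -> is_reduced v -> u != 0 -> v != 0 ->
  reduce_mod (u * v) != 0 /\ weighted_degree (reduce_mod (u * v)) = (weighted_degree u + weighted_degree v)%N.
Proof.
move=> ru rv u0 v0.
have [i [j [wu jq uij lu]]] := reduced_top ru u0.
have [i' [j' [wv j'q vij lv]]] := reduced_top rv v0.
set w := reduce_mod (u * v); have rw : is_reduced w by exact: reduced_red.
set t := Pdiv.Ring.rdivp (u * v) curve_poly.
have E : weight_poly u * weight_poly v = weight_poly t * weight_poly curve_poly + weight_poly w.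
  by rewrite -!rmorphM -rmorphD; congr (weight_poly _); apply: redE.
have [szA lcA] := weight_curve_poly.
have pu0 : weight_poly u != 0 by rewrite weight_poly_eq0.
have pv0 : weight_poly v != 0 by rewrite weight_poly_eq0.
have lcuv : lead_coef (weight_poly u * weight_poly v) = (u`_j`_i * v`_j'`_i') *: 'X^(j + j').
  by rewrite lead_coefM lu lv -scalerAl -scalerAr scalerA exprD.
have szuv : size (weight_poly u * weight_poly v) = (weighted_degree u + weighted_degree v).+1.
  rewrite size_mul // /weighted_degree; move: pu0 pv0; rewrite -!size_poly_gt0.
  by case: (size _) => // a _; case: (size _) => // b _; rewrite /= addnS.
suff sz : size (weight_poly w) = (weighted_degree u + weighted_degree v).+1.
  split; last by rewrite /weighted_degree sz.
  by rewrite -weight_poly_eq0 -size_poly_gt0 sz.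
have [t0|t0] := eqVneq t 0.
  by rewrite -szuv E t0 rmorph0 mul0r add0r.
set a := weight_poly t * _ in E; set b := weight_poly w in E *.
have lca : lead_coef a = ('X^q - l%:P) * lead_coef (weight_poly t).
  by rewrite lead_coefM lcA mulrC.
case: (ltngtP (size a) (size b)) => [lt_ab|lt_ba|eq_ab].
- by rewrite -szuv E addrC size_polyDl.
- exfalso; have := lead_coefDl lt_ba; rewrite -E lcuv lca.
  by apply: monomial_no_multiple => //; rewrite mulf_neq0.
- case: (ltngtP (size b) (weighted_degree u + weighted_degree v).+1) => //.
  + rewrite -szuv E => lt_b; exfalso; move: lt_b; rewrite ltnNge.
    by rewrite (leq_trans (size_polyD _ _)) // eq_ab maxnn.
  (* Here the tops of the multiple of [curve_poly] and of the remainder would cancel; but the latter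
     is a monomial, the remainder being reduced. *)
  + move=> lt_uv; exfalso.
    have w0 : w != 0.
      rewrite -weight_poly_eq0 -size_poly_gt0; exact: leq_ltn_trans lt_uv.
    have [i1 [j1 [_ _ wij lw]]] := reduced_top rw w0.
    have : lead_coef b = lead_coef (- a).
      rewrite -(addKr a b) -E lead_coefDl // size_polyN szuv.
      by rewrite eq_ab.
    rewrite lead_coefN lca lw -mulrN; apply: monomial_no_multiple => //.
Qed.

End WeightedDegree.

(** * The norm from the coordinate ring to [K[x]] *)

Section Norm.
Variables (K : finFieldType) (q d : nat) (beta : {poly K}).
Hypotheses (q_gt1 : (1 < q)%N) (d_gt0 : (0 < d)%N) (co_qd : coprime q d).
Hypothesis (size_beta : size beta = d.+1).
Hypothesis (q_pchar : [pchar K].-nat q).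
Hypothesis (card_fixed : #|[pred b : K | b ^+ q == b]| = q).

Local Notation A := (curve_poly q beta).
Local Notation red := (reduce_mod q beta).
Local Notation reduced := (@is_reduced K q).

Let A_monic := curve_poly_monic beta q_gt1.

Lemma red_mulr u v : red (u * red v) = red (u * v).
Proof. exact: (Pdiv.RingMonic.rmodp_mulmr A_monic). Qed.

Lemma red_mull u v : red (red u * v) = red (u * v).
Proof. by rewrite ![_ * v]mulrC red_mulr. Qed.

(** The coordinate ring is an integral domain, because weights add up. *)
Lemma redM_neq0 u v : red u != 0 -> red v != 0 -> red (u * v) != 0.
Proof.
move=> u0 v0; rewrite -red_mulr -red_mull.
have ru : reduced (red u) by exact: reduced_red.
have rv : reduced (red v) by exact: reduced_red.
by case: (weight_redM q_gt1 co_qd size_beta ru rv u0 v0).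
Qed.

Let q_pchar2 : [pchar {poly {poly K}}].-nat q.
Proof. by rewrite (eq_pnat _ (@pchar_poly _)) (eq_pnat _ (@pchar_poly _)). Qed.

Definition shift (b : K) (u : {poly {poly K}}) := u \Po ('X + b%:P%:P).

Lemma shift_curve_poly b : b ^+ q = b -> shift b A = A.
Proof.
move=> bq; rewrite /shift /curve_poly !raddfB /= comp_polyC comp_polyX comp_Xn_poly.
by rewrite exprDn_pchar // -!rmorphXn bq opprD addrA addrAC addrK.
Qed.

Lemma size_shift b u : size (shift b u) = size u.
Proof. by rewrite /shift size_comp_poly2 // size_XaddC. Qed.

Lemma red_shift b u : b ^+ q = b -> red (shift b u) = shift b (red u).
Proof.
move=> bq; apply: (red_uniq q_gt1 (v := shift b (Pdiv.Ring.rdivp u A))).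
  by rewrite /is_reduced size_shift; apply: reduced_red.
rewrite {1}(redE beta q_gt1 u) /shift rmorphD rmorphM /=.
by congr (_ * _ + _); apply: shift_curve_poly.
Qed.

(* The norm from [K(x, y)] down to [K(x)]: the conjugates of [y] are the [y + b]
   with [b ^+ q = b]. *)
Lemma norm_exists u : reduced u -> u != 0 ->
  exists v c, c != 0 /\ red (u * v) = c%:P.
Proof.
move=> ru u0; pose S := [pred b : K | b ^+ q == b].
pose N := \prod_(b in S) shift b u.
have S0 : 0 \in S by rewrite inE expr0n -[q == 0%N]negbK -lt0n (ltnW q_gt1).
have N0 : red N != 0.
  rewrite /N; apply: (big_ind (fun u => red u != 0)) => [|v w|b _].
  - by rewrite red_id ?oner_eq0 // /is_reduced size_poly1; apply: ltnW.
  - exact: redM_neq0.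
  - rewrite red_id ?/is_reduced ?size_shift //.
    by rewrite -size_poly_gt0 size_shift size_poly_gt0.
have shN b : b \in S -> shift b (red N) = red N.
  move=> Sb; have bq : b ^+ q = b by exact/eqP.
  rewrite -red_shift //; congr red.
  rewrite /N /shift rmorph_prod /= [RHS](reindex_inj (addrI b)) /=.
  apply: eq_big => [c|c Sc].
    rewrite !inE exprDn_pchar // bq.
    by rewrite (can_eq (addKr b)).
  rewrite -comp_polyA comp_polyD comp_polyX comp_polyC.
  by rewrite -addrA -!rmorphD /=.
exists (\prod_(b in S | b != 0) shift b u), (red N).[0].
(* Invariance under the translations [Y := Y + b] makes [red N] take its value at 0 at [q] points,
   while its degree in [Y] is less than [q]. *)
have cE : red N = (red N).[0]%:P.
  apply/eqP; rewrite -subr_eq0; apply/eqP.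
  apply: (@roots_geq_poly_eq0 _ _ [seq b%:P | b <- enum S]).
  - apply/allP => z /mapP[b bS ->{z}]; have Sb : b \in S by rewrite -mem_enum.
    rewrite /root !hornerE subr_eq0 -[in X in _ == X](shN b Sb) /shift.
    by rewrite horner_comp !hornerE.
  - by rewrite map_inj_uniq ?enum_uniq //; apply: polyC_inj.
  - rewrite size_map -cardE card_fixed.
    have rN : (size (red N) <= q)%N by exact: reduced_red.
    rewrite (leq_trans (size_polyD _ _)) // geq_max rN /=.
    by rewrite size_polyN (leq_trans (size_polyC_leq1 _)) // ltnW.
split.
  by apply: contraNneq N0 => c0; rewrite cE c0.
rewrite -cE /N [in RHS](bigD1 0) //=; congr (red (_ * _)).
by rewrite /shift (_ : (0 : K)%:P%:P = 0) ?addr0 ?comp_polyXr // !polyC0.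
Qed.

End Norm.

(** * Places of the function field *)

Section Places.
Variables (K F : fieldType) (iota : {rmorphism K -> F}).
Implicit Types (P : place iota) (z w : F).

Lemma placeM P z w : z != 0 -> w != 0 -> P (z * w) = P z + P w.
Proof. by case: (place_valP P) => _ + _ _ _; apply. Qed.

Lemma placeC P c : P (iota c) = 0.
Proof. by case: (place_valP P). Qed.

Lemma place1 P : P 1 = 0.
Proof. by rewrite -(rmorph1 iota) placeC. Qed.

Lemma placeX P z n : z != 0 -> P (z ^+ n) = P z *+ n.
Proof.
move=> z0; elim: n => [|n IH]; first by rewrite expr0 place1 mulr0n.
by rewrite exprS placeM ?expf_neq0 // IH mulrS.
Qed.

Lemma placeV P z : P z^-1 = - P z.
Proof.
have [->|z0] := eqVneq z 0.
  by rewrite invr0; case: (place_valP P) => ->; rewrite oppr0.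
by apply/eqP; rewrite -addr_eq0 -placeM ?invr_neq0 // mulVf // place1.
Qed.

Lemma placeN P z : P (- z) = P z.
Proof.
have [->|z0] := eqVneq z 0; first by rewrite oppr0.
rewrite -mulN1r placeM // ?oppr_eq0 ?oner_eq0 //.
by rewrite -[X in P (- X)](rmorph1 iota) -rmorphN placeC add0r.
Qed.

(** Reads as [m <= P z] with the convention that the value at 0 is infinite, in place of the
    placeholder value 0. *)
Definition val_ge P (m : int) z : Prop := z = 0 \/ m <= P z.

Lemma val_ge_le P m m' z : m' <= m -> val_ge P m z -> val_ge P m' z.
Proof. by move=> le [->|h]; [left | right; apply: le_trans h]. Qed.

Lemma val_geD P m z w : val_ge P m z -> val_ge P m w -> val_ge P m (z + w).
Proof.
have [->|z0] := eqVneq z 0; first by rewrite add0r.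
have [->|w0] := eqVneq w 0; first by rewrite addr0.
have [->|zw0] := eqVneq (z + w) 0; first by left.
case=> [/eqP|hz]; first by rewrite (negbTE z0).
case=> [/eqP|hw]; first by rewrite (negbTE w0).
right; case: (place_valP P) => _ _ + _ _ => /(_ z w z0 w0 zw0).
by apply: le_trans; rewrite le_min hz.
Qed.

Lemma val_geM P m m' z w : val_ge P m z -> val_ge P m' w -> val_ge P (m + m') (z * w).
Proof.
have [->|z0] := eqVneq z 0; first by rewrite mul0r; left.
have [->|w0] := eqVneq w 0; first by rewrite mulr0; left.
case=> [/eqP|hz]; first by rewrite (negbTE z0).
case=> [/eqP|hw]; first by rewrite (negbTE w0).
by right; rewrite placeM // lerD.
Qed.

Lemma val_geC P c : val_ge P 0 (iota c).
Proof. by right; rewrite placeC. Qed.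

Lemma val_geN P m z : val_ge P m z -> val_ge P m (- z).
Proof. by case=> [->|h]; [left; rewrite oppr0 | right; rewrite placeN]. Qed.

Lemma val_geB P m z w : val_ge P m z -> val_ge P m w -> val_ge P m (z - w).
Proof. by move=> hz hw; apply: val_geD => //; apply: val_geN. Qed.

Lemma val_geX P z n : val_ge P 0 z -> val_ge P 0 (z ^+ n).
Proof.
move=> hz; elim: n => [|n IH]; first by right; rewrite expr0 place1.
by rewrite exprS -[0]addr0; apply: val_geM.
Qed.

Lemma val_ge_sum P m (I : Type) (s : seq I) (Q : pred I) (f : I -> F) :
  (forall i, Q i -> val_ge P m (f i)) -> val_ge P m (\sum_(i <- s | Q i) f i).
Proof.
move=> h; apply: (big_ind (val_ge P m)) => //; first by left.
exact: val_geD.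
Qed.

Lemma place_add_lt P z w : z != 0 -> val_ge P (P z + 1) w ->
  z + w != 0 /\ P (z + w) = P z.
Proof.
move=> z0 hw; have lt : ~ val_ge P (P z + 1) z.
  by case=> [/eqP|]; rewrite ?(negbTE z0) // lezD1 ltxx.
have zw0 : z + w != 0.
  apply: contra_notN lt => zw0.
  rewrite [X in val_ge _ _ X](_ : z = - w); first exact: val_geN.
  by apply/eqP; rewrite -addr_eq0 zw0.
split=> //; apply/eqP; rewrite eq_le; apply/andP; split; last first.
  have : val_ge P (P z) (z + w).
    apply: val_geD; first by right.
    by apply: val_ge_le hw; rewrite lerDl.
  by case=> // /eqP; rewrite (negbTE zw0).
rewrite leNgt; apply/negP => ltz; apply: lt.
have : val_ge P (P z + 1) (z + w) by right; rewrite lezD1.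
by move=> /val_geB/(_ hw); rewrite addrK.
Qed.

Lemma placeP P P' : (forall z, z != 0 -> P z = P' z) -> P = P'.
Proof.
case: P P' => v vP [v' v'P] /= e.
have evv : v = v'.
  apply/funext => z; have [->|/e//] := eqVneq z 0.
  by case: vP => -> _ _ _ _; case: v'P => ->.
by rewrite evv in vP *; congr Place; apply: Prop_irrelevance.
Qed.

End Places.

(** * Extension of a valuation to the field of fractions *)

Section ExtendValuation.
Variables (K F : fieldType) (iota : {rmorphism K -> F}).
Variables (R : comNzRingType) (f : {rmorphism R -> F}) (nu : R -> int).
Hypothesis frac : forall z : F, exists u w, f w != 0 /\ z = f u / f w.
Hypothesis nuM : forall u w, f u != 0 -> f w != 0 -> nu (u * w) = nu u + nu w.
Hypothesis nuD : forall u w, f u != 0 -> f w != 0 -> f (u + w) != 0 ->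
  Num.min (nu u) (nu w) <= nu (u + w).
Hypothesis nu_eq : forall u w, f u != 0 -> f u = f w -> nu u = nu w.
Hypothesis nuC : forall c, exists2 u, f u = iota c & nu u = 0.
Hypothesis nu1 : exists u w, [/\ f u != 0, f w != 0 & nu u - nu w = 1].

(** The value of [f u / f w] is [nu u - nu w]. The map [f] may have a kernel; [nu_eq] says that [nu]
    depends only on the image. It is applied at infinity and at the points of the affine curve. *)
Lemma extend_valuation : exists P : place iota, forall u, f u != 0 -> P (f u) = nu u.
Proof.
have vex z : exists m, (z = 0 -> m = 0) /\
    forall u w, f u != 0 -> f w != 0 -> z = f u / f w -> m = nu u - nu w.
  have [->|z0] := eqVneq z 0.
    exists 0; split=> // u w u0 w0 /esym/eqP.
    by rewrite mulf_eq0 (negbTE u0) invr_eq0 (negbTE w0).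
  have [u [w [w0 zE]]] := frac z.
  have u0 : f u != 0 by apply: contraNneq z0 => u0; rewrite zE u0 mul0r.
  exists (nu u - nu w); split=> [/eqP|u' w' u'0 w'0]; first by rewrite (negbTE z0).
  rewrite zE => /eqP; rewrite eqr_div // -!rmorphM => /eqP /nu_eq.
  rewrite rmorphM mulf_neq0 // => /(_ isT); rewrite !nuM // => e.
  by apply/eqP; rewrite subr_eq addrAC eq_sym subr_eq e.
have [v vP] := choice vex.
have vE z u w : f u != 0 -> f w != 0 -> z = f u / f w -> v z = nu u - nu w.
  by case: (vP z) => _; apply.
have fracn z : z != 0 -> exists u w, [/\ f u != 0, f w != 0 & z = f u / f w].
  move=> z0; have [u [w [w0 zE]]] := frac z; exists u, w; split=> //.
  by apply: contraNneq z0 => u0; rewrite zE u0 mul0r.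
have vM z w : z != 0 -> w != 0 -> v (z * w) = v z + v w.
  move=> /fracn[u1 [w1 [u10 w10 e1]]] /fracn[u2 [w2 [u20 w20 e2]]].
  rewrite (vE (z * w) (u1 * u2) (w1 * w2)) ?rmorphM ?mulf_neq0 //; last first.
    by rewrite e1 e2 mulf_div.
  rewrite (vE z _ _ _ _ e1) // (vE w _ _ _ _ e2) // !nuM //.
  by rewrite opprD addrACA.
have nu_1 : nu 1 = 0.
  have [u fu <-] := nuC 1; apply: nu_eq; first by rewrite rmorph1 oner_eq0.
  by rewrite fu !rmorph1.
have vf u : f u != 0 -> v (f u) = nu u.
  move=> u0; rewrite (vE _ u 1) ?rmorph1 ?oner_eq0 // ?divr1 //.
  by rewrite nu_1 subr0.
have is_v : is_place iota v.
  split=> //.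
  - by case: (vP 0) => ->.
  - move=> z w z0 w0 zw0.
    move: (z0) (w0) => /fracn[u1 [w1 [u10 w10 e1]]] /fracn[u2 [w2 [u20 w20 e2]]].
    have e1' : z = f (u1 * w2) / f (w1 * w2).
      by rewrite !rmorphM -mulf_div divff // mulr1.
    have e2' : w = f (u2 * w1) / f (w1 * w2).
      by rewrite [w1 * w2]mulrC !rmorphM -mulf_div divff // mulr1.
    set D := w1 * w2 in e1' e2'.
    have D0 : f D != 0 by rewrite rmorphM mulf_neq0.
    have n1 : f (u1 * w2) != 0 by rewrite rmorphM mulf_neq0.
    have n2 : f (u2 * w1) != 0 by rewrite rmorphM mulf_neq0.
    have e3 : z + w = f (u1 * w2 + u2 * w1) / f D by rewrite e1' e2' rmorphD mulrDl.
    have n3 : f (u1 * w2 + u2 * w1) != 0.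
      by apply: contraNneq zw0; rewrite e3 => ->; rewrite mul0r.
    rewrite (vE _ _ _ _ _ e3) // (vE _ _ _ _ _ e1') // (vE _ _ _ _ _ e2') //.
    rewrite lerBrDr; apply: le_trans (nuD n1 n2 n3).
    by rewrite le_min -!lerBrDr !ge_min !lexx orbT.
  - move=> c; have [->|c0] := eqVneq c 0; first by rewrite rmorph0; case: (vP 0) => ->.
    by have [u fu <-] := nuC c; rewrite -fu vf // fu fmorph_eq0.
  - have [u [w [u0 w0 e]]] := nu1; exists (f u / f w); split.
      by rewrite mulf_neq0 ?invr_eq0.
    by rewrite (vE _ u w).
by exists (Place is_v).
Qed.
End ExtendValuation.

Section PlaceSubspaces.
Variables (K : finFieldType) (F : fieldType) (iota : {rmorphism K -> F}).
Implicit Types (P : place iota).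

Lemma subspace_val_ge P m : subspace iota (val_ge P m).
Proof.
split=> [|c z w hz hw]; first by left.
by apply: val_geD => //; rewrite -[m]add0r; apply: val_geM => //; apply: val_geC.
Qed.

Lemma maximal_idealE P : maximal_ideal P = val_ge P 1.
Proof. by apply/seteqP; split=> z [->|h]; by [left|right]. Qed.

Lemma val_ge_maxE P z m : z != 0 -> val_ge P m z -> m <= P z.
Proof. by move=> z0 [/eqP|//]; rewrite (negbTE z0). Qed.

End PlaceSubspaces.

(** By [as_card_fixed], [K] contains the field with [q] elements, so that the conjugates of [y] are
    its translates by elements of [K]. By [as_card], powers of [#|K|] are powers of [q], for which
    [y] is raised to [y] plus a polynomial in [x]. *)
Record as_curve (K : finFieldType) (F : fieldType) (iota : {rmorphism K -> F})
    (q d : nat) (beta : {poly K}) (x y : F) : Prop := AsCurve {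
  as_q_gt1 : (1 < q)%N;
  as_co_qd : coprime q d;
  as_size_beta : size beta = d.+1;
  as_d_gt0 : (0 < d)%N;
  as_q_pchar : [pchar K].-nat q;
  as_card_fixed : #|[pred b : K | b ^+ q == b]| = q;
  as_card : exists2 n, (0 < n)%N & #|K| = (q ^ n)%N;
  as_transcendental : ~ algebraicOver iota x;
  as_generated : forall z : F, exists u w : {poly {poly K}},
        eval2 iota x y w != 0 /\ z = eval2 iota x y u / eval2 iota x y w;
  as_equation : y ^+ q - y = (map_poly iota beta).[x] }.

(** * The coordinate ring and the valuation at infinity *)

Section CoordinateRing.
Variables (K : finFieldType) (F : fieldType) (iota : {rmorphism K -> F}).
Variables (q d : nat) (beta : {poly K}) (x y : F).
Hypothesis C : as_curve iota q d beta x y.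

Let q_gt1 := as_q_gt1 C.
Let co_qd := as_co_qd C.
Let size_beta := as_size_beta C.
Let d_gt0 := as_d_gt0 C.
Let q_gt0 : (0 < q)%N. Proof. exact: ltnW. Qed.

Local Notation A := (curve_poly q beta).
Local Notation red := (reduce_mod q beta).
Local Notation weight := (weighted_degree q d).
Local Notation reduced := (@is_reduced K q).

Definition eval_x : {rmorphism {poly K} -> F} := horner_eval x \o map_poly iota.
Definition eval_xy : {rmorphism {poly {poly K}} -> F} := horner_eval y \o map_poly eval_x.

Arguments eval_x : simpl never.
Arguments eval_xy : simpl never.

Lemma eval2E u : eval2 iota x y u = eval_xy u.
Proof. by []. Qed.

Lemma ev1E c : eval_x c = \sum_(i < size c) iota c`_i * x ^+ i.
Proof.
rewrite /eval_x /= /horner_eval (@horner_coef_wide _ (size c)) ?size_poly //.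
by apply: eq_bigr => i _; rewrite coef_map.
Qed.

Lemma ev2E u : eval_xy u = \sum_(j < size u) eval_x u`_j * y ^+ j.
Proof.
rewrite -[LHS]/((map_poly eval_x u).[y]) (@horner_coef_wide _ (size u)) ?size_poly //.
by apply: eq_bigr => j _; rewrite coef_map.
Qed.

Lemma ev1C c : eval_x c%:P = iota c.
Proof. by rewrite /eval_x /= /horner_eval map_polyC hornerC. Qed.

Lemma ev1X : eval_x 'X = x.
Proof. by rewrite /eval_x /= /horner_eval map_polyX hornerX. Qed.

Lemma ev2C c : eval_xy c%:P = eval_x c.
Proof. by rewrite -[LHS]/((map_poly eval_x _).[y]) map_polyC hornerC. Qed.

Lemma ev2X : eval_xy 'X = y.
Proof. by rewrite -[LHS]/((map_poly eval_x _).[y]) map_polyX hornerX. Qed.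

Lemma ev2_monomial c i j :
  eval_xy ((c *: 'X^i) *: 'X^j) = iota c * x ^+ i * y ^+ j.
Proof.
have -> : (c *: 'X^i) *: 'X^j = (c%:P * 'X^i)%:P * 'X^j by rewrite !mul_polyC.
by rewrite (rmorphM eval_xy) ev2C (rmorphM eval_x) ev1C (rmorphXn eval_x) ev1X (rmorphXn eval_xy) ev2X.
Qed.

Lemma ev1_eq0 c : (eval_x c == 0) = (c == 0).
Proof.
apply/idP/idP => [|/eqP->]; last by rewrite rmorph0.
apply: contraTT => c0; apply/negP => /eqP e; apply: (as_transcendental C).
by exists c => //; apply/rootP.
Qed.

Lemma ev2_curve_poly : eval_xy A = 0.
Proof.
rewrite /curve_poly !rmorphB rmorphXn ev2X ev2C.
by rewrite (as_equation C) subrr.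
Qed.

Lemma ev2_red u : eval_xy (red u) = eval_xy u.
Proof.
by rewrite [in RHS](redE beta q_gt1 u) rmorphD rmorphM ev2_curve_poly mulr0 add0r.
Qed.

(** A nonzero reduced polynomial divides its nonzero norm in [K[x]], and [x] is transcendental; so
    [curve_poly] generates all relations between [x] and [y]. *)
Lemma ev2_eq0 u : (eval_xy u == 0) = (red u == 0).
Proof.
rewrite -ev2_red; apply/idP/idP => [|/eqP->]; last by rewrite rmorph0.
apply: contraTT => u0.
have [v [c [c0 e]]] := norm_exists q_gt1 co_qd size_beta (as_q_pchar C)
  (as_card_fixed C) (reduced_red beta q_gt1 u) u0.
apply: contraNneq c0 => e0; rewrite -ev1_eq0 -ev2C -e ev2_red rmorphM.
by rewrite e0 mul0r.
Qed.

Lemma ev2_reduced_eq0 u : reduced u -> (eval_xy u == 0) = (u == 0).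
Proof. by move=> ru; rewrite ev2_eq0 red_id. Qed.

Lemma reduced_ev2_inj u v : reduced u -> reduced v -> eval_xy u = eval_xy v -> u = v.
Proof.
move=> ru rv e; apply/eqP; rewrite -subr_eq0 -ev2_reduced_eq0; last exact: reducedB.
by rewrite rmorphB e subrr.
Qed.

(** Multiplying by the other conjugates of the denominator brings it into [K[x]]. *)
Lemma ev2_frac z : exists u c, [/\ reduced u, c != 0 & z = eval_xy u / eval_x c].
Proof.
have [u [w [w0 ->]]] := as_generated C z; rewrite !eval2E in w0 *.
have [v [c [c0 e]]] := norm_exists q_gt1 co_qd size_beta (as_q_pchar C)
  (as_card_fixed C) (reduced_red beta q_gt1 w) (etrans (esym (congr1 negb (ev2_eq0 w))) w0).
exists (red (u * v)), c; split=> //; first exact: reduced_red.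
have e' : eval_xy w * eval_xy v = eval_x c by rewrite -ev2C -e ev2_red rmorphM ev2_red.
have v0 : eval_xy v != 0.
  apply: contraNneq c0 => v0; rewrite -ev1_eq0 -e' v0 mulr0 //.
by rewrite ev2_red rmorphM -e' -mulf_div divff // mulr1.
Qed.

Lemma as_x_neq0 : x != 0.
Proof. by rewrite -ev1X ev1_eq0 polyX_eq0. Qed.

Lemma as_y_neq0 : y != 0.
Proof.
apply/eqP => y0; have := as_equation C; rewrite y0 expr0n gtn_eqF // subrr => /esym/eqP.
by rewrite -[_.[x]]/(eval_x beta) ev1_eq0 -size_poly_eq0 size_beta.
Qed.

Lemma infinite_place_exists : exists P : place iota,
  forall u, reduced u -> u != 0 -> P (eval_xy u) = - (weight u)%:Z.
Proof.
pose nu u : int := - (weight (red u))%:Z.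
have rr u : reduced (red u) by exact: reduced_red.
have nuM u w : eval_xy u != 0 -> eval_xy w != 0 -> nu (u * w) = nu u + nu w.
  rewrite !ev2_eq0 => u0 w0; rewrite /nu -opprD; congr (- _).
  have [_] := weight_redM q_gt1 co_qd size_beta (rr u) (rr w) u0 w0.
  by rewrite red_mulr // red_mull // => ->; rewrite PoszD.
have nu1 : nu 1 = 0.
  have := nuM 1 1; rewrite mulr1 rmorph1 oner_neq0 => /(_ isT isT) /eqP.
  by rewrite -subr_eq0 opprD addNKr oppr_eq0 => /eqP.
have nuX u n : eval_xy u != 0 -> nu (u ^+ n) = nu u *+ n.
  move=> u0; elim: n => [|n IH]; last by rewrite exprS nuM ?rmorphXn ?expf_neq0 // IH mulrS.
  by rewrite expr0 mulr0n -nu1.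
have nuE c i j : c != 0 -> (j < q)%N ->
    nu ((c *: 'X^i) *: 'X^j) = - (q * i + d * j)%N%:Z.
  by move=> c0 jq; rewrite /nu red_id ?reduced_monomial // weight_monomial.
have [P PE] : exists P : place iota, forall u, eval_xy u != 0 -> P (eval_xy u) = nu u.
  apply: extend_valuation => //.
  - exact: as_generated C.
  - move=> u w u0 w0 uw0; rewrite /nu -oppr_max lerN2.
    have -> : red (u + w) = red u - - red w.
      by rewrite /reduce_mod (Pdiv.RingMonic.rmodpD (curve_poly_monic _ _)) // opprK.
    rewrite le_max !lez_nat -leq_max; by apply: weightB_le; rewrite ?weightN ?leq_maxl ?leq_maxr.
  - move=> u w u0 e; congr (- (weight _)%:Z).
    by apply: reduced_ev2_inj => //; rewrite !ev2_red.
  - move=> c; exists c%:P%:P; first by rewrite ev2C ev1C.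
    have [->|c0] := eqVneq c 0.
      by rewrite /nu !polyC0 red_id ?/is_reduced ?size_poly0 // /weighted_degree rmorph0 size_poly0.
    have -> : c%:P%:P = (c *: 'X^0) *: 'X^0 :> {poly {poly K}}.
      by rewrite !expr0 -!mul_polyC !mulr1.
    by rewrite nuE // !muln0.
  (* Bezout gives [km * q = kn * d + 1], so [y ^+ kn / x ^+ km] has value 1. *)
  - case: (egcdnP d q_gt0) => km kn; rewrite (eqP co_qd) => e _.
    exists ('X ^+ kn), ('X%:P ^+ km).
    have mY : ('X : {poly {poly K}}) = (1 *: 'X^0) *: 'X^1 by rewrite scale1r expr0 scale1r expr1.
    have mX : 'X%:P = (1 *: 'X^1) *: 'X^0 :> {poly {poly K}}.
      by rewrite scale1r expr0 expr1 -mul_polyC mulr1.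
    rewrite rmorphXn ev2X rmorphXn ev2C ev1X !expf_neq0 ?as_x_neq0 ?as_y_neq0 //.
    split=> //; rewrite !nuX ?ev2X ?ev2C ?ev1X ?as_x_neq0 ?as_y_neq0 //.
    rewrite mY mX !nuE ?oner_neq0 // !muln0 !muln1 addn0 add0n.
    by move: e; rewrite -mulr_natr natz -mulr_natr natz; clear; lia.
exists P => u ru u0; rewrite PE ?ev2_reduced_eq0 //.
by rewrite /nu red_id.
Qed.

End CoordinateRing.

(** * Places whose residue field is [K] *)

Section DegreeOne.
Variables (K : finFieldType) (F : fieldType) (iota : {rmorphism K -> F}).
Variable P : place iota.

Lemma not_val_ge1_const c : val_ge P 1 (iota c) -> c = 0.
Proof.
case=> [/eqP|]; first by rewrite fmorph_eq0 => /eqP.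
by rewrite placeC.
Qed.

Lemma degree_one_dim : (forall z, val_ge P 0 z -> exists c, val_ge P 1 (z - iota c)) ->
  quotient_dim iota (val_ge P 0) (val_ge P 1) 1.
Proof.
move=> res.
exists (fun=> 1); split; first by move=> _; rewrite -(rmorph1 iota); apply: val_geC.
move=> z /res[c cP]; exists [ffun=> c]; split.
  by rewrite big_ord1 ffunE mulr1.
move=> e; rewrite big_ord1 mulr1 => eP; apply/ffunP=> i; rewrite ffunE ord1.
have := val_geB eP cP; rewrite opprB addrC addrA subrK -rmorphB.
by move=> /not_val_ge1_const/eqP; rewrite subr_eq0 => /eqP.
Qed.

Lemma degree_one : (forall z, val_ge P 0 z -> exists c, val_ge P 1 (z - iota c)) ->
  place_degree P = 1%N.
Proof.
move=> /degree_one_dim; rewrite /place_degree maximal_idealE; apply: qdimE.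
  exact: subspace_val_ge.
exact: subspace_val_ge.
Qed.

Lemma degree_oneP : place_degree P = 1%N ->
  forall z, val_ge P 0 z -> exists c, val_ge P 1 (z - iota c).
Proof.
rewrite /place_degree /qdim maximal_idealE => deg1 z hz.
have [b [Vb bP]] : quotient_dim iota (valuation_ring P) (val_ge P 1) 1.
  (* The default value of [qdim] is 0, so the value 1 is the dimension of a finite-dimensional
     quotient. *)
  have [[n hn]|no] := pselect (exists n, quotient_dim iota (valuation_ring P) (val_ge P 1) n).
    by have := xgetI 0%N hn; rewrite /= deg1.
  by move: deg1; rewrite xgetPN // => n hn; apply: no; exists n.
have h1 : val_ge P 0 1 by rewrite -(rmorph1 iota); apply: val_geC.
have [c [cP _]] := bP z hz; have [e [eP _]] := bP 1 h1.
move: cP eP; rewrite !big_ord1 => cP eP.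
have e0 : e ord0 != 0.
  apply/eqP => e0; move: eP; rewrite e0 rmorph0 mul0r subr0 -(rmorph1 iota).
  by move/not_val_ge1_const/eqP; rewrite oner_eq0.
(* The single basis vector is compared with 1, whose coordinate [e ord0] is nonzero. *)
exists (c ord0 / e ord0).
have : val_ge P (0 + 1) (iota (c ord0 / e ord0) * (1 - iota (e ord0) * b ord0)).
  by apply: val_geM => //; apply: val_geC.
rewrite add0r mulrBr mulr1 mulrA -rmorphM divfK // => h.
by have := val_geB cP h; rewrite opprB addrA subrK.
Qed.

End DegreeOne.

(** * Uniqueness and residue field of the place at infinity *)

Section InfinitePlace.
Variables (K : finFieldType) (F : fieldType) (iota : {rmorphism K -> F}).
Variables (q d : nat) (beta : {poly K}) (x y : F).
Hypothesis C : as_curve iota q d beta x y.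

Let q_gt1 := as_q_gt1 C.
Let co_qd := as_co_qd C.
Let size_beta := as_size_beta C.
Let d_gt0 := as_d_gt0 C.
Let q_gt0 : (0 < q)%N. Proof. exact: ltnW. Qed.

Local Notation weight := (weighted_degree q d).
Local Notation reduced := (@is_reduced K q).
Local Notation ev1 := (eval_x iota x).
Local Notation ev2 := (eval_xy iota x y).

Definition infinite_place (P : place iota) :=
  forall u, reduced u -> u != 0 -> P (ev2 u) = - (weight u)%:Z.

Lemma reducedC (c : {poly K}) : reduced c%:P.
Proof. by rewrite /is_reduced (leq_trans (size_polyC_leq1 _)). Qed.

Lemma weightC (c : {poly K}) : weight c%:P = (q * (size c).-1)%N.
Proof.
have [->|c0] := eqVneq c 0; first by rewrite /weighted_degree rmorph0 !size_poly0 muln0.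
have sc : (0 < size c)%N by rewrite size_poly_gt0.
apply/eqP; rewrite eqn_leq; apply/andP; split.
  apply/weight_le => // i j; rewrite coefC.
  have [->|_] := eqVneq j 0%N; last by rewrite coef0 eqxx.
  move=> ci; rewrite muln0 addn0 leq_mul2l -ltnS prednK //; apply/orP; right.
  by apply: contraNT ci; rewrite -leqNgt => /(nth_default 0)->.
have /(weight_le _ _ _ _) h := leqnn (weight c%:P).
have := h q_gt1 (size c).-1 0%N; rewrite muln0 addn0; apply.
by rewrite coefC eqxx -lead_coefE lead_coef_eq0.
Qed.

Lemma infinite_place_ev1 P c : infinite_place P -> c != 0 ->
  P (ev1 c) = - (q * (size c).-1)%N%:Z.
Proof.
move=> hP c0; rewrite -(ev2C iota x y) hP ?weightC ?reducedC // polyC_eq0 //.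
Qed.

Lemma infinite_place_x P : infinite_place P -> P x = - q%:Z.
Proof.
move=> hP; rewrite -(ev1X iota x) infinite_place_ev1 // ?polyX_eq0 //.
by rewrite size_polyX muln1.
Qed.

Lemma infinite_not_finite P : infinite_place P -> ~ val_ge P 0 x.
Proof.
move=> hP [/eqP|]; first by rewrite (negbTE (as_x_neq0 C)).
by rewrite infinite_place_x // oppr_ge0; move: q_gt0; lia.
Qed.

Lemma infinite_place_uniq P P' : infinite_place P -> infinite_place P' -> P = P'.
Proof.
move=> hP hP'; apply: placeP => z z0.
have [u [c [ru c0 zE]]] := ev2_frac C z.
have u0 : u != 0 by apply: contraNneq z0 => u0; rewrite zE u0 rmorph0 mul0r.
have e0 : ev2 u != 0 by rewrite (ev2_reduced_eq0 C).
have c0' : ev1 c != 0 by rewrite (ev1_eq0 C).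
by rewrite zE !placeM ?invr_eq0 // !placeV hP ?hP' // !infinite_place_ev1.
Qed.

Lemma infinite_residue P z : infinite_place P -> val_ge P 0 z ->
  exists c, val_ge P 1 (z - iota c).
Proof.
move=> hP hz.
have [z0|z0] := eqVneq z 0.
  by exists 0; rewrite z0 rmorph0 subr0; left.
have [u [c [ru c0 zE]]] := ev2_frac C z.
have u0 : u != 0 by apply: contraNneq z0 => u0; rewrite zE u0 rmorph0 mul0r.
have e0 : ev2 u != 0 by rewrite (ev2_reduced_eq0 C).
have c0' : ev1 c != 0 by rewrite (ev1_eq0 C).
have valE v : reduced v -> v != 0 ->
    P (ev2 v / ev1 c) = (weight c%:P)%:Z - (weight v)%:Z.
  move=> rv v0; rewrite placeM ?invr_eq0 // ?(ev2_reduced_eq0 C) //.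
  by rewrite placeV -(ev2C iota x y) !hP ?reducedC ?polyC_eq0 // opprK addrC.
move: hz => /(val_ge_maxE z0); rewrite zE valE // subr_ge0 lez_nat leq_eqVlt.
case/orP => [/eqP e|lt]; last first.
  by exists 0; rewrite rmorph0 subr0; right; rewrite valE //; move: lt; lia.
have pc0 : c%:P != 0 :> {poly {poly K}} by rewrite polyC_eq0.
(* Numerator and denominator have equal weights; subtracting the right constant lowers the weight of
   the numerator. *)
have [b b0 bP] := weight_cancel q_gt1 co_qd ru (reducedC c) u0 pc0 e.
exists b; have -> : ev2 u / ev1 c - iota b = ev2 (u - b%:P *: c%:P) / ev1 c.
  rewrite rmorphB -mul_polyC rmorphM !ev2C ev1C mulrBl mulfK //.
have [->|w0] := eqVneq (u - b%:P *: c%:P) 0; first by rewrite rmorph0 mul0r; left.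
case: bP => [/eqP|lt]; first by rewrite (negbTE w0).
by right; rewrite valE ?reducedB ?reducedZ ?reducedC //; move: lt; rewrite e; lia.
Qed.

Lemma infinite_degree P : infinite_place P -> place_degree P = 1%N.
Proof. by move=> hP; apply: degree_one => z; apply: infinite_residue. Qed.

Lemma place_ev1_neg (P : place iota) c : P x < 0 -> c != 0 -> P (ev1 c) = P x * (size c).-1%:Z.
Proof.
move=> ltx c0; have x0 := as_x_neq0 C.
rewrite ev1E; move: (c0); rewrite -lead_coef_eq0 lead_coefE.
rewrite -size_poly_gt0 in c0; case: (size c) c0 => // m _ /= lc.
rewrite big_ord_recr /= addrC.
have t0 : iota c`_m * x ^+ m != 0 by rewrite mulf_neq0 ?expf_neq0 ?fmorph_eq0.
have tE : P (iota c`_m * x ^+ m) = P x * m%:Z.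
  by rewrite placeM ?expf_neq0 ?fmorph_eq0 // placeC add0r placeX // -mulr_natr natz.
have [] := @place_add_lt _ _ _ P _ (\sum_(i < m) iota c`_i * x ^+ i) t0; last first.
  by move=> _ ->.
apply: val_ge_sum => i _; rewrite -[_ + 1]add0r; apply: val_geM.
  exact: val_geC.
right; rewrite tE placeX // -mulr_natr natz.
have := ltn_ord i; nia.
Qed.

Lemma val_ge_weight (P : place iota) (e : nat) u M : P x = - (q * e)%N%:Z -> P y = - (d * e)%N%:Z ->
  (weight u <= M)%N -> val_ge P (- (e * M)%N%:Z) (ev2 u).
Proof.
move=> Px Py /weight_le wu; rewrite ev2E; apply: val_ge_sum => j _.
have x0 := as_x_neq0 C; have y0 := as_y_neq0 C.
rewrite ev1E mulr_suml; apply: val_ge_sum => i _.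
have [->|uij] := eqVneq (u`_j`_i) 0; first by rewrite rmorph0 !mul0r; left.
right; rewrite !placeM ?mulf_neq0 ?expf_neq0 ?fmorph_eq0 // placeC add0r !placeX //.
rewrite Px Py -mulr_natr natz -mulr_natr natz; have := wu q_gt1 i j uij; clear; nia.
Qed.

(** If [x] has a pole, comparing orders in the equation gives [q P(y) = d P(x)], hence
    [P(x) = - q n] and [P(y) = - d n] by coprimality. The monomials of a reduced polynomial have
    distinct weights, so [P] is [- n] times the weight; as [P] takes the value 1, [n] is 1. *)
Lemma nonfinite_infinite P : ~ val_ge P 0 x -> infinite_place P.
Proof.
have x0 := as_x_neq0 C; have y0 := as_y_neq0 C.
move=> nf; have ltx : P x < 0 by rewrite ltNge; apply/negP => h; apply: nf; right.
have beta0 : beta != 0 by rewrite -size_poly_gt0 size_beta.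
have Pb : P (y ^+ q - y) = P x * d%:Z.
  by rewrite (as_equation C) -[_.[x]]/(ev1 beta) place_ev1_neg // size_beta.
have lty : P y < 0.
  rewrite ltNge; apply/negP => h.
  have hy : val_ge P 0 y by right.
  have : val_ge P 0 (y ^+ q - y) by apply: val_geB => //; apply: val_geX.
  case=> [/eqP|]; last by rewrite Pb; nia.
  by rewrite (as_equation C) -[_.[x]]/(ev1 beta) (ev1_eq0 C) (negbTE beta0).
have yq0 : y ^+ q != 0 by rewrite expf_neq0.
have [] := @place_add_lt _ _ _ P _ (- y) yq0.
  by right; rewrite placeN placeX // -mulr_natr natz; nia.
rewrite Pb placeX // -mulr_natr natz => _ e.
have [t tE] : exists t, P x = t * q%:Z.
  apply/dvdzP; rewrite -(@Gauss_dvdzl _ _ d%:Z) //.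
  by rewrite e dvdz_mull.
have tE' : P y = t * d%:Z by move: e; rewrite tE; nia.
have t0 : t < 0 by move: ltx; rewrite tE; nia.
pose n := `|t|%N; have nE : t = - n%:Z by rewrite /n; lia.
have n0 : (0 < n)%N by move: t0; rewrite nE; lia.
have Px : P x = - (q * n)%N%:Z by rewrite tE nE; lia.
have Py : P y = - (d * n)%N%:Z by rewrite tE' nE; lia.
have main u : reduced u -> u != 0 -> P (ev2 u) = - (n * weight u)%N%:Z.
  move=> ru u0.
  have [i [j [wu jq uij _]]] := reduced_top q_gt1 co_qd ru u0.
  pose t1 := (u`_j`_i *: 'X^i) *: 'X^j : {poly {poly K}}.
  have e1 : ev2 t1 = iota u`_j`_i * x ^+ i * y ^+ j.
    exact: ev2_monomial.
  have t10 : ev2 t1 != 0 by rewrite e1 !mulf_neq0 ?expf_neq0 ?fmorph_eq0.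
  have Pt : P (ev2 t1) = - (n * weight u)%N%:Z.
    rewrite e1 !placeM ?mulf_neq0 ?expf_neq0 ?fmorph_eq0 // placeC add0r !placeX //.
    by rewrite Px Py wu -mulr_natr natz -mulr_natr natz; nia.
  have rt : reduced t1 by exact: reduced_monomial.
  have [] := @place_add_lt _ _ _ P _ (ev2 (u - t1)) t10; last first.
    by rewrite -rmorphD addrC subrK Pt.
  have [->|w0] := eqVneq (u - t1) 0; first by rewrite rmorph0; left.
  have le : (weight (u - t1) <= weight u)%N.
    by apply: weightB_le => //; rewrite weight_monomial // wu.
  have lt : (weight (u - t1) < weight u)%N.
    rewrite ltn_neqAle le andbT; apply/eqP => ew.
    have [i1 [j1 [ww j1q wij _]]] := reduced_top q_gt1 co_qd (reducedB ru rt) w0.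
    have [ei ej] := weight_eq_inj q_gt1 co_qd j1q jq (etrans (esym ww) (etrans ew wu)).
    move: wij; rewrite ei ej !coefB /t1 coefZ coefXn eqxx mulr1 coefZ coefXn eqxx mulr1.
    by rewrite subrr eqxx.
  have [M MP] : exists M, weight u = M.+1 by case: (weight u) lt => // M _; exists M.
  apply: (@val_ge_le _ _ _ P (- (n * M)%N%:Z)); first by rewrite Pt MP; nia.
  by apply: val_ge_weight => //; rewrite -ltnS -MP.
suff n1 : n = 1%N by move=> u ru u0; rewrite main // n1 mul1n.
have [z [z0 Pz]] : exists z, z != 0 /\ P z = 1 by case: (place_valP P).
have [u [c [ru c0 zE]]] := ev2_frac C z.
have u0 : u != 0 by apply: contraNneq z0 => u0; rewrite zE u0 rmorph0 mul0r.
move: Pz; rewrite zE placeM ?invr_eq0 ?(ev2_reduced_eq0 C) ?(ev1_eq0 C) //.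
rewrite placeV -(ev2C iota x y) !main ?reducedC ?polyC_eq0 //.
move: (weight u) (weight c%:P) => a b E.
have : (n %| 1)%N.
  have E' : (b%:Z - a%:Z) * n%:Z = 1 by rewrite -E !PoszM; ring.
  have : (n%:Z %| 1)%Z by apply/dvdzP; exists (b%:Z - a%:Z); rewrite E'.
  by [].
by rewrite dvdn1 => /eqP.
Qed.

End InfinitePlace.

(** * The polynomials [X^(#|K|^N) - X] *)

Section Theta.
Variable K : finFieldType.

(* The product of all monic irreducible polynomials over [K] whose degree
   divides [N]; it is a uniformizer at every place lying above its roots. *)
Definition frob_poly N : {poly K} := 'X^(#|K| ^ N) - 'X.

Lemma card_expn_gt1 N : (0 < N)%N -> (1 < #|K| ^ N)%N.
Proof.
move=> N0; rewrite -[1%N](expn0 #|K|) ltn_exp2l //; exact: finNzRing_gt1.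
Qed.

Lemma size_theta N : (0 < N)%N -> size (frob_poly N) = (#|K| ^ N).+1.
Proof.
move=> N0; rewrite /frob_poly size_polyDl ?size_polyXn // size_polyN size_polyX ltnS.
exact: card_expn_gt1.
Qed.

Lemma expf_card_expn N (a : K) : a ^+ (#|K| ^ N) = a.
Proof. by elim: N => [|N IH]; rewrite ?expr1 // expnSr exprM IH expf_card. Qed.

(** There are finitely many residues modulo [c], so two of the iterated powers of ['X] agree. Their
    difference is the [#|K| ^ i]-th power of [frob_poly N]: every nonzero polynomial divides a power
    of some [frob_poly N]. *)
Lemma theta_multiple (c : {poly K}) : c != 0 ->
  exists N i, [/\ (0 < N)%N & c %| 'X^(#|K| ^ (N + i)) - 'X^(#|K| ^ i)].
Proof.
move=> c0; pose s := size c.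
pose f (i : 'I_(#|{ffun 'I_s -> K}|).+1) :=
  [ffun j : 'I_s => ('X^(#|K| ^ i) %% c)`_j].
have /injectivePn[i [j nij eij]] : ~~ injectiveb f.
  apply/negP => /injectiveP/leq_card; by rewrite card_ord ltnn.
have key (i' j' : 'I__) : (i' < j')%N -> f i' = f j' ->
    exists N i, [/\ (0 < N)%N & c %| 'X^(#|K| ^ (N + i)) - 'X^(#|K| ^ i)].
  move: i' j' => {i j nij eij}i j lt e; exists (j - i)%N, i; rewrite subn_gt0 lt; split=> //.
  rewrite subnK; last exact: ltnW.
  rewrite dvdp_eq -[X in _ == X]addr0 {1}(divp_eq ('X^(#|K| ^ j) - _) c).
  rewrite (inj_eq (addrI _)) modpD modpN subr_eq0; apply/eqP/polyP => l.
  have [ls|sl] := ltnP l s; last first.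
    have sz (r : {poly K}) : (size (r %% c)%R <= s)%N by rewrite ltnW // ltn_modpN0.
    by rewrite !nth_default // (leq_trans (sz _) sl).
  by have /ffunP/(_ (Ordinal ls)) := e; rewrite !ffunE /=.
case: (ltngtP i j) => [lt|lt|/val_inj e]; [exact: key eij | exact: key (esym eij) |].
by rewrite e eqxx in nij.
Qed.

End Theta.

Section ThetaCongruence.
Variables (K : finFieldType) (F : fieldType) (iota : {rmorphism K -> F}).
Variables (q d : nat) (beta : {poly K}) (x y : F).
Hypothesis C : as_curve iota q d beta x y.

Let q_gt1 := as_q_gt1 C.
Let q_gt0 : (0 < q)%N. Proof. exact: ltnW. Qed.

Local Notation ev1 := (eval_x iota x).
Local Notation ev2 := (eval_xy iota x y).

Lemma pnat_card N : [pchar K].-nat (#|K| ^ N)%N.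
Proof. by have [n n0 ->] := as_card C; rewrite -expnM pnatX (as_q_pchar C). Qed.

Lemma pchar_card_expn N : [pchar F].-nat (#|K| ^ N)%N.
Proof. by rewrite (eq_pnat _ (fmorph_pchar iota)) pnat_card. Qed.

Lemma pchar_poly_card_expn N : [pchar {poly K}].-nat (#|K| ^ N)%N.
Proof. by rewrite (eq_pnat _ (@pchar_poly _)) pnat_card. Qed.

Lemma exp_card_theta N (c : {poly K}) : exists t, c ^+ (#|K| ^ N) = c + frob_poly K N * t.
Proof.
elim/poly_ind: c => [|c b [t tE]].
  by exists 0; rewrite mulr0 addr0 expr0n gtn_eqF // expn_gt0 (ltnW (finNzRing_gt1 K)).
exists (t * ('X + frob_poly K N) + c).
rewrite exprDn_pchar ?pchar_poly_card_expn // exprMn tE -rmorphXn expf_card_expn.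
rewrite (_ : 'X^(#|K| ^ N) = 'X + frob_poly K N); last by rewrite addrC subrK.
ring.
Qed.

Lemma exp_card_theta_iter N i (c : {poly K}) :
  exists t, c ^+ (#|K| ^ (N * i)) = c + frob_poly K N * t.
Proof.
elim: i => [|i [t tE]].
  by exists 0; rewrite muln0 expn0 expr1 mulr0 addr0.
have [t' t'E] := exp_card_theta N (c + frob_poly K N * t).
by exists (t + t'); rewrite mulnS addnC expnD exprM tE t'E; ring.
Qed.

Lemma y_exp_q i : exists c, y ^+ (q ^ i) = y + ev1 c.
Proof.
elim: i => [|i [c cE]]; first by exists 0; rewrite expn0 expr1 rmorph0 addr0.
exists (beta + c ^+ q); rewrite expnSr exprM cE exprDn_pchar; last first.
  by rewrite (eq_pnat _ (fmorph_pchar iota)) (as_q_pchar C).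
rewrite rmorphD rmorphXn addrA; congr (_ + _).
by rewrite -[ev1 beta]/((map_poly iota beta).[x]) -(as_equation C) addrC subrK.
Qed.

Definition theta_exp N := (#|K| ^ (N * q))%N.

Lemma theta_exp_gt2 N : (0 < N)%N -> (2 < theta_exp N)%N.
Proof.
move=> N0; have h := finNzRing_gt1 K.
apply: (@leq_trans (#|K| ^ 2)).
  apply: (@leq_trans (2 ^ 2)) => //; rewrite leq_exp2r //.
by rewrite leq_exp2l //; nia.
Qed.

(* In characteristic p, [y ^ (Q ^ i) = y + i tau] modulo [frob_poly], and [q] is a
   multiple of p. *)
Lemma frobenius_theta N u :
  exists t, ev2 u ^+ theta_exp N = ev2 u + ev1 (frob_poly K N) * ev2 t.
Proof.
have [tau tauE] : exists tau, y ^+ (#|K| ^ N) = y + ev1 tau.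
  have [n n0 ->] := as_card C.
  by rewrite -expnM; apply: y_exp_q.
have yi i : exists t, y ^+ (#|K| ^ (N * i)) = y + ev1 tau *+ i + ev1 (frob_poly K N * t).
  elim: i => [|i [t tE]].
    by exists 0; rewrite muln0 expn0 expr1 mulr0 rmorph0 mulr0n !addr0.
  have [t1 t1E] := exp_card_theta N (tau *+ i + frob_poly K N * t).
  exists (t + t1); rewrite mulnS addnC expnD exprM tE.
  rewrite -rmorphMn -addrA -rmorphD exprDn_pchar ?pchar_card_expn // tauE.
  rewrite -rmorphXn t1E !rmorphD mulrDr rmorphMn mulrS rmorphD; ring.
have q0 : (q%:R : F) = 0.
  have qF : [pchar F].-nat q by rewrite (eq_pnat _ (fmorph_pchar iota)) (as_q_pchar C).
  have pF : pdiv q \in [pchar F] by rewrite (pnatPpi qF) // pi_pdiv.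
  by apply/eqP; rewrite -(dvdn_pcharf pF) pdiv_dvd.
have [ty tyE] : exists t, y ^+ theta_exp N = y + ev1 (frob_poly K N * t).
  have [t tE] := yi q; exists t; rewrite tE -[ev1 tau *+ q]mulr_natr q0 mulr0 addr0 //.
elim/poly_ind: u => [|u c [t tE]].
  exists 0; rewrite !rmorph0 mulr0 addr0 expr0n gtn_eqF //.
  by rewrite expn_gt0 (ltnW (finNzRing_gt1 K)).
have [tc tcE] := exp_card_theta_iter N q c.
rewrite rmorphD rmorphM ev2X ev2C exprDn_pchar ?pchar_card_expn // exprMn tE tyE.
rewrite -rmorphXn tcE.
exists (u * ty%:P + t * ('X + (frob_poly K N * ty)%:P) + tc%:P).
rewrite !(rmorphD ev2) !(rmorphM ev2) (rmorphD ev2) ev2X !ev2C.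
by move: (frob_poly K N) => th; rewrite !(rmorphM ev1); ring.
Qed.

(** Modulo [frob_poly K N] a power of [u] is an idempotent, equal to 1 where [u] does not vanish and
    to 0 elsewhere. Its complement is thus a unit wherever [u] vanishes, and multiplying [u] by it
    produces a factor [frob_poly K N]: this is division by a uniformizer without leaving the
    coordinate ring. *)
Lemma theta_step N u : (0 < N)%N ->
  exists t, ev2 (1 - u ^+ (theta_exp N).-1) * ev2 u = ev1 (frob_poly K N) * ev2 t.
Proof.
move=> N0; have [t tE] := frobenius_theta N u.
exists (- t); rewrite -rmorphM mulrBl mul1r -exprSr prednK; last first.
  by apply: leq_trans (theta_exp_gt2 N0).
by rewrite rmorphB rmorphXn tE rmorphN mulrN opprD addrA subrr sub0r.
Qed.

(** Euclidean division by [c] of the coefficients of the reduced form of [u]. The number of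
    monomials, [q] times the degree of [c], bounds all degrees of zeros below. *)
Lemma span_mod_ev1 (c : {poly K}) u : c != 0 ->
  exists f : {ffun 'I_(size c).-1 * 'I_q -> K}, exists t,
    ev2 u - \sum_i iota (f i) * (x ^+ i.1 * y ^+ i.2) = ev1 c * ev2 t.
Proof.
move=> c0; pose v := reduce_mod q beta u.
have sv : (size v <= q)%N by apply: reduced_red.
pose f := [ffun i : 'I_(size c).-1 * 'I_q => (v`_i.2 %% c)`_i.1].
exists f; exists (\poly_(j < q) (v`_j %/ c)).
have -> : \sum_i iota (f i) * (x ^+ i.1 * y ^+ i.2) =
    \sum_(j < q) \sum_(i < (size c).-1) iota (f (i, j)) * (x ^+ i * y ^+ j).
  by rewrite exchange_big pair_bigA; apply: eq_bigr => -[].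
have evv : ev2 v = \sum_(j < q) ev1 v`_j * y ^+ j.
  by rewrite -[LHS]/((map_poly ev1 v).[y]) (@horner_coef_wide _ q)
    ?(leq_trans (size_poly _ _)) //; apply: eq_bigr => j _; rewrite coef_map.
rewrite -(ev2_red C) -/v evv -sumrB.
rewrite (_ : ev2 (\poly_(j < q) _) = \sum_(j < q) ev1 (v`_j %/ c) * y ^+ j); last first.
  rewrite -[LHS]/((map_poly ev1 _).[y]) (@horner_coef_wide _ q); last first.
    by rewrite (leq_trans (size_poly _ _)) // size_poly.
  by apply: eq_bigr => j _; rewrite coef_map coef_poly ltn_ord.
rewrite mulr_sumr; apply: eq_bigr => j _.
rewrite {1}(divp_eq v`_j c) rmorphD rmorphM mulrDl.
have -> : ev1 (v`_j %% c) = \sum_(i < (size c).-1) iota (v`_j %% c)`_i * x ^+ i.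
  rewrite -[LHS]/((map_poly iota _).[x]) (@horner_coef_wide _ (size c).-1).
    by apply: eq_bigr => i _; rewrite coef_map.
  rewrite (leq_trans (size_poly _ _)) // -ltnS prednK ?size_poly_gt0 //.
  by rewrite ltn_modp.
rewrite mulr_suml [X in _ - X](eq_bigr (fun i : 'I__ => iota (v`_j %% c)`_i * x ^+ i * y ^+ j)); last first.
  by move=> i _; rewrite ffunE mulrA.
by rewrite addrK -mulrA mulrCA.
Qed.

End ThetaCongruence.

(** * Places at which [x] is finite *)

Section FinitePlace.
Variables (K : finFieldType) (F : fieldType) (iota : {rmorphism K -> F}).
Variables (q d : nat) (beta : {poly K}) (x y : F).
Hypothesis C : as_curve iota q d beta x y.

Let q_gt1 := as_q_gt1 C.
Let q_gt0 : (0 < q)%N. Proof. exact: ltnW. Qed.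

Local Notation ev1 := (eval_x iota x).
Local Notation ev2 := (eval_xy iota x y).
Local Notation theta := (frob_poly K).
Local Notation texp := (theta_exp K q).
Implicit Types P : place iota.

Lemma finite_ev1 P c : val_ge P 0 x -> val_ge P 0 (ev1 c).
Proof.
move=> hx; rewrite ev1E; apply: val_ge_sum => i _; rewrite -[0]addr0.
by apply: val_geM; [apply: val_geC | apply: val_geX].
Qed.

Lemma finite_y P : val_ge P 0 x -> val_ge P 0 y.
Proof.
move=> hx; have y0 := as_y_neq0 C; have [|lt] := lerP 0 (P y); first by right.
have yq0 : y ^+ q != 0 by rewrite expf_neq0.
have [] := @place_add_lt _ _ _ P _ (- y) yq0.
  by right; rewrite placeN placeX // -mulr_natr natz; move: q_gt1 lt; clear; nia.
move=> ne0 e; have := finite_ev1 beta hx.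
rewrite -[ev1 beta]/((map_poly iota beta).[x]) -(as_equation C).
case=> [/eqP|]; first by rewrite (negbTE ne0).
by rewrite e placeX // -mulr_natr natz; move: q_gt0 lt; clear; nia.
Qed.

Lemma finite_ev2 P u : val_ge P 0 x -> val_ge P 0 (ev2 u).
Proof.
move=> hx; rewrite ev2E; apply: val_ge_sum => i _; rewrite -[0]addr0.
by apply: val_geM; [apply: finite_ev1 | apply/val_geX/finite_y].
Qed.

Lemma not_val_ge1_1 P : ~ val_ge P 1 1.
Proof. by case=> [/eqP|]; rewrite ?oner_eq0 // place1. Qed.

Lemma val_ge0_unit P z : val_ge P 0 z -> ~ val_ge P 1 z -> z != 0 /\ P z = 0.
Proof.
case=> [->|h] h1; first by case: h1; left.
have z0 : z != 0 by apply: contra_notN h1 => /eqP->; left.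
split=> //; apply/eqP; rewrite eq_le h andbT leNgt; apply/negP => lt.
by apply: h1; right.
Qed.

Lemma val_ge1_prime P z w : val_ge P 0 z -> val_ge P 0 w -> val_ge P 1 (z * w) ->
  val_ge P 1 z \/ val_ge P 1 w.
Proof.
move=> hz hw hzw.
have [|nz] := pselect (val_ge P 1 z); first by left.
have [|nw] := pselect (val_ge P 1 w); first by right.
have [z0 Pz] := val_ge0_unit hz nz; have [w0 Pw] := val_ge0_unit hw nw.
by case: hzw => [/eqP|]; rewrite ?mulf_eq0 ?(negbTE z0) ?(negbTE w0) // placeM // Pz Pw.
Qed.

Lemma val_ge1M P z w : val_ge P 0 z -> val_ge P 1 w -> val_ge P 1 (z * w).
Proof. by move=> hz hw; rewrite -[1]add0r; apply: val_geM. Qed.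

Lemma val_ge1X P z n : val_ge P 0 z -> val_ge P 1 (z ^+ n) -> val_ge P 1 z.
Proof.
move=> hz; elim: n => [|n IH]; first by rewrite expr0 => /not_val_ge1_1.
by rewrite exprS => /(val_ge1_prime hz (val_geX n hz))[].
Qed.

(** If no nonzero polynomial in [x] vanished at [P], all denominators would be units and no function
    could have a pole there. A vanishing polynomial divides a power of some [theta N]. *)
Lemma finite_theta_ex P : val_ge P 0 x ->
  exists2 N, (0 < N)%N & val_ge P 1 (ev1 (theta N)).
Proof.
move=> hx.
have [c c0 cP] : exists2 c, c != 0 & val_ge P 1 (ev1 c).
  apply: contrapT => no.
  have P0 c : c != 0 -> P (ev1 c) = 0.
    move=> c0; have [_ //] := val_ge0_unit (finite_ev1 c hx) (fun h => no (ex_intro2 _ _ c c0 h)).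
  have Pge z : z != 0 -> 0 <= P z.
    move=> z0; have [u [c [ru c0 zE]]] := ev2_frac C z.
    have u0 : ev2 u != 0 by apply: contraNneq z0 => u0; rewrite zE u0 mul0r.
    rewrite zE placeM ?invr_eq0 ?(ev1_eq0 C) // placeV P0 // subr0.
    by apply: (val_ge_maxE u0); apply: finite_ev2.
  have [z [z0 Pz]] : exists z, z != 0 /\ P z = 1 by case: (place_valP P).
  by have := Pge z^-1; rewrite invr_eq0 placeV Pz => /(_ z0).
have [N [i [N0 /dvdpP[t tE]]]] := theta_multiple c0.
exists N => //; apply: (@val_ge1X _ _ (#|K| ^ i)); first exact: finite_ev1.
rewrite -rmorphXn /frob_poly exprDn_pchar ?(pchar_poly_card_expn C) //.
rewrite exprNn_pchar ?(pchar_poly_card_expn C) // -exprM -expnD tE rmorphM.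
by apply: val_ge1M => //; apply: finite_ev1.
Qed.

(** Induction on the value of [u]: as long as [u] vanishes at [P], [theta_step] splits off one more
    factor [theta N], at the price of a factor which is a unit at [P]. *)
Lemma finite_factor P N u : val_ge P 0 x -> (0 < N)%N -> val_ge P 1 (ev1 (theta N)) ->
  ev2 u != 0 -> exists e s t,
    [/\ ev2 s * ev2 u = ev1 (theta N) ^+ e * ev2 t,
        ~ val_ge P 1 (ev2 s) & ~ val_ge P 1 (ev2 t)].
Proof.
move=> hx N0 hN; have [m] : exists m, P (ev2 u) <= m%:Z.
  by exists `|P (ev2 u)|%N; lia.
elim: m u => [|m IH] u le_m u0.
  exists 0%N, 1, u; rewrite expr0 rmorph1; split=> //; first exact: not_val_ge1_1.
  by move=> /(val_ge_maxE u0) h; move: le_m h; clear; lia.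
have [hu|nu] := pselect (val_ge P 1 (ev2 u)); last first.
  by exists 0%N, 1, u; rewrite expr0 rmorph1; split=> //; apply: not_val_ge1_1.
have [t tE] := theta_step C u N0; set s := 1 - _ in tE.
have ns : ~ val_ge P 1 (ev2 s).
  rewrite /s rmorphB rmorph1 rmorphXn => hs.
  have h2 : val_ge P 1 (ev2 u ^+ (texp N).-1).
    have := theta_exp_gt2 C N0; case: (texp N) => [|[|n]] // _.
    by rewrite /= exprSr; apply: val_ge1M => //; apply/val_geX/finite_ev2.
  by apply: (@not_val_ge1_1 P); rewrite -[X in val_ge _ _ X](subrK (ev2 u ^+ (texp N).-1)); apply: val_geD.
have [s0 Ps] := val_ge0_unit (finite_ev2 s hx) ns.
have st0 : ev1 (theta N) * ev2 t != 0 by rewrite -tE mulf_neq0.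
have [th0 t0] : ev1 (theta N) != 0 /\ ev2 t != 0.
  by move: st0; rewrite mulf_eq0 negb_or => /andP[].
have Pth := val_ge_maxE th0 hN.
have [||e [s' [t' [e1 ns' nt']]]] := IH t; rewrite ?t0 //.
  have : P (ev2 s * ev2 u) = P (ev1 (theta N) * ev2 t) by rewrite tE.
  by rewrite !placeM // Ps; move: Pth le_m; clear; lia.
exists e.+1, (s' * s), t'; split=> //.
  by rewrite rmorphM -mulrA tE mulrCA e1 exprS mulrA.
rewrite rmorphM => /val_ge1_prime[]; try exact: finite_ev2; by [].
Qed.

Lemma finite_factor_val P N u e s t : val_ge P 0 x ->
  ev2 s * ev2 u = ev1 (theta N) ^+ e * ev2 t ->
  ev2 u != 0 -> ev1 (theta N) != 0 ->
  ~ val_ge P 1 (ev2 s) -> ~ val_ge P 1 (ev2 t) -> P (ev2 u) = P (ev1 (theta N)) * e%:Z.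
Proof.
move=> hx E u0 th0 ns nt.
have [s0 Ps] := val_ge0_unit (finite_ev2 s hx) ns.
have [t0 Pt] := val_ge0_unit (finite_ev2 t hx) nt.
have : P (ev2 s * ev2 u) = P (ev1 (theta N) ^+ e * ev2 t) by rewrite E.
by rewrite !placeM ?expf_neq0 // Ps Pt addr0 add0r placeX // -mulr_natr natz.
Qed.

Lemma theta_neq0 N : (0 < N)%N -> ev1 (theta N) != 0.
Proof. by move=> N0; rewrite (ev1_eq0 C) -size_poly_eq0 size_theta. Qed.

(** By [finite_factor] all values of [P] are multiples of this one, and the value 1 is taken. *)
Lemma finite_theta_val P N : val_ge P 0 x -> (0 < N)%N -> val_ge P 1 (ev1 (theta N)) ->
  P (ev1 (theta N)) = 1.
Proof.
move=> hx N0 hN; have th0 := theta_neq0 N0.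
have mult u : ev2 u != 0 -> exists e : nat, P (ev2 u) = P (ev1 (theta N)) * e%:Z.
  move=> u0; have [e [s [t [E ns nt]]]] := finite_factor hx N0 hN u0.
  by exists e; apply: (finite_factor_val hx E).
have [z [z0 Pz]] : exists z, z != 0 /\ P z = 1 by case: (place_valP P).
have [u [c [ru c0 zE]]] := ev2_frac C z.
have u0 : ev2 u != 0 by apply: contraNneq z0 => u0; rewrite zE u0 mul0r.
have c0' : ev2 c%:P != 0 by rewrite ev2C (ev1_eq0 C).
have [e eE] := mult _ u0; have [e' e'E] := mult _ c0'.
move: Pz; rewrite zE -(ev2C iota x y) placeM ?invr_eq0 // placeV eE e'E -mulrBr.
have := val_ge_maxE th0 hN; move: (P (ev1 (theta N))) (e%:Z - e'%:Z) => a b; clear=> a1 ab.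
have [b0|b1] : b <= 0 \/ 1 <= b by lia.
  by nia.
by nia.
Qed.

(** If [u] vanishes at [P'], then [s = 1 - u ^+ (texp N).-1] does not, hence does not vanish at [P]
    either; since [s u] is divisible by [theta N], [u] vanishes at [P]. So the two centers agree,
    and the factorizations of [finite_factor] then give equal values. *)
Lemma finite_place_le P P' : val_ge P 0 x -> val_ge P' 0 x ->
  (forall u, val_ge P 1 (ev2 u) -> val_ge P' 1 (ev2 u)) -> P = P'.
Proof.
move=> hx hx' sub; have [N N0 hN] := finite_theta_ex hx.
have hN' : val_ge P' 1 (ev1 (theta N)) by rewrite -(ev2C iota x y); apply: sub; rewrite ev2C.
have sup u : val_ge P' 1 (ev2 u) -> val_ge P 1 (ev2 u).
  move=> hu; have [t tE] := theta_step C u N0; set s := 1 - _ in tE.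
  have : val_ge P 1 (ev2 s * ev2 u).
    by rewrite tE mulrC; apply: val_ge1M => //; apply: finite_ev2.
  move=> /val_ge1_prime[]; try exact: finite_ev2; last by [].
  move/sub; rewrite /s rmorphB rmorph1 rmorphXn => hs; exfalso.
  have h2 : val_ge P' 1 (ev2 u ^+ (texp N).-1).
    have := theta_exp_gt2 C N0; case: (texp N) => [|[|n]] // _.
    by rewrite /= exprSr; apply: val_ge1M => //; apply/val_geX/finite_ev2.
  by apply: (@not_val_ge1_1 P'); rewrite -[X in val_ge _ _ X](subrK (ev2 u ^+ (texp N).-1)); apply: val_geD.
have eq u : ev2 u != 0 -> P (ev2 u) = P' (ev2 u).
  move=> u0; have [e [s [t [E ns nt]]]] := finite_factor hx N0 hN u0.
  rewrite (finite_factor_val hx E) ?theta_neq0 //.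
  rewrite (finite_factor_val hx' E) ?theta_neq0 //; try by move/sup.
  by rewrite !finite_theta_val.
apply: placeP => z z0; have [u [c [ru c0 zE]]] := ev2_frac C z.
have u0 : ev2 u != 0 by apply: contraNneq z0 => u0; rewrite zE u0 mul0r.
have c0' : ev2 c%:P != 0 by rewrite ev2C (ev1_eq0 C).
by rewrite zE -(ev2C iota x y) !placeM ?invr_eq0 // !placeV !eq.
Qed.

(** After cancelling powers of [theta N], [z] is a fraction whose denominator is a unit at [P], and
    a power of that denominator inverts it modulo [P]. *)
Lemma finite_residue P z : val_ge P 0 x -> val_ge P 0 z ->
  exists u, val_ge P 1 (z - ev2 u).
Proof.
move=> hx hz; have [z0|z0] := eqVneq z 0.
  by exists 0; rewrite z0 rmorph0 subr0; left.
have [N N0 hN] := finite_theta_ex hx.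
have th0 := theta_neq0 N0; have Pth := finite_theta_val hx N0 hN.
have [u [c [ru c0 zE]]] := ev2_frac C z.
have u0 : ev2 u != 0 by apply: contraNneq z0 => u0; rewrite zE u0 mul0r.
have c0' : ev2 c%:P != 0 by rewrite ev2C (ev1_eq0 C).
have [e [s [t [E ns nt]]]] := finite_factor hx N0 hN c0'.
have [e' [s' [t' [E' ns' nt']]]] := finite_factor hx N0 hN u0.
have Pc := finite_factor_val hx E c0' th0 ns nt.
have Pu := finite_factor_val hx E' u0 th0 ns' nt'.
have le_e : (e <= e')%N.
  have := val_ge_maxE z0 hz.
  rewrite zE -(ev2C iota x y) placeM ?invr_eq0 // placeV Pu Pc Pth; clear; lia.
have [s0 Ps] := val_ge0_unit (finite_ev2 s hx) ns.
have [t0 Pt] := val_ge0_unit (finite_ev2 t hx) nt.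
have [s0' Ps'] := val_ge0_unit (finite_ev2 s' hx) ns'.
pose a := (theta N ^+ (e' - e))%:P * t' * s; pose w := s' * t.
have w0 : ev2 w != 0 by rewrite rmorphM mulf_neq0.
have zE' : z = ev2 a / ev2 w.
  apply/eqP; rewrite zE -(ev2C iota x y) eqr_div //; apply/eqP.
  apply: (mulfI (mulf_neq0 s0 s0')).
  rewrite /a /w !rmorphM (ev2C iota x y (theta N ^+ _)) rmorphXn.
  transitivity ((ev2 s' * ev2 u) * ev2 s * ev2 s' * ev2 t); first by ring.
  transitivity (ev2 s' * ev2 t' * ev2 s * ev1 (theta N) ^+ (e' - e) * (ev2 s * ev2 c%:P)); last by ring.
  by rewrite E E' -{1}(subnK le_e) exprD; ring.
have nw : ~ val_ge P 1 (ev2 w).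
  by rewrite rmorphM => /val_ge1_prime[]; try exact: finite_ev2.
(* Modulo [P] the power [w ^+ (texp N).-1] is 1, so [w ^+ (texp N).-2] is the inverse of [w]. *)
clearbody a w; exists (a * w ^+ (texp N).-2).
have [b bE] := theta_step C w N0.
have hs : val_ge P 1 (ev2 (1 - w ^+ (texp N).-1)).
  have : val_ge P 1 (ev2 (1 - w ^+ (texp N).-1) * ev2 w).
    by rewrite bE mulrC; apply: val_ge1M => //; apply: finite_ev2.
  by move=> /val_ge1_prime[]; try exact: finite_ev2.
have -> : z - ev2 (a * w ^+ (texp N).-2) = ev2 a / ev2 w * ev2 (1 - w ^+ (texp N).-1).
  rewrite zE' rmorphM rmorphB rmorph1 !rmorphXn mulrBr mulr1; congr (_ - _).
  have := theta_exp_gt2 C N0; case: (texp N) => [|[|n]] // _ /=.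
  by rewrite exprS mulrA divfK.
by apply: val_ge1M => //; rewrite -zE'.
Qed.

(** As [theta N] vanishes at [P], finitely many monomials span the residue field; hence the degree
    is not the default value of [qdim]. *)
Lemma finite_degree P : val_ge P 0 x ->
  quotient_dim iota (val_ge P 0) (val_ge P 1) (place_degree P).
Proof.
move=> hx; have [N N0 hN] := finite_theta_ex hx.
have s0 := subspace_val_ge P 0; have s1 := subspace_val_ge P 1.
pose th := theta N; have th0 : th != 0 by rewrite -size_poly_eq0 size_theta.
pose I : finType := ('I_(size th).-1 * 'I_q)%type.
have span z : val_ge P 0 z -> exists c : {ffun I -> K},
    val_ge P 1 (z - \sum_i iota (c i) * (x ^+ i.1 * y ^+ i.2)).
  move=> hz; have [u hu] := finite_residue hx hz.
  have [f [t E]] := span_mod_ev1 C u th0; exists f.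
  rewrite -[z](subrK (ev2 u)) -addrA; apply: val_geD => //.
  by rewrite E mulrC; apply: val_ge1M => //; apply: finite_ev2.
have [n _ hn] : exists2 n, (n <= #|I|)%N & quotient_dim iota (val_ge P 0) (val_ge P 1) n.
  apply: quotient_dim_bounded => // n.
  apply: (@independent_mod_le _ _ _ _ _ (val_ge P 1) idfun n I
    (fun i : I => x ^+ i.1 * y ^+ i.2)) => //.
rewrite /place_degree maximal_idealE.
by rewrite (qdimE s0 s1 hn).
Qed.

Lemma finite_degree_gt0 P : val_ge P 0 x -> (0 < place_degree P)%N.
Proof.
move=> hx; rewrite lt0n; apply/eqP => deg0.
have := finite_degree hx; rewrite deg0 => -[b [_ bP]].
have h1 : val_ge P 0 1 by rewrite -(rmorph1 iota); apply: val_geC.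
by have [c []] := bP 1 h1; rewrite big_ord0 subr0 => /not_val_ge1_1.
Qed.

End FinitePlace.

(** * The place centered at a point with coordinates in an extension field *)

Section GeometricPoint.
Variables (K : finFieldType) (F : fieldType) (iota : {rmorphism K -> F}).
Variables (q d : nat) (beta : {poly K}) (x y : F).
Hypothesis C : as_curve iota q d beta x y.
Variables (L : fieldType) (j : {rmorphism K -> L}) (a b : L) (N : nat).
Hypothesis on_curve : b ^+ q - b = (map_poly j beta).[a].
Hypothesis N_gt0 : (0 < N)%N.
Hypothesis a_fixed : a ^+ (#|K| ^ N) = a.

Let q_gt1 := as_q_gt1 C.

Local Notation ev1 := (eval_x iota x).
Local Notation ev2 := (eval_xy iota x y).
Local Notation theta := (frob_poly K).
Local Notation texp := (theta_exp K q).
Local Notation red := (reduce_mod q beta).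
Local Notation evL := (eval_xy j a b).

Let evL_red u : evL (red u) = evL u.
Proof.
rewrite [in RHS](redE beta q_gt1 u) rmorphD rmorphM.
rewrite (_ : evL (curve_poly q beta) = 0) ?mulr0 ?add0r //.
rewrite /curve_poly !rmorphB rmorphXn ev2X ev2C.
by rewrite on_curve subrr.
Qed.

Let evL_eq u v : ev2 u = ev2 v -> evL u = evL v.
Proof.
move=> e; rewrite -evL_red -(evL_red v); congr (evL _).
by apply: (reduced_ev2_inj C); rewrite ?reduced_red // !(ev2_red C).
Qed.

Let evL_theta : eval_x j a (theta N) = 0.
Proof. by rewrite /frob_poly rmorphB rmorphXn ev1X a_fixed subrr. Qed.

(** Divisibility of [u] by [theta N ^+ e] in the local ring at the point [(a, b)]. *)
Let divides u e := exists s t, ev2 s * ev2 u = ev1 (theta N) ^+ e * ev2 t /\ evL s != 0.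

(** After multiplication by the conjugates of [u], the norm [c] times [s] is divisible by
    [theta N ^+ e]. Some coefficient of [red s] does not vanish at [a], so [('X - a%:P) ^+ e]
    divides [c] over [L]. *)
Let divides_bound u : ev2 u != 0 -> exists B, forall e, divides u e -> (e <= B)%N.
Proof.
rewrite (ev2_eq0 C) => u0.
have [v [c [c0 nE]]] := norm_exists q_gt1 (as_co_qd C) (as_size_beta C) (as_q_pchar C)
  (as_card_fixed C) (reduced_red beta q_gt1 u) u0.
exists (size c) => e [s [t [E s0]]].
have nE' : ev2 u * ev2 v = ev1 c.
  by rewrite -(ev2C iota x y) -nE (ev2_red C) rmorphM (ev2_red C).
have E' : ev2 (c *: red s) = ev2 (theta N ^+ e *: red (t * v)).
  rewrite -!mul_polyC !rmorphM !ev2C !(ev2_red C) rmorphXn -nE' rmorphM.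
  by rewrite mulrA -E; ring.
have {}E' : c *: red s = theta N ^+ e *: red (t * v).
  by apply: (reduced_ev2_inj C) E'; apply: reducedZ; apply: reduced_red.
have [i si] : exists i, (map_poly j (red s)`_i).[a] != 0.
  apply: contrapT => no; move: s0; rewrite -evL_red ev2E big1 ?eqxx // => i _.
  rewrite (_ : eval_x j a _ = 0) ?mul0r //; apply/eqP/negP => /negP h.
  by apply: no; exists i.
have Ei : c * (red s)`_i = theta N ^+ e * (red (t * v))`_i by rewrite -!coefZ E'.
have dv : ('X - a%:P) ^+ e %| map_poly j c * map_poly j (red s)`_i.
  rewrite -rmorphM Ei rmorphM rmorphXn dvdp_mulr // dvdp_exp2r //.
  by rewrite dvdp_XsubCl; apply/rootP.
move: dv; rewrite Gauss_dvdpl; last first.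
  by rewrite coprimep_expl // coprimep_sym coprimep_XsubC.
move/dvdp_leq; rewrite map_poly_eq0 => /(_ c0).
by rewrite size_exp_XsubC size_map_poly; apply: ltnW.
Qed.

Let factor u : ev2 u != 0 -> exists e s t,
  [/\ ev2 s * ev2 u = ev1 (theta N) ^+ e * ev2 t, evL s != 0 & evL t != 0].
Proof.
move=> u0; have [B BP] := divides_bound u0.
have ex0 : exists e, `[< divides u e >].
  by exists 0%N; apply/asboolP; exists 1, u; rewrite expr0 rmorph1 rmorph1 oner_neq0.
have bnd e : `[< divides u e >] -> (e <= B)%N by move/asboolP/BP.
case: (ex_maxnP ex0 bnd) => e /asboolP[s [t [E s0]]] emax.
exists e, s, t; split=> //; apply/eqP => t0.
(* If [t] vanished at the point, [theta_step] would produce one more factor, against the maximality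
   of [e]. *)
have [t' tE] := theta_step C t N_gt0; set s' := 1 - _ in tE.
suff : (e.+1 <= e)%N by rewrite ltnn.
apply: emax; apply/asboolP; exists (s' * s), t'; split.
  by rewrite rmorphM -mulrA E mulrCA tE exprS; ring.
rewrite rmorphM mulf_neq0 // /s' rmorphB rmorph1 rmorphXn t0 expr0n.
have := theta_exp_gt2 C N_gt0; case: (texp N) => [|[|n]] //= _.
by rewrite subr0 oner_neq0.
Qed.

Let factor_le u e s t e' s' t' :
  ev2 s * ev2 u = ev1 (theta N) ^+ e * ev2 t -> evL s != 0 ->
  ev2 s' * ev2 u = ev1 (theta N) ^+ e' * ev2 t' -> evL s' != 0 -> evL t' != 0 ->
  (e <= e')%N.
Proof.
move=> E s0 E' s0' t0'; rewrite leqNgt; apply/negP => lt.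
have th0 := theta_neq0 C N_gt0.
have : ev2 (s * t') = ev2 (s' * (theta N ^+ (e - e'))%:P * t).
  rewrite !rmorphM ev2C rmorphXn; apply: (mulfI (expf_neq0 e' th0)).
  transitivity (ev2 s * (ev1 (theta N) ^+ e' * ev2 t')); first by ring.
  rewrite -E' mulrCA E -{1}(subnK (ltnW lt)) exprD; ring.
move/evL_eq/eqP; rewrite !rmorphM ev2C rmorphXn evL_theta expr0n.
by rewrite subn_eq0 leqNgt lt /= mulr0 mul0r mulf_eq0 (negbTE s0) (negbTE t0').
Qed.

Let factor_uniq u e s t e' s' t' :
  ev2 s * ev2 u = ev1 (theta N) ^+ e * ev2 t -> evL s != 0 -> evL t != 0 ->
  ev2 s' * ev2 u = ev1 (theta N) ^+ e' * ev2 t' -> evL s' != 0 -> evL t' != 0 ->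
  e = e'.
Proof.
move=> E s0 t0 E' s0' t0'; apply/eqP; rewrite eqn_leq.
by rewrite (factor_le E s0 E') // (factor_le E' s0' E).
Qed.

(** The valuation of [u] is the exponent of [theta N] in its factorization with cofactors not
    vanishing at the point; [factor_le] makes it well defined and yields the ultrametric
    inequality. *)
Lemma geometric_place : exists P : place iota,
  val_ge P 0 x /\ forall u, val_ge P 1 (ev2 u) <-> evL u = 0.
Proof.
have nuex u : exists e : nat, (ev2 u = 0 -> e = 0%N) /\ (ev2 u != 0 -> exists s t,
    [/\ ev2 s * ev2 u = ev1 (theta N) ^+ e * ev2 t, evL s != 0 & evL t != 0]).
  have [u0|u0] := eqVneq (ev2 u) 0; first by exists 0%N.
  have [e [s [t h]]] := factor u0; exists e; split=> [/eqP|_]; last by exists s, t.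
  by rewrite (negbTE u0).
have [nu nuP'] := choice nuex.
have nuP u := proj2 (nuP' u).
have nuE u e s t : ev2 u != 0 -> ev2 s * ev2 u = ev1 (theta N) ^+ e * ev2 t ->
    evL s != 0 -> evL t != 0 -> nu u = e.
  move=> u0 E s0 t0; have [s' [t' [E' s0' t0']]] := nuP u u0.
  exact: (factor_uniq E' s0' t0' E s0 t0).
have nu_unit u : evL u != 0 -> nu u = 0%N.
  move=> u0; have u0' : ev2 u != 0.
    by apply: contraNneq u0 => u0; rewrite (@evL_eq u 0) ?rmorph0 ?u0.
  by apply: (nuE _ _ 1 u) => //; rewrite ?expr0 ?rmorph1 ?oner_neq0.
have th0 := theta_neq0 C N_gt0.
have [P PE] : exists P : place iota, forall u, ev2 u != 0 -> P (ev2 u) = (nu u)%:Z.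
  apply: (@extend_valuation _ _ _ _ ev2 (fun u => (nu u)%:Z)).
  - exact: as_generated C.
  - move=> u w u0 w0; rewrite -PoszD; congr Posz.
    have [s [t [E s0 t0]]] := nuP u u0; have [s' [t' [E' s0' t0']]] := nuP w w0.
    apply: (nuE _ _ (s * s') (t * t')); rewrite ?rmorphM ?mulf_neq0 //.
    by rewrite exprD mulrACA E E'; ring.
  - move=> u w; wlog le : u w / (nu u <= nu w)%N.
      move=> H u0 w0 uw0; have [le|/ltnW le] := leqP (nu u) (nu w); first exact: H.
      by rewrite minC addrC; apply: H => //; rewrite addrC.
    move=> u0 w0 uw0; rewrite min_l ?lez_nat //.
    have [s [t [E s0 t0]]] := nuP u u0; have [s' [t' [E' s0' t0']]] := nuP w w0.
    have [s1 [t1 [E1 s01 t01]]] := nuP _ uw0.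
    apply: (@factor_le (u + w) _ (s * s') (s' * t + s * (theta N ^+ (nu w - nu u))%:P * t')
      _ _ _ _ _ E1) => //; last by rewrite rmorphM mulf_neq0.
    rewrite (rmorphM ev2 s) (rmorphD ev2 u) (rmorphD ev2 (s' * t)) !rmorphM ev2C rmorphXn.
    transitivity (ev2 s' * (ev2 s * ev2 u) + ev2 s * (ev2 s' * ev2 w)); first by ring.
    by rewrite E E' -{1}(subnK le) exprD; ring.
  - move=> u w u0 e; congr Posz; have [s [t [E s0 t0]]] := nuP u u0.
    by apply/esym/(nuE _ _ s t) => //; rewrite -?e.
  - move=> c; exists c%:P%:P; first by rewrite ev2C ev1C.
    have [->|c0] := eqVneq c 0; last first.
      by congr Posz; apply: nu_unit; rewrite ev2C ev1C fmorph_eq0.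
    by congr Posz; apply: (proj1 (nuP' _)); rewrite ev2C ev1C rmorph0.
  - exists ((theta N)%:P), 1; rewrite ev2C th0 rmorph1 oner_neq0; split=> //.
    rewrite (nu_unit 1) ?rmorph1 ?oner_neq0 // subr0; congr Posz.
    by apply: (nuE _ _ 1 1); rewrite ?rmorph1 ?oner_neq0 ?ev2C // expr1 mulr1 mul1r.
exists P; split.
  have := as_x_neq0 C; rewrite -(ev1X iota x) -(ev2C iota x y) => x0.
  by right; rewrite PE.
move=> u; split=> [h|u0].
  apply/eqP/negP => /negP u0; have u0' : ev2 u != 0.
    by apply: contraNneq u0 => u0; rewrite (@evL_eq u 0) ?rmorph0 ?u0.
  by have := val_ge_maxE u0' h; rewrite PE // nu_unit.
have [->|u0'] := eqVneq (ev2 u) 0; first by left.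
right; rewrite PE //; have [s [t [E s0 t0]]] := nuP u u0'.
case: (nu u) E => // E.
have : ev2 (s * u) = ev2 t by rewrite rmorphM E expr0 mul1r.
by move/evL_eq/eqP; rewrite rmorphM u0 mulr0 eq_sym (negbTE t0).
Qed.

End GeometricPoint.

(** * Rational points and genus *)

Section RegularFunctions.
Variables (K : finFieldType) (F : fieldType) (iota : {rmorphism K -> F}).
Variables (q d : nat) (beta : {poly K}) (x y : F).
Hypothesis C : as_curve iota q d beta x y.

Let q_gt1 := as_q_gt1 C.
Let q_gt0 : (0 < q)%N. Proof. exact: ltnW. Qed.

Local Notation ev1 := (eval_x iota x).
Local Notation ev2 := (eval_xy iota x y).
Local Notation theta := (frob_poly K).
Local Notation reduced := (@is_reduced K q).
Implicit Types P : place iota.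

Lemma root_annihilator (L : fieldType) (j : {rmorphism K -> L}) (a : L) (c : {poly K}) :
  c != 0 -> root (map_poly j c) a -> exists2 r : {poly K}, (1 < size r)%N &
    forall p, root (map_poly j p) a -> r %| p.
Proof.
move=> c0 ca.
pose Q n := `[< exists r : {poly K}, [/\ r != 0, root (map_poly j r) a & size r = n] >].
have exQ : exists n, Q n by exists (size c); apply/asboolP; exists c.
case: (ex_minnP exQ) => n /asboolP[r [r0 ra <-]] rmin.
exists r.
  rewrite ltnNge; apply/negP => /size1_polyC rE.
  move: ra r0; rewrite rE map_polyC rootC fmorph_eq0 => /eqP->.
  by rewrite polyC0 eqxx.
move=> p pa; rewrite /dvdp; apply: contraT => m0.
have : (size r <= size (p %% r)%R)%N.
  apply: rmin; apply/asboolP; exists (p %% r); split=> //.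
  have := pa; rewrite {1}(divp_eq p r) rmorphD rmorphM /=.
  by rewrite /root !hornerE (rootP ra) mulr0 add0r.
by rewrite leqNgt ltn_modpN0.
Qed.

(** There are [q] points above [a], translates of each other, and [u(a, Y)] is a nonzero polynomial
    of degree less than [q]. *)
Lemma fiber_nonvanishing (L : closedFieldType) (j : {rmorphism K -> L}) (a : L) u :
  reduced u -> (exists i, (map_poly j u`_i).[a] != 0) ->
  exists2 b, b ^+ q - b = (map_poly j beta).[a] & eval_xy j a b u != 0.
Proof.
move=> ru [i ui]; set be := (map_poly j beta).[a].
have [b0] : exists b, root ('X^q - 'X - be%:P) b.
  apply/closed_rootP; rewrite -addrA -opprD size_polyDl.
    by rewrite size_polyXn eqSS -lt0n.
  rewrite size_polyXn size_polyN (leq_ltn_trans (size_polyD _ _)) // gtn_max.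
  by rewrite size_polyX ltnS q_gt1 (leq_ltn_trans (size_polyC_leq1 _)).
rewrite /root !hornerE subr_eq0 => /eqP b0E.
pose v := map_poly (eval_x j a) u.
have v0 : v != 0.
  by apply: contraNneq ui => v0; rewrite -[_.[a]]/(eval_x j a _) -coef_map -/v v0 coef0.
pose S := [pred e : K | e ^+ q == e].
have [e Se ve] : exists2 e, e \in S & v.[b0 + j e] != 0.
  apply: contrapT => no; move/eqP: v0; apply.
  apply: (@roots_geq_poly_eq0 _ _ [seq b0 + j e | e <- enum S]).
  - apply/allP => z /mapP[e eS ->{z}]; rewrite mem_enum in eS.
    by apply/rootP/eqP/negP => /negP h; apply: no; exists e.
  - rewrite map_inj_uniq ?enum_uniq // => e e' /addrI; exact: fmorph_inj.
  - rewrite size_map -cardE (as_card_fixed C).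
    by rewrite (leq_trans (size_poly _ _)).
exists (b0 + j e) => //.
have qL : [pchar L].-nat q by rewrite (eq_pnat _ (fmorph_pchar j)) (as_q_pchar C).
rewrite exprDn_pchar // -rmorphXn (eqP Se) -b0E; ring.
Qed.

(** The coordinate ring is integrally closed. Write [z = u / c] and let [a] be a root of [c]. If all
    coefficients of [u] vanish at [a], its minimal polynomial cancels and the degree of [c] drops;
    otherwise some point above [a] is not a zero of [u], and [z] has a pole at the place there. *)
Lemma regular_in_ring z : (forall P, val_ge P 0 x -> val_ge P 0 z) ->
  exists2 u, reduced u & z = ev2 u.
Proof.
move=> reg; have [u [c [ru c0 zE]]] := ev2_frac C z.
have [m le_m] := ubnP (size c); elim: m => // m IH in u c ru c0 zE le_m *.
have [c1|c1] := leqP (size c) 1.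
  have cE := size1_polyC c1; set k := c`_0 in cE.
  exists (k^-1%:P *: u); first exact: reducedZ.
  by rewrite zE cE -mul_polyC rmorphM ev2C !ev1C fmorphV mulrC.
have [L [j _]] := countable_algebraic_closure K.
have [a ca] : exists a, root (map_poly j c) a.
  by apply/closed_rootP; rewrite size_map_poly gtn_eqF.
have [r r1 rP] := root_annihilator c0 ca.
have [all0|/existsNP[i /eqP ui]] := pselect (forall i, (map_poly j u`_i).[a] = 0).
  have [c' cE] := dvdpP _ _ (rP c ca).
  have r0 : r != 0 by rewrite -size_poly_gt0 ltnW.
  have c'0 : c' != 0 by apply: contraNneq c0 => c'0; rewrite cE c'0 mul0r.
  pose u' := \poly_(i < size u) (u`_i %/ r).
  have uE : u = r *: u'.
    apply/polyP => i; rewrite coefZ coef_poly; case: ltnP => [lt|ge]; last first.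
      by rewrite nth_default // mulr0.
    by rewrite mulrC divpK //; apply: rP; apply/rootP.
  apply: (IH u' c') => //.
  - by rewrite /is_reduced (leq_trans (size_poly _ _)).
  - rewrite zE cE {1}uE -mul_polyC !rmorphM ev2C [ev1 c' * _]mulrC -mulf_div divff ?mul1r //.
    by rewrite (ev1_eq0 C).
  - have arith A B l : (1 < B)%N -> ((A + B).-1 < l.+1)%N -> (A < l)%N by lia.
    by apply: arith r1 _; move: le_m; rewrite cE size_mul.
have [|b on_curve ub] := @fiber_nonvanishing L j a u ru; first by exists i.
have [N [l [N0 dv]]] := theta_multiple c0.
have aN : a ^+ (#|K| ^ N) = a.
  have : root (map_poly j ('X^(#|K| ^ (N + l)) - 'X^(#|K| ^ l))) a.
    have [t ->] := dvdpP _ _ dv.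
    by rewrite rmorphM rootM ca orbT.
  rewrite rmorphB /= !map_polyXn /root !hornerE expnD exprM.
  have Kl : [pchar L].-nat (#|K| ^ l)%N.
    by rewrite (eq_pnat _ (fmorph_pchar j)) (pnat_card C).
  rewrite -exprNn_pchar // -exprDn_pchar // expf_eq0 => /andP[_].
  by rewrite subr_eq0 => /eqP.
have [P [hx hP]] := geometric_place C on_curve N0 aN.
have nu : ~ val_ge P 1 (ev2 u) by rewrite hP; apply/eqP.
have [u0 Pu] := val_ge0_unit (finite_ev2 C u hx) nu.
have hc : val_ge P 1 (ev1 c).
  by rewrite -(ev2C iota x y) hP ev2C; apply/eqP.
have c0' : ev1 c != 0 by rewrite (ev1_eq0 C).
have z0 : z != 0 by rewrite zE mulf_neq0 ?invr_eq0.
have := val_ge_maxE z0 (reg P hx); have := val_ge_maxE c0' hc.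
by rewrite zE placeM ?invr_eq0 // placeV Pu; clear; lia.
Qed.

(** The product of one function for each member of [s] other than [P], vanishing there but not at
    [P]; it exists because distinct finite places have incomparable centers. *)
Lemma finite_avoid P (s : seq (place iota)) : val_ge P 0 x ->
  (forall P', P' \in s -> val_ge P' 0 x) ->
  exists2 u, ~ val_ge P 1 (ev2 u) &
    forall P', val_ge P' 0 x -> P' <> P -> val_ge P' (count_mem P' s)%:Z (ev2 u).
Proof.
move=> hx; elim: s => [|P1 s IH] hs.
  exists 1; rewrite rmorph1; first exact: not_val_ge1_1.
  by move=> P' _ _; rewrite -(rmorph1 iota); apply: val_geC.
have [|u nu hu] := IH; first by move=> P' sP'; apply: hs; rewrite inE sP' orbT.
have [e|/eqP ne] := eqVneq P1 P.
  exists u => // P' hx' nP' /=; rewrite (_ : P1 == P' = false) ?add0n; first exact: hu.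
  by rewrite e; apply/eqP => e'; apply: nP'.
have hx1 : val_ge P1 0 x by apply: hs; rewrite inE eqxx.
have [w hw nw] : exists2 w, val_ge P1 1 (ev2 w) & ~ val_ge P 1 (ev2 w).
  apply: contrapT => no; apply: ne; apply: (finite_place_le C) => // w hw.
  by apply: contrapT => nw; apply: no; exists w.
exists (w * u) => [|P' hx' nP'].
  by rewrite rmorphM => /val_ge1_prime[]//; exact: (finite_ev2 C).
rewrite rmorphM /= PoszD; apply: val_geM; last exact: hu.
have [<-//|_] := eqVneq P1 P'; exact: (finite_ev2 C).
Qed.

Lemma finite_approx P (s : seq (place iota)) (e : nat) : val_ge P 0 x ->
  (forall P', P' \in s -> val_ge P' 0 x) ->
  exists u, [/\ ev2 u != 0, P (ev2 u) = e%:Z &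
    forall P', val_ge P' 0 x -> P' <> P -> val_ge P' (count_mem P' s)%:Z (ev2 u)].
Proof.
move=> hx hs; have [u nu hu] := finite_avoid hx hs.
have [N N0 hN] := finite_theta_ex C hx.
have th0 := theta_neq0 C N0; have Pth := finite_theta_val C hx N0 hN.
have [u0 Pu] := val_ge0_unit (finite_ev2 C u hx) nu.
have E : ev2 ((theta N ^+ e)%:P * u) = ev1 (theta N) ^+ e * ev2 u.
  by rewrite rmorphM ev2C rmorphXn.
exists ((theta N ^+ e)%:P * u); rewrite E; split.
- by rewrite mulf_neq0 ?expf_neq0.
- by rewrite placeM ?expf_neq0 // placeX // Pth Pu addr0 natz.
- move=> P' hx' nP'; rewrite -[_%:Z]add0r; apply: val_geM; last exact: hu.
  by apply/val_geX/finite_ev1.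
Qed.

Definition coord_ring : set F := [set z | exists u, z = ev2 u].

(** The list [s] encodes an effective divisor, each place being repeated according to its
    multiplicity. *)
Definition vanishing (s : seq (place iota)) : set F :=
  [set z | coord_ring z /\
           forall P, val_ge P 0 x -> val_ge P (count_mem P s)%:Z z].

Lemma subspace_coord_ring : subspace iota coord_ring.
Proof.
split; first by exists 0; rewrite rmorph0.
move=> c _ _ [u ->] [v ->]; exists (c%:P%:P * u + v).
by rewrite rmorphD rmorphM ev2C ev1C.
Qed.

Lemma subspace_vanishing s : subspace iota (vanishing s).
Proof.
split.
  by split=> [|P _]; [case: subspace_coord_ring | left].
move=> c z w [Oz hz] [Ow hw]; split.
  by case: subspace_coord_ring => _; apply.
move=> P hx; case: (subspace_val_ge P (count_mem P s)%:Z) => _; apply.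
  exact: hz.
exact: hw.
Qed.

(** Division by a function [t] vanishing along [s], to the exact order at [P], identifies the
    quotient with the residue field at [P], whose elements all lift to the coordinate ring. *)
Lemma vanishing_cons P s : val_ge P 0 x -> (forall P', P' \in s -> val_ge P' 0 x) ->
  quotient_dim iota (vanishing s) (vanishing (P :: s)) (place_degree P).
Proof.
move=> hx hs; have [b [hb bP]] := finite_degree C hx.
have [t [t0 Pt ht]] := finite_approx (count_mem P s) hx hs.
have [l lP] := choice (fun i => finite_residue C hx (hb i)).
have combE (c : {ffun 'I_(place_degree P) -> K}) w :
    val_ge P 1 (w - \sum_i iota (c i) * b i) <->
    val_ge P 1 (w - \sum_i iota (c i) * ev2 (l i)).
  have h : val_ge P 1 (\sum_i iota (c i) * b i - \sum_i iota (c i) * ev2 (l i)).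
    rewrite -sumrB; apply: val_ge_sum => i _; rewrite -mulrBr.
    by apply: val_ge1M => //; apply: val_geC.
  split=> hw; first by have := val_geD hw h; rewrite addrA subrK.
  by have := val_geB hw h; rewrite opprB addrA subrK.
have cnt P' : (count_mem P' (P :: s))%:Z = (P == P')%:Z + (count_mem P' s)%:Z :> int.
  by [].
have tl_in i : vanishing s (ev2 t * ev2 (l i)).
  split; first by exists (t * l i); rewrite rmorphM.
  move=> P' hx'; rewrite -[_%:Z]addr0; apply: val_geM; last exact: (finite_ev2 C).
  have [->|/eqP nP'] := eqVneq P' P; last exact: ht.
  by right; rewrite Pt.
have key z (c : {ffun 'I_(place_degree P) -> K}) : vanishing s z ->
   (vanishing (P :: s) (z - \sum_i iota (c i) * (ev2 t * ev2 (l i))) <->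
    val_ge P 1 (z / ev2 t - \sum_i iota (c i) * b i)).
  move=> Vz; rewrite combE.
  have E : z - \sum_i iota (c i) * (ev2 t * ev2 (l i)) =
      ev2 t * (z / ev2 t - \sum_i iota (c i) * ev2 (l i)).
    rewrite mulrBr mulrCA divff // mulr1 mulr_sumr; congr (_ - _).
    by apply: eq_bigr => i _; rewrite mulrCA.
  have Vd : vanishing s (z - \sum_i iota (c i) * (ev2 t * ev2 (l i))).
    apply: subspace_sub => //; first exact: subspace_vanishing.
    by apply: subspace_sum => //; apply: subspace_vanishing.
  split=> [[_ /(_ P hx)]|h].
    rewrite cnt eqxx E => h.
    have : val_ge P (- (count_mem P s)%:Z + (1 + (count_mem P s)%:Z))
      ((ev2 t)^-1 * (ev2 t * (z / ev2 t - \sum_i iota (c i) * ev2 (l i)))).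
      by apply: val_geM h; right; rewrite placeV Pt.
    by rewrite mulKf // addrCA addNr addr0.
  case: Vd => Od hd; split=> // P' hx'; rewrite cnt.
  have [<-|ne] := eqVneq P P'; last by rewrite add0r; apply: hd.
  by rewrite E addrC; apply: val_geM h; right; rewrite Pt.
exists (fun i => ev2 t * ev2 (l i)); split=> // z Vz.
have hzt : val_ge P 0 (z / ev2 t).
  rewrite -(subrr (count_mem P s)%:Z); apply: val_geM; first by case: Vz => _; apply.
  by right; rewrite placeV Pt.
have [c [cP cU]] := bP _ hzt; exists c; split; first exact/key.
by move=> e /key-/(_ Vz)/cU.
Qed.

Lemma vanishing_dim s : (forall P', P' \in s -> val_ge P' 0 x) ->
  quotient_dim iota coord_ring (vanishing s) (\sum_(P <- s) place_degree P)%N.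
Proof.
elim: s => [|P s IH] hs.
  rewrite big_nil; exists (fun=> 0); split=> [[]//|z Oz]; exists 0; split.
    by rewrite big_ord0 subr0; split=> // P hx; case: Oz => u ->; apply: (finite_ev2 C).
  by move=> c _; apply/ffunP=> -[].
have hs' P' : P' \in s -> val_ge P' 0 x by move=> sP; apply: hs; rewrite inE sP orbT.
rewrite big_cons; apply: (@quotient_dim_trans _ _ _ _ (vanishing s)).
- exact: subspace_vanishing.
- exact: subspace_vanishing.
- exact: subspace_coord_ring.
- move=> z [Oz hz]; split=> // P' hx'; apply: val_ge_le (hz P' hx').
  by rewrite /= PoszD lerDr.
- by move=> z [].
- by apply: vanishing_cons => //; apply: hs; rewrite inE eqxx.
- exact: IH.
Qed.

(** Multiples of [c(x)] vanish along [s], so the coordinate ring modulo the functions vanishing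
    along [s] is a quotient of the ring modulo [c(x)], which [span_mod_ev1] spans. *)
Lemma zeros_degree_le (c : {poly K}) s : c != 0 ->
  (forall P, P \in s -> val_ge P 0 x) ->
  (forall P, val_ge P 0 x -> val_ge P (count_mem P s)%:Z (ev1 c)) ->
  (\sum_(P <- s) place_degree P <= q * (size c).-1)%N.
Proof.
move=> c0 hs hc; pose I : finType := ('I_(size c).-1 * 'I_q)%type.
have -> : (q * (size c).-1)%N = #|I| by rewrite card_prod !card_ord mulnC.
pose W' : set F := fun z => exists t, z = ev1 c * ev2 t.
apply: (@quotient_dim_le_span _ _ iota coord_ring (vanishing s) W' _ I
  (fun i => x ^+ i.1 * y ^+ i.2)).
- exact: subspace_coord_ring.
- exact: subspace_vanishing.
- split; first by exists 0; rewrite rmorph0 mulr0.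
  move=> k _ _ [u ->] [v ->]; exists (k%:P%:P * u + v).
  by rewrite rmorphD rmorphM ev2C ev1C; ring.
- move=> _ [t ->]; split; first by exists (c%:P * t); rewrite rmorphM ev2C.
  move=> P hx; rewrite -[_%:Z]addr0; apply: val_geM; first exact: hc.
  exact: (finite_ev2 C).
- by move=> _ [u ->]; have [f [t E]] := span_mod_ev1 C u c0; exists f, t.
- exact: vanishing_dim.
Qed.

End RegularFunctions.

(** * Rational places and affine points *)

Section RationalPoints.
Variables (K : finFieldType) (F : fieldType) (iota : {rmorphism K -> F}).
Variables (q d : nat) (beta : {poly K}) (x y : F).
Hypothesis C : as_curve iota q d beta x y.

Local Notation ev1 := (eval_x iota x).
Local Notation ev2 := (eval_xy iota x y).
Implicit Types P : place iota.

Definition affine_points : pred (K * K) :=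
  [pred ab | ab.2 ^+ q - ab.2 == beta.[ab.1]].

Local Notation at_point a b := (eval_xy (idfun : {rmorphism K -> K}) a b).

Let at_x a b c : at_point a b ('X - c%:P)%:P = a - c.
Proof. by rewrite ev2C rmorphB ev1X ev1C. Qed.

Let at_y a b c : at_point a b ('X - c%:P%:P) = b - c.
Proof. by rewrite rmorphB ev2X ev2C ev1C. Qed.

Lemma place_of_point a b : (a, b) \in affine_points -> exists P,
  [/\ val_ge P 0 x, place_degree P = 1%N &
      forall u, val_ge P 1 (ev2 u) <-> at_point a b u = 0].
Proof.
rewrite inE /= => /eqP on_curve.
have on_curve' : b ^+ q - b = (map_poly (idfun : {rmorphism K -> K}) beta).[a].
  by rewrite map_poly_id.
have a1 : a ^+ (#|K| ^ 1) = a by rewrite expn1 expf_card.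
have [P [hx hP]] := geometric_place C on_curve' (isT : (0 < 1)%N) a1.
exists P; split=> //; apply: degree_one => z hz.
have [u hu] := finite_residue C hx hz; exists (at_point a b u).
have : val_ge P 1 (ev2 (u - (at_point a b u)%:P%:P)).
  by apply/hP; rewrite rmorphB ev2C ev1C subrr.
by rewrite rmorphB ev2C ev1C => h; have := val_geD hu h; rewrite addrA subrK.
Qed.

(** The residues of [x] and [y] are constants [a] and [b], and reduction modulo [P] is then
    evaluation at [(a, b)]. *)
Lemma point_of_place P : val_ge P 0 x -> place_degree P = 1%N -> exists a b,
  (a, b) \in affine_points /\
  forall u, val_ge P 1 (ev2 u) <-> at_point a b u = 0.
Proof.
move=> hx deg1; have res := degree_oneP deg1.
have [a ha] := res x hx; have [b hb] := res y (finite_y C hx).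
have congM z z' w w' : val_ge P 0 z -> val_ge P 0 w' -> val_ge P 1 (z - z') ->
    val_ge P 1 (w - w') -> val_ge P 1 (z * w - z' * w').
  move=> hz hw' hzz hww.
  have -> : z * w - z' * w' = z * (w - w') + w' * (z - z') by ring.
  by apply: val_geD; apply: val_ge1M.
have c1 c : val_ge P 1 (ev1 c - iota c.[a]).
  elim/poly_ind: c => [|c e IH]; first by rewrite horner0 !rmorph0 subr0; left.
  rewrite !hornerE !rmorphD !rmorphM ev1X ev1C opprD addrACA subrr addr0.
  by apply: congM => //; [apply: (finite_ev1 c hx) | apply: val_geC].
have c2 u : val_ge P 1 (ev2 u - iota (at_point a b u)).
  elim/poly_ind: u => [|u c IH]; first by rewrite !rmorph0 subr0; left.
  rewrite !rmorphD !rmorphM !ev2X !ev2C opprD addrACA; apply: val_geD.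
    by apply: congM => //; [apply: (finite_ev2 C) | apply: val_geC].
  rewrite (_ : eval_x _ a c = c.[a]) //.
  by rewrite -[LHS]/((map_poly idfun c).[a]) map_poly_id.
have hP u : val_ge P 1 (ev2 u) <-> at_point a b u = 0.
  split=> [h|h]; last by have := c2 u; rewrite h rmorph0 subr0.
  apply: (@not_val_ge1_const _ _ _ P).
  by have := val_geB h (c2 u); rewrite opprB addrC subrK.
exists a, b; split=> //; rewrite inE /= -subr_eq0; apply/eqP.
have := (hP (curve_poly q beta)).1; rewrite (ev2_curve_poly C) => /(_ (or_introl erefl)).
rewrite /curve_poly !rmorphB rmorphXn ev2X ev2C.
rewrite (_ : eval_x _ a beta = beta.[a]) //.
by rewrite -[LHS]/((map_poly idfun beta).[a]) map_poly_id.
Qed.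

Lemma rational_points_card : (@rational_points K F iota #= `I_#|affine_points|.+1)%card.
Proof.
have [Pinf Pinf_inf] := infinite_place_exists C.
have Ptex ab : exists P, ab \in affine_points -> [/\ val_ge P 0 x, place_degree P = 1%N &
    forall u, val_ge P 1 (ev2 u) <-> at_point ab.1 ab.2 u = 0].
  case: ab => a b; have [/place_of_point[P hP]|] := boolP ((a, b) \in affine_points).
    by exists P.
  by exists Pinf.
have [Pt PtP] := choice Ptex.
(* The last index, [#|affine_points|], stands for the place at infinity. *)
pose f i := if (i < #|affine_points|)%N then Pt (nth (0, 0) (enum affine_points) i) else Pinf.
have nthS i : (i < #|affine_points|)%N -> nth (0, 0) (enum affine_points) i \in affine_points.
  by move=> lt; rewrite -mem_enum mem_nth // -cardE.
have Pt_inj : {in affine_points &, injective Pt}.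
  move=> [a b] [a' b'] Sab Sab' e.
  have [_ _ h] := PtP _ Sab; have [_ _ h'] := PtP _ Sab'.
  congr (_, _).
    have := (h ('X - a'%:P)%:P).1; rewrite e h' !at_x /= subrr => /(_ erefl)/eqP.
    by rewrite subr_eq0 => /eqP.
  have := (h ('X - b'%:P%:P)).1; rewrite e h' !at_y /= subrr => /(_ erefl)/eqP.
  by rewrite subr_eq0 => /eqP.
have -> : @rational_points K F iota = (f @` `I_#|affine_points|.+1)%classic.
  apply/seteqP; split=> [P|_ [i lt_i <-]] /=.
    move=> deg1; have [hx|nx] := pselect (val_ge P 0 x).
      have [a [b [Sab hP]]] := point_of_place hx deg1.
      exists (index (a, b) (enum affine_points)).
        by rewrite ltnW // ltnS cardE index_mem mem_enum.
      rewrite /f cardE index_mem mem_enum Sab nth_index ?mem_enum //.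
      have [hx' _ hP'] := PtP _ Sab.
      apply: (finite_place_le C) => // u; rewrite hP'; exact: (hP u).2.
    exists #|affine_points|; first by rewrite /= ltnSn.
    rewrite /f ltnn; apply: (infinite_place_uniq C) => //.
    exact: (nonfinite_infinite C nx).
  rewrite /f /rational_points /=; case: ltnP => [lt|_].
    by case: (PtP _ (nthS i lt)).
  exact: (infinite_degree C Pinf_inf).
apply: inj_card_eq => i i'; rewrite !inE /= /f => lt_i lt_i'.
case: ltnP => [lt|ge]; case: ltnP => [lt'|ge'].
- move/(Pt_inj _ _ (nthS _ lt) (nthS _ lt'))/eqP.
  by rewrite nth_uniq -?cardE ?enum_uniq // => /eqP.
- move=> e; exfalso; have [hx _ _] := PtP _ (nthS _ lt).
  by apply: (infinite_not_finite C Pinf_inf); rewrite -e.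
- move=> e; exfalso; have [hx _ _] := PtP _ (nthS _ lt').
  by apply: (infinite_not_finite C Pinf_inf); rewrite e.
- rewrite !ltnS in lt_i lt_i'; move=> _; apply/eqP.
  by rewrite eqn_leq (leq_trans lt_i ge') (leq_trans lt_i' ge).
Qed.

End RationalPoints.

(** * Counting monomials of bounded weight *)

Section LatticePoints.
Variables (q h M : nat).
Hypotheses (q_gt1 : (1 < q)%N) (h_gt0 : (0 < h)%N) (M_ge : (q ^ h <= M)%N).

(** With [T = q ^ h.-1], the condition for [0 < j < q] is [i + T * j < M], which leaves [M - T * j]
    values of [i], and there are [M.+1] of them for [j = 0]. Doubling avoids the fraction in the sum
    of the [j]. *)
Lemma lattice_points_card : (2 * #|[pred ij : 'I_M.+1 * 'I_q |
    q * ij.1 + (q ^ h).+1 * ij.2 <= q * M]| + q.-1 * q ^ h = 2 * (q * M).+1)%N.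
Proof.
have [h' hE] : exists h', h = h'.+1 by case: h h_gt0 => // h' _; exists h'.
have [q' qE] : exists q', q = q'.+1 by case: q q_gt1 => // q' _; exists q'.
pose T := (q ^ h')%N; have TE : (q ^ h = q * T)%N by rewrite hE expnS.
have fiber (k N : nat) : (k <= N)%N -> (\sum_(i < N | (i < k)%N) 1 = k)%N.
  by move=> le_kN; rewrite -(big_ord_widen _ (fun=> 1%N)) // sum1_card card_ord.
have -> : #|[pred ij : 'I_M.+1 * 'I_q | (q * ij.1 + (q ^ h).+1 * ij.2 <= q * M)%N]| =
    (\sum_(j < q) \sum_(i < M.+1 | q * i + (q ^ h).+1 * j <= q * M) 1)%N.
  rewrite -sum1_card (eq_bigl (fun ij : 'I_M.+1 * 'I_q =>
    true && (q * ij.1 + (q ^ h).+1 * ij.2 <= q * M)%N)) //.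
  rewrite -(pair_big_dep xpredT (fun (i : 'I_M.+1) (j : 'I_q) =>
     (q * i + (q ^ h).+1 * j <= q * M)%N) (fun _ _ => 1%N)) /=.
  by rewrite (exchange_big_dep xpredT).
have le_TM (j : nat) : (j < q')%N -> (T * j.+1 <= M)%N.
  by move=> lt; apply: leq_trans M_ge; rewrite TE mulnC leq_mul2r qE ltnW ?orbT.
have -> : (\sum_(j < q) \sum_(i < M.+1 | q * i + (q ^ h).+1 * j <= q * M) 1 =
    M.+1 + \sum_(j < q') (M - T * j.+1))%N.
  have H (j : nat) : (j < q)%N ->
     (\sum_(i < M.+1 | q * i + (q ^ h).+1 * j <= q * M) 1 =
      if j == 0 then M.+1 else M - T * j)%N.
    move=> lt; rewrite -[RHS](@fiber _ M.+1); last first.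
      by case: eqP => // _; rewrite (leq_trans (leq_subr _ _)).
    apply: eq_bigl => i; rewrite TE.
    case: eqP => [->|/eqP j0]; first by rewrite muln0 addn0 leq_mul2l ltn_ord -ltnS ltn_ord orbT.
    have -> : (q * i + (q * T).+1 * j = q * (i + T * j) + j)%N by nia.
    rewrite ltn_subRL; have j1 : (0 < j)%N by rewrite lt0n.
    apply/idP/idP => [le|le]; last by move: le lt; rewrite addnC; clear; nia.
    by rewrite addnC; move: le lt j1; clear; nia.
  rewrite (eq_bigr (fun j : 'I_q => if j == 0%N :> nat then M.+1 else (M - T * j)%N)); last first.
    by move=> j _; apply: H.
  by move: (q) qE => ? ->; rewrite big_ord_recl.
have S1 : (\sum_(j < q') (M - T * j.+1) + T * \sum_(j < q') j.+1 = q' * M)%N.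
  rewrite big_distrr -big_split /= (eq_bigr (fun=> M)) ?sum_nat_const ?card_ord //.
  by move=> j _; rewrite subnK // le_TM.
have S2 n : (2 * \sum_(j < n) j.+1 = n * n.+1)%N.
  by elim: n => [|n IH]; rewrite ?big_ord0 // big_ord_recr mulnDr IH /=; nia.
have := S2 q'; move: S1; rewrite TE qE; clear.
set A := (\sum_(j < q') (M - _))%N; set B := (\sum_(j < q') _)%N => S1 S2.
have : (T * (2 * B) = T * (q' * q'.+1))%N by rewrite S2.
by rewrite mulSn /=; nia.
Qed.

End LatticePoints.

(** * The genus *)

Section Genus.
Variables (K : finFieldType) (F : fieldType) (iota : {rmorphism K -> F}).
Variables (q d : nat) (beta : {poly K}) (x y : F).
Hypothesis C : as_curve iota q d beta x y.
Variables (h g : nat).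
Hypotheses (h_gt0 : (0 < h)%N) (dE : d = (q ^ h).+1) (gE : (2 * g = q.-1 * q ^ h)%N).

Let q_gt1 := as_q_gt1 C.
Let q_gt0 : (0 < q)%N. Proof. exact: ltnW. Qed.

Local Notation ev1 := (eval_x iota x).
Local Notation ev2 := (eval_xy iota x y).
Local Notation theta := (frob_poly K).
Local Notation reduced := (@is_reduced K q).
Local Notation weight := (weighted_degree q d).
Local Notation inf := (infinite_place q d x y).
Local Notation LL := (@riemann_roch_space K F iota).
Local Notation deg := place_degree.
Implicit Types P : place iota.

Lemma finiteVinfinite P : val_ge P 0 x \/ inf P.
Proof.
have [|nf] := pselect (val_ge P 0 x); first by left.
by right; apply: (nonfinite_infinite C).
Qed.

Lemma place_dim P : quotient_dim iota (val_ge P 0) (val_ge P 1) (deg P).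
Proof.
case: (finiteVinfinite P) => [hx|hP]; first exact: (finite_degree C).
rewrite (infinite_degree C hP); apply: degree_one_dim => z.
exact: (infinite_residue C).
Qed.

Lemma place_val_surj P (e : int) : exists2 t, t != 0 & P t = e.
Proof.
have [z [z0 Pz]] : exists z, z != 0 /\ P z = 1 by case: (place_valP P).
case: e => n.
  by exists (z ^+ n); rewrite ?expf_neq0 // placeX // Pz natz.
exists (z ^+ n.+1)^-1; first by rewrite invr_eq0 expf_neq0.
by rewrite placeV placeX // Pz natz NegzE.
Qed.

Lemma riemann_rochP (E : place iota -> int) z :
  LL E z <-> forall P, val_ge P (- E P) z.
Proof.
split=> [[->|hz] P|hz]; [by left | by right | ].
have [->|z0] := eqVneq z 0; first by left.
by right=> P; apply: val_ge_maxE.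
Qed.

Lemma subspace_riemann_roch (E : place iota -> int) : subspace iota (LL E).
Proof.
split; first by left.
move=> c z w /riemann_rochP hz /riemann_rochP hw; apply/riemann_rochP => P.
by case: (subspace_val_ge P (- E P)) => _; apply.
Qed.

Let zero_sub := subspace0 iota.

(** Multiplication by a function of order [E P0 + 1] at [P0] embeds the quotient of the two spaces
    into the residue field at [P0]. *)
Lemma riemann_roch_cons (E : place iota -> int) P0 n' :
  quotient_dim iota (LL (fun P => E P + (P0 == P)%:Z)) [set 0] n' ->
  exists2 n, quotient_dim iota (LL E) [set 0] n & (n' <= n + deg P0)%N.
Proof.
move=> hn'; set E' := fun P => _ in hn'.
have sub z : LL E z -> LL E' z.
  move/riemann_rochP => hz; apply/riemann_rochP => P; apply: val_ge_le (hz P).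
  by rewrite lerN2 lerDl.
have sE := subspace_riemann_roch E; have sE' := subspace_riemann_roch E'.
have [n _ hn] : exists2 n, (n <= n')%N & quotient_dim iota (LL E) [set 0] n.
  by apply: (@quotient_dim_embed _ _ _ _ _ (LL E') [set 0] idfun) hn'.
have [t t0 Pt] := place_val_surj P0 (E P0 + 1).
have [e le_e he] : exists2 e, (e <= deg P0)%N & quotient_dim iota (LL E') (LL E) e.
  have [s0 s1] := (subspace_val_ge P0 0, subspace_val_ge P0 1).
  apply: (@quotient_dim_embed _ _ _ _ _ (val_ge P0 0) (val_ge P0 1)
    (t \*o idfun) _ sE' sE s0 s1 _ _ _ (place_dim P0)).
  - by move=> c z; rewrite /= mulrCA.
  - move=> z /riemann_rochP/(_ P0) hz.
    have ht : val_ge P0 (E P0 + 1) t by right; rewrite Pt.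
    by have := val_geM ht hz; rewrite /E' eqxx subrr.
  - move=> z /riemann_rochP hz htz; apply/riemann_rochP => P.
    have [<-|ne] := eqVneq P0 P; last first.
      by have := hz P; rewrite /E' (negbTE ne) addr0.
    have ht : val_ge P0 (- (E P0 + 1)) t^-1 by right; rewrite placeV Pt.
    by have := val_geM ht htz; rewrite /= mulKf // opprD addrNK.
exists n => //; apply: (@leq_trans (n + e)); last by rewrite leq_add2l.
by rewrite (quotient_dim_uniq sE' zero_sub hn' (quotient_dim_trans zero_sub sE sE' _ sub hn he)) //
  => z ->; left.
Qed.

Lemma riemann_roch_cat (E : place iota -> int) s n' :
  quotient_dim iota (LL (fun P => E P + (count_mem P s)%:Z)) [set 0] n' ->
  exists2 n, quotient_dim iota (LL E) [set 0] n & (n' <= n + \sum_(P <- s) deg P)%N.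
Proof.
elim: s E n' => [|P0 s IH] E n' hn'.
  exists n'; last by rewrite big_nil addn0.
  by move: hn'; congr (quotient_dim _ (LL _) _ _); apply/funext => P; rewrite addr0.
have [|n1 hn1 le1] := IH (fun P => E P + (P0 == P)%:Z) n'.
  move: hn'; congr (quotient_dim _ (LL _) _ _); apply/funext => P /=.
  by rewrite PoszD addrA.
have [n hn le] := riemann_roch_cons hn1.
exists n => //; rewrite big_cons; move: le le1; lia.
Qed.

Definition pole_divisor (m : int) : place iota -> int :=
  fun P => if `[< val_ge P 0 x >] then 0 else m.

Lemma pole_divisor_finite m P : val_ge P 0 x -> pole_divisor m P = 0.
Proof. by move=> hx; rewrite /pole_divisor asboolT. Qed.

Lemma pole_divisor_infinite m P : inf P -> pole_divisor m P = m.
Proof.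
by move=> hP; rewrite /pole_divisor asboolF //; apply: (infinite_not_finite C).
Qed.

(** By [regular_in_ring] these functions lie in the coordinate ring, and the reduced monomials of
    weight at most [q * M] form a basis; [lattice_points_card] counts them. *)
Lemma pole_space_dim M n : (q ^ h <= M)%N -> (n + g = q * M + 1)%N ->
  quotient_dim iota (LL (pole_divisor (q * M)%N%:Z)) [set 0] n.
Proof.
move=> leM nE.
pose Q := [pred ij : 'I_M.+1 * 'I_q | (q * ij.1 + d * ij.2 <= q * M)%N].
pose I : finType := {ij : 'I_M.+1 * 'I_q | Q ij}.
have -> : n = #|I|.
  rewrite card_sig; have := lattice_points_card q_gt1 h_gt0 leM.
  rewrite -dE -/Q -gE (eq_card (B := Q)) //; move: nE; clear; lia.
pose b (ij : I) := x ^+ (val ij).1 * y ^+ (val ij).2.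
pose U (c : {ffun I -> K}) : {poly {poly K}} :=
  \sum_(ij : I) (c ij *: 'X^((val ij).1)) *: 'X^((val ij).2).
have evU c : ev2 (U c) = \sum_ij iota (c ij) * b ij.
  by rewrite rmorph_sum; apply: eq_bigr => ij _; rewrite ev2_monomial mulrA.
have coefU c (ij : I) : (U c)`_((val ij).2 : nat)`_((val ij).1 : nat) = c ij.
  rewrite !coef_sum (bigD1 ij) //= !coefZ coefXn eqxx mulr1 coefZ coefXn eqxx mulr1.
  rewrite big1 ?addr0 // => ij' ne; rewrite coefZ coefXn.
  case: eqP => [e2|_]; last by rewrite mulr0 coef0.
  rewrite mulr1 coefZ coefXn; case: eqP => [e1|_]; last by rewrite mulr0.
  case/eqP: ne; apply/val_inj.
  rewrite /= [sval ij']surjective_pairing [sval ij]surjective_pairing.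
  by congr (_, _); apply/val_inj/esym.
have redU c : reduced (U c).
  apply: (big_ind reduced) => [|u v ru rv|ij _]; first by rewrite /is_reduced size_poly0.
    by rewrite /is_reduced (leq_trans (size_polyD _ _)) // geq_max; apply/andP.
  exact: reduced_monomial.
have [Pinf Pinf_inf] := infinite_place_exists C.
apply: (@quotient_dim_fin _ _ _ _ _ _ b) => [ij|z /riemann_rochP hz].
  apply/riemann_rochP => P; case: (finiteVinfinite P) => [hx|hP].
    rewrite pole_divisor_finite // oppr0 -[0]addr0.
    by apply: val_geM; apply: val_geX => //; apply: (finite_y C).
  rewrite pole_divisor_infinite //.
  have := ev2_monomial iota x y 1 (val ij).1 (val ij).2.
  rewrite rmorph1 mul1r => E; right; rewrite /b -E hP ?reduced_monomial //.
    rewrite weight_monomial ?oner_neq0 // lerN2 lez_nat.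
    by have := valP ij.
  rewrite -(ev2_reduced_eq0 C) ?reduced_monomial // E.
  by rewrite mulf_neq0 ?expf_neq0 ?(as_x_neq0 C) ?(as_y_neq0 C).
have [u ru zE] : exists2 u, reduced u & z = ev2 u.
  apply: (regular_in_ring C) => P hx.
  by have := hz P; rewrite pole_divisor_finite // oppr0.
have wu : (weight u <= q * M)%N.
  have [->|u0] := eqVneq u 0; first by rewrite /weighted_degree rmorph0 size_poly0.
  have := hz Pinf; rewrite pole_divisor_infinite // zE.
  have eu0 : ev2 u != 0 by rewrite (ev2_reduced_eq0 C).
  by move/(val_ge_maxE eu0); rewrite Pinf_inf // lerN2 lez_nat.
pose c := [ffun ij : I => u`_((val ij).2 : nat)`_((val ij).1 : nat)].
have uE : u = U c.
  apply/polyP => j; apply/polyP => i.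
  have [uij|uij] := eqVneq (u`_j`_i) 0; last first.
    have wij := (weight_le d q_gt1 u (q * M)).1 wu i j uij.
    have jq : (j < q)%N.
      by rewrite ltnNge; apply: contraNN uij => le; rewrite (nth_default _ (leq_trans ru le)) coef0.
    have iM : (i < M.+1)%N.
      by rewrite ltnS -(leq_pmul2l q_gt0) (leq_trans _ wij) // leq_addr.
    pose ij : I := exist _ (Ordinal iM, Ordinal jq) wij.
    by have := coefU c ij; rewrite ffunE.
  rewrite uij /U coef_sum coef_sum big1 // => ij _.
  rewrite coefZ coefXn; case: eqP => [e2|_]; last by rewrite mulr0 coef0.
  rewrite mulr1 coefZ coefXn; case: eqP => [e1|_]; last by rewrite mulr0.
  by rewrite mulr1 ffunE -e1 -e2.
exists c; split; first by rewrite /= -evU -uE zE subrr.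
move=> e /= /eqP; rewrite subr_eq0 zE -evU => /eqP /(reduced_ev2_inj C ru (redU e)) ue.
by apply/ffunP => ij; rewrite ffunE ue coefU.
Qed.

Definition multiples (e : place iota -> nat) (r : seq (place iota)) :=
  flatten [seq nseq (e P) P | P <- r].

Lemma mem_multiples e r P : P \in multiples e r -> P \in r.
Proof. by case/flatten_mapP => P' rP'; rewrite mem_nseq => /andP[_ /eqP->]. Qed.

Lemma count_multiples e r P : uniq r ->
  count_mem P (multiples e r) = if P \in r then e P else 0%N.
Proof.
elim: r => [|P' r IH] //= /andP[nr ur].
rewrite /multiples /= count_cat count_nseq -/(multiples e r) IH // in_cons /=.
by have [<-|_] := eqVneq P' P; rewrite ?(negbTE nr) ?mul1n ?addn0.
Qed.

Lemma sum_multiples e r (f : place iota -> nat) :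
  (\sum_(P <- multiples e r) f P = \sum_(P <- r) e P * f P)%N.
Proof.
rewrite big_flatten big_map; apply: eq_bigr => P _.
by rewrite big_nseq iter_addn addn0 mulnC.
Qed.

Lemma enum_bounded (Q : place iota -> Prop) B :
  (forall s, uniq s -> (forall P, P \in s -> Q P) -> (size s <= B)%N) ->
  exists r : seq (place iota), forall P, Q P <-> P \in r.
Proof.
move=> bnd; pose T n := `[< exists s : seq (place iota),
  [/\ uniq s, (forall P, P \in s -> Q P) & size s = n] >].
have ex0 : exists n, T n by exists 0%N; apply/asboolP; exists [::].
have Tbnd n : T n -> (n <= B)%N by move=> /asboolP[s [us hs <-]]; apply: bnd.
case: (ex_maxnP ex0 Tbnd) => n /asboolP[s [us hs <-]] smax.
exists s => P; split; last exact: hs.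
move=> QP; apply: contraT => nP.
suff : (size (P :: s) <= size s)%N by rewrite ltnn.
apply: smax; apply/asboolP; exists (P :: s); split=> //=; first by rewrite nP.
by move=> P'; rewrite inE => /orP[/eqP->//|/hs].
Qed.

Lemma divisor_degreeE (D : place iota -> int) r : uniq r ->
  (forall P, D P != 0 -> P \in r) ->
  divisor_degree D = \sum_(P <- r) D P * (deg P)%:Z.
Proof.
move=> ur hr; rewrite /divisor_degree (fsbigE r) //=.
  by apply: eq_bigl => P; rewrite in_setT.
move=> P _; apply: contraNeq => DP; apply: hr.
by apply: contraNneq DP => ->; rewrite mul0r.
Qed.

Lemma common_multiple (e : place iota -> nat) (r : seq (place iota)) :
  exists2 c : {poly K}, c != 0 & forall P, P \in r -> val_ge P 0 x ->
    val_ge P (e P)%:Z (ev1 c).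
Proof.
elim: r => [|P r [c c0 hc]]; first by exists 1; rewrite ?oner_neq0.
have [hx|nx] := pselect (val_ge P 0 x); last first.
  exists c => // P'; rewrite inE => /orP[/eqP->//|]; exact: hc.
have [N N0 hN] := finite_theta_ex C hx.
have Pth := finite_theta_val C hx N0 hN; have th0 := theta_neq0 C N0.
exists (theta N ^+ e P * c).
  by rewrite mulf_neq0 ?expf_neq0 // -(ev1_eq0 C).
move=> P' rP' hx'; rewrite rmorphM rmorphXn.
move: rP'; rewrite inE => /orP[/eqP->|rP'].
  rewrite -[_%:Z]addr0; apply: val_geM; last exact: (finite_ev1 c hx).
  by right; rewrite placeX // Pth natz.
rewrite -[_%:Z]add0r; apply: val_geM; last exact: hc.
by apply/val_geX/finite_ev1.
Qed.

(** [D] is enlarged to [D1], the sum of [q M] times infinity and the divisor of [c(x)].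
    Multiplication by [c(x)] shows that [D1] has the same dimension [q M + 1 - g] as the pole
    divisor, and its degree is at most [q M] by [zeros_degree_le]. Going back from [D1] to [D] loses
    at most the degree of the difference. *)
Lemma genus_upper_bound (D : place iota -> int) : is_divisor D ->
  divisor_degree D - (riemann_roch_dim D)%:Z + 1 <= g%:Z.
Proof.
move=> /finite_seqP[r0 r0E].
have hr0 P : D P != 0 -> P \in r0.
  by move=> DP; have : [set` r0]%classic P by rewrite -r0E.
have [Pinf Pinf_inf] := infinite_place_exists C.
have [c c0 hc] := common_multiple (fun P => `|D P|%N) r0.
have c0' : ev1 c != 0 by rewrite (ev1_eq0 C).
have val_c P : val_ge P 0 x -> 0 <= P (ev1 c).
  by move=> hx; apply: (val_ge_maxE c0'); apply: finite_ev1.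
(* The zeros of [c(x)] are finite in number, each contributing at least 1 to a bounded sum of
   degrees. *)
have [r1 r1P] : exists r : seq (place iota), forall P,
    (val_ge P 0 x /\ val_ge P 1 (ev1 c)) <-> P \in r.
  apply: (@enum_bounded _ (q * (size c).-1)) => s us hs.
  apply: leq_trans (zeros_degree_le C (s := s) c0 _ _).
  - rewrite -sum1_size big_seq [in X in (_ <= X)%N]big_seq.
    by apply: leq_sum => P /hs[hx _]; apply: (finite_degree_gt0 C).
  - by move=> P /hs[].
  - move=> P hx; rewrite count_uniq_mem //.
    by have [/hs[]//|_] := boolP (P \in s); apply: finite_ev1.
pose rf := undup [seq P <- r0 ++ r1 | `[< val_ge P 0 x >]].
have rf_fin P : P \in rf -> val_ge P 0 x.
  by rewrite mem_undup mem_filter => /andP[/asboolP].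
have ur : uniq (Pinf :: rf).
  rewrite /= undup_uniq andbT; apply/negP => /rf_fin.
  exact: (infinite_not_finite C).
(* The term [m] compensates the pole of [c(x)] at infinity, [|D Pinf|] makes [D1] dominate [D]
   there, and [q ^ h] is the threshold of [pole_space_dim]. *)
pose m := (size c).-1; pose M := (m + `|D Pinf| + q ^ h)%N.
have leM : (q ^ h <= M)%N by rewrite leq_addl.
have g_le : (g <= q * M + 1)%N.
  by move: gE leM q_gt0; clear; nia.
have [n nE] : exists n, (n + g = q * M + 1)%N.
  by exists (q * M + 1 - g)%N; rewrite subnK.
have hn := pole_space_dim leM nE.
pose D1 P : int := if `[< val_ge P 0 x >] then P (ev1 c) else (q * M)%N%:Z - (q * m)%N%:Z.
have D1_fin P : val_ge P 0 x -> D1 P = P (ev1 c) by move=> hx; rewrite /D1 asboolT.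
have D1_inf P : inf P -> D1 P = (q * M)%N%:Z - (q * m)%N%:Z.
  by move=> hP; rewrite /D1 asboolF //; apply: (infinite_not_finite C).
have le_D P : D P <= D1 P.
  case: (finiteVinfinite P) => [hx|hP].
    rewrite D1_fin //; have [->|DP] := eqVneq (D P) 0; first exact: val_c.
    have := val_ge_maxE c0' (hc P (hr0 P DP) hx); lia.
  rewrite D1_inf // (infinite_place_uniq C hP Pinf_inf) /M.
  by move: q_gt0; clear; nia.
have D1_out P : P \notin Pinf :: rf -> D1 P = D P.
  move=> nP; have hx : val_ge P 0 x.
    case: (finiteVinfinite P) => // hP; move: nP.
    by rewrite (infinite_place_uniq C hP Pinf_inf) mem_head.
  move: nP; rewrite inE negb_or mem_undup mem_filter (asboolT hx) /= => /andP[_].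
  rewrite mem_cat negb_or => /andP[n0 n1].
  have -> : D P = 0 by apply/eqP; apply: contraNT n0 => /hr0.
  rewrite D1_fin //; apply: (@val_ge0_unit _ _ _ P (ev1 c) _ _).2.
    exact: finite_ev1.
  by move=> h1; move/negP: n1; apply; apply/r1P.
pose e P := `|D1 P - D P|%N.
pose s := multiples e (Pinf :: rf).
have sE : (fun P => D P + (count_mem P s)%:Z) = D1.
  apply/funext => P; rewrite count_multiples //; case: ifP => [_|/negbT/D1_out->].
    by rewrite /e gez0_abs ?subr_ge0 // addrCA subrr addr0.
  by rewrite addr0.
have s1 := subspace_riemann_roch D1.
have sp := subspace_riemann_roch (pole_divisor (q * M)%N).
have lin (t : F) k (z : F) : t * (iota k * z) = iota k * (t * z) by rewrite mulrCA.
have mulD1 z : LL (pole_divisor (q * M)%N) (ev1 c * z) <-> LL D1 z.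
  have D1E P : D1 P = pole_divisor (q * M)%N P + P (ev1 c).
    case: (finiteVinfinite P) => [hx|hP].
      by rewrite D1_fin // pole_divisor_finite // add0r.
    by rewrite D1_inf // pole_divisor_infinite // (infinite_place_ev1 C).
  split=> /riemann_rochP hz; apply/riemann_rochP => P.
    have hv : val_ge P (- P (ev1 c)) (ev1 c)^-1 by right; rewrite placeV.
    by have := val_geM hv (hz P); rewrite mulKf // -opprD addrC -D1E.
  have hv : val_ge P (P (ev1 c)) (ev1 c) by right.
  by have := val_geM hv (hz P); rewrite D1E opprD addrCA subrr addr0.
have [n1 _ hn1] : exists2 n1, (n1 <= n)%N & quotient_dim iota (LL D1) [set 0] n1.
  apply: (@quotient_dim_embed _ _ _ _ _ _ [set 0] (ev1 c \*o idfun) _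
    s1 zero_sub sp zero_sub _ _ _ hn) => [k z|z /mulD1//|z _ /= /eqP].
    exact: lin.
  by rewrite mulf_eq0 (negbTE c0') => /eqP.
have [n2 le_n2 hn2] : exists2 n2, (n2 <= n1)%N &
    quotient_dim iota (LL (pole_divisor (q * M)%N)) [set 0] n2.
  apply: (@quotient_dim_embed _ _ _ _ _ _ [set 0] ((ev1 c)^-1 \*o idfun) _
    sp zero_sub s1 zero_sub _ _ _ hn1) => [k z|z hz|z _ /= /eqP].
  - exact: lin.
  - by apply/mulD1; rewrite /= mulVKf.
  - by rewrite mulf_eq0 invr_eq0 (negbTE c0') => /eqP.
have n2E : n2 = n := quotient_dim_uniq sp zero_sub hn2 hn.
have [nD hnD le_n1] : exists2 n', quotient_dim iota (LL D) [set 0] n' &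
    (n1 <= n' + \sum_(P <- s) deg P)%N.
  by apply: riemann_roch_cat; rewrite sE.
rewrite (_ : riemann_roch_dim D = nD); last first.
  by apply: qdimE => //; apply: subspace_riemann_roch.
rewrite (divisor_degreeE ur); last first.
  move=> P DP; case: (finiteVinfinite P) => [hx|hP].
    by rewrite inE mem_undup mem_filter (asboolT hx) mem_cat hr0 ?orbT.
  by rewrite (infinite_place_uniq C hP Pinf_inf) mem_head.
have sum_s : (\sum_(P <- s) deg P)%N%:Z = \sum_(P <- Pinf :: rf) (D1 P - D P) * (deg P)%:Z.
  rewrite sum_multiples (big_morph Posz PoszD (erefl _)); apply: eq_bigr => P _.
  by rewrite PoszM /e gez0_abs // subr_ge0.
have sum_c : \sum_(P <- rf) P (ev1 c) * (deg P)%:Z <= (q * m)%N%:Z.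
  pose e' P := `|P (ev1 c)|%N.
  have -> : \sum_(P <- rf) P (ev1 c) * (deg P)%:Z = (\sum_(P <- multiples e' rf) deg P)%N%:Z.
    rewrite sum_multiples (big_morph Posz PoszD (erefl _)) big_seq [RHS]big_seq.
    by apply: eq_bigr => P /rf_fin hx; rewrite PoszM /e' gez0_abs // val_c.
  rewrite lez_nat; apply: (zeros_degree_le C) => //.
    by move=> P /mem_multiples/rf_fin.
  move=> P hx; rewrite count_multiples ?undup_uniq //; case: ifP => _; last exact: finite_ev1.
  by right; rewrite /e' gez0_abs // val_c.
have sum_D1 : \sum_(P <- Pinf :: rf) D1 P * (deg P)%:Z <= (q * M)%N%:Z.
  rewrite big_cons D1_inf // (infinite_degree C) // mulr1.
  rewrite (_ : \sum_(P <- rf) _ = \sum_(P <- rf) P (ev1 c) * (deg P)%:Z); first by lia.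
  by rewrite big_seq [RHS]big_seq; apply: eq_bigr => P /rf_fin hx; rewrite D1_fin.
move: sum_s sum_D1.
under [X in _ = X -> _]eq_bigr do rewrite mulrBl.
rewrite sumrB; move: (\sum_(P <- _) _ * _) (\sum_(P <- _) _ * _) => A B.
rewrite n2E in le_n2; move: le_n1 le_n2 nE; clear; lia.
Qed.

Lemma genus_attained : exists D : place iota -> int, is_divisor D /\
  divisor_degree D - (riemann_roch_dim D)%:Z + 1 = g%:Z.
Proof.
have [Pinf Pinf_inf] := infinite_place_exists C.
pose M := (q ^ h)%N.
have [n nE] : exists n, (n + g = q * M + 1)%N.
  exists (q * M + 1 - g)%N; rewrite subnK //.
  by move: gE q_gt0; rewrite -/M; clear; nia.
have hn := pole_space_dim (leqnn M) nE.
have supp P : pole_divisor (q * M)%N P != 0 -> P \in [:: Pinf].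
  case: (finiteVinfinite P) => [hx|hP]; first by rewrite pole_divisor_finite ?eqxx.
  by rewrite (infinite_place_uniq C hP Pinf_inf) mem_head.
exists (pole_divisor (q * M)%N); split.
  apply: (@sub_finite_set _ _ [set` [:: Pinf]]%classic); first by move=> P /supp.
  exact: finite_seq.
rewrite (divisor_degreeE _ supp) // big_seq1 pole_divisor_infinite //.
rewrite (infinite_degree C) // mulr1.
rewrite (_ : riemann_roch_dim _ = n); last first.
  by apply: qdimE => //; apply: subspace_riemann_roch.
by move: nE; clear; lia.
Qed.

Lemma curve_genus : has_genus iota g.
Proof. by split; [exact: genus_upper_bound | exact: genus_attained]. Qed.

End Genus.

(** * Zeros of quadratic forms over a finite field *)

Section Diagonalization.
Variable k : fieldType.
Hypothesis two_neq0 : 2%:R != 0 :> k.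

(** Polarization: were the quadratic form zero, every [2 * H i j] would vanish. *)
Lemma symmetric_anisotropic_vector n (H : 'M[k]_n) : H^T = H -> H != 0 ->
  exists v : 'rV_n, (v *m H *m v^T) 0 0 != 0.
Proof.
move=> sH H0; apply: contrapT => no.
have Q0 (v : 'rV_n) : (v *m H *m v^T) 0 0 = 0.
  by apply/eqP/negP => /negP h; apply: no; exists v.
case/eqP: H0; apply/matrixP => i j; rewrite [RHS]mxE.
have E (a b : 'I_n) : ((delta_mx 0 a : 'rV_n) *m H *m (delta_mx 0 b : 'rV_n)^T) 0 0 = H a b.
  by rewrite -rowE trmx_delta -colE !mxE.
have Q2 (u v : 'rV_n) : ((u + v) *m H *m (u + v)^T) 0 0 =
    (u *m H *m u^T) 0 0 + (u *m H *m v^T) 0 0 + ((v *m H *m u^T) 0 0 + (v *m H *m v^T) 0 0).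
  by rewrite linearD /= mulmxDl mulmxDl !mulmxDr [LHS]mxE [X in X + _ = _]mxE [X in _ + X = _]mxE.
have := Q2 (delta_mx 0 i) (delta_mx 0 j); rewrite !Q0 !E add0r addr0.
have -> : H j i = H i j by rewrite -[in LHS]sH mxE.
rewrite -mulr2n -mulr_natr => /esym/eqP.
by rewrite mulf_eq0 (negbTE two_neq0) orbF => /eqP.
Qed.

Lemma symmetric_diagonalization n (H : 'M[k]_n) : H^T = H ->
  exists2 P : 'M[k]_n, P \in unitmx & is_diag_mx (P *m H *m P^T).
Proof.
elim: n H => [|n IH] H sH.
  by exists 1%:M; [apply: unitmx1 | apply/is_diag_mxP => -[]].
have [->|H0] := eqVneq H 0.
  exists 1%:M; first exact: unitmx1.
  by rewrite mulmx0 mul0mx; apply/is_diag_mxP => i j _; rewrite mxE.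
have [v vH] := symmetric_anisotropic_vector sH H0.
have v0 : v != 0 by apply: contraNneq vH => ->; rewrite !mul0mx mxE.
pose P0 := row_ebase v.
have vE : v = col_ebase v 0 0 *: row 0 P0.
  rewrite -{1}(mulmx_ebase v) rank_rV v0 [X in X *m _ *m _]mx11_scalar mul_scalar_mx -scalemxAl rowE.
  congr (_ *: (_ *m _)); apply/matrixP => i j; rewrite !mxE !ord1 /=.
  by rewrite andbC; case: j => -[].
pose H1 : 'M[k]_(1 + n) := P0 *m H *m P0^T.
have sH1 : H1^T = H1 by rewrite /H1 !trmx_mul trmxK sH mulmxA.
pose a := H1 0 0.
have a0 : a != 0.
  apply: contraNneq vH => a0; rewrite vE linearZ /= -scalemxAr -!scalemxAl.
  rewrite tr_row colE -row_mul mulmxA -colE -row_mul.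
  have : (col 0 (row 0 H1) : 'M_1) 0 0 = 0 by rewrite [LHS]mxE [LHS]mxE.
  by move: (col 0 _) => X X0; apply/eqP; rewrite [LHS]mxE [X in _ * X]mxE X0 !mulr0.
pose b := ursubmx H1; pose D := drsubmx H1.
have H1E : H1 = block_mx a%:M b b^T D.
  rewrite -[LHS]submxK; congr block_mx.
    by rewrite [LHS]mx11_scalar; congr _%:M; rewrite [LHS]mxE [LHS]mxE /a; congr (H1 _ _); apply: val_inj.
  by rewrite /b trmx_ursub sH1.
have sD : D^T = D by rewrite /D trmx_drsub sH1.
(* The Schur complement of the entry [a]; [P1] clears the rest of the first row and column. *)
pose D' := D - a^-1 *: (b^T *m b).
have [|P' uP' dP'] := IH D'.
  by rewrite /D' linearB linearZ /= trmx_mul trmxK sD.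
pose P1 : 'M[k]_(1 + n) := block_mx 1%:M 0 (- a^-1 *: b^T) 1%:M.
pose P2 : 'M[k]_(1 + n) := block_mx 1%:M 0 0 P'.
exists (P2 *m P1 *m P0).
  rewrite !unitmx_mul row_ebase_unit andbT; apply/andP; split.
    by rewrite unitmxE /P2 (@det_ublock _ 1 n) det1 mul1r -unitmxE.
  by rewrite unitmxE /P1 (@det_lblock _ 1 n) !det1 mulr1 unitr1.
have -> : P2 *m P1 *m P0 *m H *m (P2 *m P1 *m P0)^T = P2 *m (P1 *m H1 *m P1^T) *m P2^T.
  by rewrite !trmx_mul /H1 !mulmxA.
have -> : P1 *m H1 *m P1^T = block_mx a%:M 0 0 D'.
  have dl0 : (- a^-1 *: b^T) *m a%:M + b^T = 0.
    by rewrite mul_mx_scalar scalerA mulrN mulfV // scaleN1r addNr.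
  have ur0 : a%:M *m (- a^-1 *: b) + b = 0.
    by rewrite mul_scalar_mx scalerA mulrN mulfV // scaleN1r addNr.
  rewrite H1E /P1 (@mulmx_block _ 1 n 1 n 1 n) !mul1mx !mul0mx !addr0 dl0.
  rewrite tr_block_mx !trmx1 trmx0 [(_ *: b^T)^T]linearZ /= trmxK.
  rewrite (@mulmx_block _ 1 n 1 n 1 n) !mulmx1 !mulmx0 !addr0 !mul0mx !add0r ur0.
  by rewrite -scalemxAl scaleNr [- _ + D]addrC.
rewrite /P2 tr_block_mx !trmx0 trmx1 !mulmx_block !mul1mx !mul0mx !mulmx0 !mulmx1 !addr0 !add0r ?mul0mx ?mulmx0.
apply/is_diag_mxP => i j; rewrite -[i](@splitK 1 n) -[j](@splitK 1 n).
case: (@fintype.split 1 n i) => i'; case: (@fintype.split 1 n j) => j' /= ne.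
- by move: ne; rewrite !ord1.
- by rewrite (@block_mxEur _ 1 n 1 n) mxE.
- by rewrite (@block_mxEdl _ 1 n 1 n) mxE.
- by rewrite (@block_mxEdr _ 1 n 1 n); move/is_diag_mxP: dP'; apply.
Qed.

End Diagonalization.

(** * Zeros of diagonal forms *)

Section DiagonalForms.
Variable k : finFieldType.
Hypothesis two_neq0 : 2%:R != 0 :> k.
Local Notation q := #|k|.

(** The number of vectors on which the diagonal form with entries [d] takes the value [c], computed
    by peeling off one variable at a time. *)
Fixpoint diag_count (d : seq k) (c : k) : nat :=
  if d is a :: d' then (\sum_(x : k) diag_count d' (c - a * x ^+ 2)%R)%N else (c == 0).

Lemma diag_count_total d : (\sum_c diag_count d c = q ^ size d)%N.
Proof.
elim: d => [|a d IH] /=.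
  by rewrite (bigD1 0) //= eqxx big1 // => i /negbTE->.
rewrite exchange_big /= (eq_bigr (fun=> (q ^ size d)%N)) ?sum_nat_const ?expnS //.
move=> x _; rewrite -IH [RHS](reindex (fun c => c - a * x ^+ 2)) //=.
by exists (fun c => c + a * x ^+ 2) => c _; rewrite ?subrK ?addrK.
Qed.

Definition nonsquare (z : k) := forall b, z != b ^+ 2.

Lemma nonsquare_mul_square z b : b != 0 -> nonsquare (z * b ^+ 2) <-> nonsquare z.
Proof.
move=> b0; split=> h e.
  by apply: contra (h (e * b)) => /eqP->; rewrite exprMn.
apply: contra (h (e / b)) => /eqP E.
by rewrite expr_div_n -E mulfK ?expf_neq0.
Qed.

(** In the coordinates [u = y - x] and [w = y + x] the plane is [a u w]. For [u = 0] the variable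
    [w] is free; for [u != 0] the product runs through [k] once. *)
Lemma diag_count_hyperbolic a d : a != 0 ->
  diag_count (- a :: a :: d) 0 = (q * diag_count d 0%R + q.-1 * q ^ size d)%N.
Proof.
move=> a0 /=.
rewrite pair_bigA /= (reindex (fun uw : k * k => ((uw.2 - uw.1) / 2%:R, (uw.2 + uw.1) / 2%:R))) /=; last first.
  exists (fun xy : k * k => (xy.2 - xy.1, xy.2 + xy.1)) => -[u w] _ /=;
    by congr (_, _); field.
rewrite (eq_bigr (fun uw : k * k => diag_count d (- a * uw.1 * uw.2))); last first.
  by move=> [u w] _ /=; congr (diag_count _ _); field.
rewrite -(pair_bigA _ (fun u w => diag_count d (- a * u * w))) /= (bigD1 0) //=.
congr (_ + _)%N.
  rewrite (eq_bigr (fun=> diag_count d 0)) ?sum_nat_const // => w _.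
  by rewrite mulr0 mul0r.
rewrite (eq_bigr (fun=> (q ^ size d)%N)).
  by rewrite sum_nat_const; congr (_ * _)%N; rewrite -(cardC1 0); apply: eq_card.
move=> u u0; rewrite -diag_count_total [RHS](reindex (fun w => - a * u * w)) //=.
exists (fun w => (- a * u)^-1 * w) => w _; rewrite ?mulKf ?mulVKf ?mulf_neq0 ?oppr_eq0 //.
Qed.

(** Pigeonhole: the values [a x^2] and the values [c - b y^2] each fill more than half of [k]. *)
Lemma represents_all a b c : a != 0 -> b != 0 -> exists x y : k, a * x ^+ 2 + b * y ^+ 2 = c.
Proof.
move=> a0 b0; apply: contrapT => no.
pose S := [set a * x ^+ 2 | x in [set: k]].
pose T := [set c - b * y ^+ 2 | y in [set: k]].
have ST0 : [disjoint S & T].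
  rewrite -finset.setI_eq0; apply/eqP/finset.setP => z; rewrite !inE; apply/negP => /andP[].
  case/imsetP => x _ -> /imsetP[y _ e]; apply: no; exists x, y.
  by rewrite e subrK.
have sq_card (f : k -> k) : (forall x y, f x = f y -> x ^+ 2 = y ^+ 2) ->
    (q < 2 * #|[set f x | x in [set: k]]|)%N.
  move=> finj; set I := [set f x | x in _].
  have If x : f x \in I by apply: imset_f; rewrite inE.
  have -> : q = (\sum_(z in I) \sum_(x | f x == z) 1)%N.
    by rewrite -sum1_card (partition_big f (fun z => z \in I)).
  rewrite (bigD1 (f 0)) //= (cardD1 (f 0)) If /= mulnDr muln1 add2n ltnS -[X in (_ <= X)%N]add1n.
  apply: leq_add.
    rewrite sum1_card; apply: (@leq_trans #|[set (0 : k)]|); last by rewrite cards1.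
    apply/subset_leq_card/fintype.subsetP => x; by rewrite !inE => /eqP/finj/eqP; rewrite expr0n sqrf_eq0.
  rewrite mulnC -sum_nat_const; rewrite (eq_bigl (mem [predD1 I & f 0])) => [|z]; last first.
    by rewrite !inE andbC.
  apply: leq_sum => z; rewrite !inE => /andP[_ /imsetP[x0 _ ->]].
  rewrite sum1_card (leq_trans _ (_ : #|[set x0; - x0]| <= 2)%N) //; last first.
    by rewrite cards2; case: eqP.
  apply/subset_leq_card/fintype.subsetP => x; rewrite !inE => /eqP/finj/eqP.
  by rewrite eqf_sqr.
have hS : (q < 2 * #|S|)%N.
  by apply: sq_card => x y /(mulfI a0).
have hT : (q < 2 * #|T|)%N.
  by apply: sq_card => x y /addrI/oppr_inj/(mulfI b0).
have : (#|S| + #|T| <= q)%N.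
  rewrite -cardsUI (_ : S :&: T = finset.set0) ?cards0 ?addn0 ?max_card //.
  by apply/eqP; rewrite finset.setI_eq0.
by move: hS hT; lia.
Qed.

(** The form with entries [a, b] takes the value [- c] at some [(x0, y0)], and the orthogonal vector
    [(- b y0, a x0)] has value [- a b c]. *)
Lemma diag_count_rotate a b c d : a != 0 -> b != 0 -> c != 0 ->
  diag_count [:: a, b, c & d] 0 = diag_count [:: - c, c, - (a * b * c) & d] 0.
Proof.
move=> a0 b0 c0; have [x0 [y0 e]] := represents_all (- c) a0 b0.
rewrite /= pair_bigA /=.
pose h (st : k * k) := (x0 * st.1 - b * y0 * st.2, y0 * st.1 + a * x0 * st.2).
have h_inj : injective h.
  apply: (can_inj (g := fun xy : k * k =>
    ((a * x0 * xy.1 + b * y0 * xy.2) / - c, (x0 * xy.2 - y0 * xy.1) / - c))).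
  by move=> [s t] /=; congr (_, _); rewrite -e; field; rewrite e oppr_eq0.
rewrite (reindex_inj h_inj) /= -(pair_bigA _ (fun s t => (\sum_z diag_count d
  (0 - a * (x0 * s - b * y0 * t) ^+ 2 - b * (y0 * s + a * x0 * t) ^+ 2 - c * z ^+ 2)%R)%N)) /=.
apply: eq_bigr => s _; rewrite exchange_big /=; apply: eq_bigr => t _; apply: eq_bigr => z _.
congr (diag_count d _).
have cE : c = - (a * x0 ^+ 2 + b * y0 ^+ 2) by rewrite e opprK.
by rewrite cE; ring.
Qed.

Lemma nonsquare_neq0 z : nonsquare z -> z != 0.
Proof. by move=> /(_ 0); rewrite expr0n. Qed.

(* Rotating three entries produces a hyperbolic plane and preserves the class of the
   signed determinant modulo squares; what remains after [e] steps is anisotropic. *)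
Lemma diag_count_elliptic e (d : seq k) : size d = (2 * e.+1)%N ->
  nonsquare ((-1) ^+ e.+1 * \prod_(a <- d) a) ->
  (diag_count d 0%R + q.-1 * q ^ e = q ^ (2 * e).+1)%N.
Proof.
have q0 : (0 < q)%N by apply/card_gt0P; exists 0.
elim: e d => [|e IH] d sd nsq.
  case: d sd nsq => [|a [|b []]] // _; rewrite !big_cons big_nil mulr1 expr1 => nsq.
  have := nonsquare_neq0 nsq; rewrite mulf_eq0 mulf_eq0 !negb_or => /and3P[_ a0 b0].
  rewrite /= (bigD1 0) //= (bigD1 0) //= expr0n !mulr0 !subr0 eqxx /=.
  rewrite big1 ?big1 ?addn0 ?muln1 ?expn1 ?add1n ?prednK // => [x x0|y y0]; last first.
    by rewrite sub0r oppr_eq0 mulf_eq0 (negbTE b0) sqrf_eq0 (negbTE y0).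
  apply: big1 => y _; apply/eqP; rewrite eqb0 sub0r -opprD oppr_eq0; apply/eqP => E.
  have y0 : y != 0.
    apply: contraNneq x0 => y0; move/eqP: E; rewrite y0 expr0n mulr0 addr0.
    by rewrite mulf_eq0 (negbTE a0) sqrf_eq0.
  (* A nontrivial zero of the binary form would make [- a b] the square of [a x / y]. *)
  have /eqP[] := nsq (a * x / y).
  have -> : b = - (a * x ^+ 2) / y ^+ 2.
    by apply/eqP; rewrite -(mulr1 b) -(divff (expf_neq0 2 y0)) mulrA; apply/eqP; congr (_ / _);
      apply/eqP; rewrite -addr_eq0 addrC E.
  by field.
case: d sd nsq => [|a [|b [|c d]]] sd nsq; try by move: sd => /=; clear; lia.
have N0 := nonsquare_neq0 nsq; rewrite !big_cons in N0.
have a0 : a != 0 by apply: contraNneq N0 => ->; rewrite mul0r mulr0.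
have b0 : b != 0 by apply: contraNneq N0 => ->; rewrite mul0r !mulr0.
have c0 : c != 0 by apply: contraNneq N0 => ->; rewrite mul0r !mulr0.
rewrite diag_count_rotate // diag_count_hyperbolic //.
have sd' : size (- (a * b * c) :: d) = (2 * e.+1)%N by move: sd => /=; clear; lia.
have /(IH _ sd') : nonsquare ((-1) ^+ e.+1 * \prod_(x <- - (a * b * c) :: d) x).
  by move: nsq; rewrite !big_cons; congr nonsquare; rewrite exprS; ring.
rewrite sd'; move: (diag_count _ 0) => N E.
have {E} := congr1 (muln q) E.
have -> : (2 * e.+1 = (2 * e).+2)%N by lia.
rewrite !expnS; move: (q ^ (2 * e))%N (q ^ e)%N q0 => X Y.
by case: q => // l _ /=; clear; nia.
Qed.

Lemma diag_count_card n (f : 'I_n -> k) c :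
  #|[pred v : 'rV[k]_n | \sum_i f i * v 0 i ^+ 2 == c]| = diag_count (codom f) c.
Proof.
elim: n f c => [|n IH] f c.
  rewrite [codom f]size0nil ?size_codom ?card_ord //=.
  rewrite (eq_card (B := [pred v : 'rV_0 | c == 0])) => [|v]; last first.
    by rewrite !inE big_ord0 eq_sym.
  have [_|_] := eqVneq c 0; last by rewrite eq_card0.
  by rewrite (eq_card (B := predT)) // card_mx.
rewrite codomE enum_ordSl /= -map_comp -codomE.
pose Q (x : k) (v : 'rV_n) := \sum_i f (lift ord0 i) * v 0 i ^+ 2 == c - f ord0 * x ^+ 2.
rewrite (eq_bigr (fun x => \sum_(v | Q x v) 1)%N); last first.
  by move=> x _; rewrite -IH -sum1_card.
rewrite -sum1_card (pair_big_dep xpredT Q (fun _ _ => 1%N)) /=.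
have r0 (x : k) (v : 'rV_n) : (row_mx (x%:M : 'M_1) v : 'rV_(1 + n)) 0 0 = x.
  by rewrite mxE; case: splitP => // j _; rewrite ord1 mxE eqxx.
have r1 (x : k) (v : 'rV_n) i : (row_mx (x%:M : 'M_1) v : 'rV_(1 + n)) 0 (lift ord0 i) = v 0 i.
  rewrite mxE; case: splitP => [j|j [e]]; first by rewrite ord1.
  by congr (v _ _); apply: val_inj.
rewrite (reindex (fun xv : k * 'rV_n => row_mx (xv.1%:M : 'M_1) xv.2 : 'rV_(1 + n))) /=; last first.
  exists (fun v : 'rV_(1 + n) => (v 0 0, rsubmx v)) => [[x v] _|v _] /=.
    by rewrite row_mxKr r0.
  rewrite -[RHS]hsubmxK; congr row_mx; rewrite [RHS]mx11_scalar mxE.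
  by congr (v _ _)%:M; apply: val_inj.
apply: eq_bigl => -[x v]; rewrite inE /= big_ord_recl r0 /Q.
rewrite addrC eq_sym -subr_eq eq_sym; congr (_ == _).
by apply: eq_bigr => i _; rewrite r1.
Qed.

(** Diagonalization by congruence multiplies the determinant by a nonzero square, which keeps the
    discriminant a nonsquare. *)
Theorem elliptic_zeros e n (H : 'M[k]_n) : n = (2 * e.+1)%N -> H^T = H ->
  nonsquare ((-1) ^+ e.+1 * \det H) ->
  (#|[pred v : 'rV_n | ((v *m H *m v^T) 0 0 == 0)%R]| + q.-1 * q ^ e = q ^ (2 * e).+1)%N.
Proof.
move=> nE sH nsq; have [P uP dP] := symmetric_diagonalization two_neq0 sH.
pose H' := P *m H *m P^T; pose f i := H' i i.
have -> : #|[pred v : 'rV_n | ((v *m H *m v^T) 0 0 == 0)%R]| = diag_count (codom f) 0%R.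
  rewrite -diag_count_card -!sum1_card (reindex (fun v => v *m P)) /=; last first.
    by exists (mulmxr (invmx P)) => v _; rewrite /= ?mulmxK ?mulmxKV.
  apply: eq_bigl => v; rewrite !inE trmx_mul.
  have -> : v *m P *m H *m (P^T *m v^T) = v *m H' *m v^T by rewrite !mulmxA.
  congr (_ == 0); rewrite mxE; apply: eq_bigr => i _.
  rewrite mxE (bigD1 i) //= big1 ?addr0 => [|j ji]; last first.
    by rewrite (is_diag_mxP dP _ _ ji) mulr0.
  by rewrite [v^T _ _]mxE /f; ring.
apply: diag_count_elliptic; first by rewrite size_codom card_ord.
have -> : \prod_(a <- codom f) a = \det H'.
  by rewrite big_image /= (det_trig (is_diag_mx_is_trig dP)).
rewrite /H' !det_mulmx det_tr.
have -> : (-1) ^+ e.+1 * (\det P * \det H * \det P) = (-1) ^+ e.+1 * \det H * \det P ^+ 2.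
  by rewrite expr2; ring.
by apply/nonsquare_mul_square => //; rewrite -unitfE -unitmxE.
Qed.

End DiagonalForms.

(** * Hankel determinants *)

Section Hankel.
Variables (k : fieldType) (L : {poly k} -> k) (D : nat) (g : {poly k}).
Hypothesis Llin : forall a u v, L (a *: u + v) = a * L u + L v.
Hypothesis size_g : size g = D.+1.
Hypothesis Lg0 : forall u, L (('X^2 - 4%:P) * g * u) = 0.

Let L0 : L 0 = 0.
Proof. by have := Llin (-1) 0 0; rewrite scaler0 addr0 mulN1r addNr. Qed.

Let LD u v : L (u + v) = L u + L v.
Proof. by rewrite -{1}(scale1r u) Llin mul1r. Qed.

Let LZ a u : L (a *: u) = a * L u.
Proof. by rewrite -{1}(addr0 (a *: u)) Llin L0 addr0. Qed.

Let Lsum n (f : 'I_n -> {poly k}) : L (\sum_i f i) = \sum_i L (f i).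
Proof. exact: (big_morph L LD L0). Qed.

Definition hankel_plus : 'M[k]_(D + 2) := \matrix_(i, j) L 'X^(i + j).
(** With [Y = X + 1/X] and [Z = X - 1/X] one has [Z^2 = Y^2 - 4], and [Z] will be skew-adjoint;
    hence the weight [- ('X^2 - 4%:P)] for products of two multiples of [Z]. *)
Definition hankel_minus : 'M[k]_D := \matrix_(i, j) L (- ('X^2 - 4%:P) * 'X^(i + j)).

Let coef_mx n (f : 'I_n -> {poly k}) : 'M[k]_n := \matrix_(i, j) (f i)`_j.

Let gram (f f' : 'I_(D + 2) -> {poly k}) : 'M[k]_(D + 2) := \matrix_(i, j) L (f i * f' j).

Let gramE (f f' : 'I_(D + 2) -> {poly k}) : (forall i, (size (f i) <= D + 2)%N) -> (forall i, (size (f' i) <= D + 2)%N) ->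
  gram f f' = coef_mx f *m hankel_plus *m (coef_mx f')^T.
Proof.
move=> sf sf'; apply/matrixP => i j; rewrite !mxE.
have polE (u : {poly k}) : (size u <= D + 2)%N -> u = \sum_(l < D + 2) u`_l *: 'X^l.
  by move=> su; rewrite -poly_def; apply/polyP => l; rewrite coef_poly; case: ltnP => // le;
     rewrite nth_default // (leq_trans su).
rewrite {1}(polE _ (sf i)) {1}(polE _ (sf' j)) big_distrr Lsum; apply: eq_bigr => l' _.
rewrite !mxE big_distrl Lsum mulr_suml; apply: eq_bigr => l _ /=.
by rewrite -scalerAl -scalerAr scalerA LZ -exprD !mxE mulrAC.
Qed.

Let alpha (i : 'I_(D + 2)) : {poly k} := if (i < D)%N then 'X^i else g * 'X^(i - D).

Let beta (i : 'I_(D + 2)) : {poly k} :=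
  if (i < 2)%N then 'X^i else ('X^2 - 4%:P) * 'X^(i - 2).

Let beta' (i : 'I_(D + 2)) : {poly k} :=
  if (i < D)%N then ('X^2 - 4%:P) * 'X^i else 'X^(i - D).

Let size_X24 : size ('X^2 - 4%:P : {poly k}) = 3%N.
Proof. by rewrite size_XnsubC. Qed.

Let size_alpha i : size (alpha i) = i.+1.
Proof.
rewrite /alpha; case: ltnP => [lt|ge]; first by rewrite size_polyXn.
rewrite size_mulXn ?size_g; last by rewrite -size_poly_gt0 size_g.
by rewrite addnS subnK.
Qed.

Let size_beta i : size (beta i) = i.+1.
Proof.
rewrite /beta; case: ltnP => [lt|ge]; first by rewrite size_polyXn.
rewrite size_mulXn ?size_X24; last by rewrite -size_poly_gt0 size_X24.
by rewrite addnC; lia.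
Qed.

Let det_triangular (f : 'I_(D + 2) -> {poly k}) : (forall i, size (f i) = i.+1) ->
  \det (coef_mx f) = \prod_i lead_coef (f i).
Proof.
move=> sf; rewrite det_trig; last first.
  by apply/is_trig_mxP => i j lt; rewrite mxE nth_default ?sf.
by apply: eq_bigr => i _; rewrite mxE lead_coefE sf.
Qed.

Let det_alpha : \det (coef_mx alpha) = lead_coef g ^+ 2.
Proof.
rewrite det_triangular ?size_alpha // big_split_ord /= big1 ?mul1r => [|i _]; last first.
  by rewrite /alpha /= ltn_ord lead_coefXn.
rewrite (eq_bigr (fun=> lead_coef g)); first by rewrite prodr_const card_ord.
by move=> i _; rewrite /alpha /= ltnNge leq_addr /= lead_coefM lead_coefXn mulr1.
Qed.

Let lead_X24 : lead_coef ('X^2 - 4%:P : {poly k}) = 1.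
Proof. by apply/eqP; rewrite -monicE monicXnsubC. Qed.

(* Rotating the family by two steps is an even permutation. *)
Let det_beta : \det (coef_mx beta') = 1.
Proof.
pose rho := perm (@ordS_inj (D + 2)).
have -> : coef_mx beta' = row_perm (rho * rho)%g (coef_mx beta).
  apply/matrixP => i j; rewrite !mxE permM !permE; congr (_`__).
  rewrite /beta /beta' /=; have lt_i := ltn_ord i.
  case: ltnP => [lt|ge].
    rewrite (@modn_small i.+1); last by move: lt; clear; lia.
    rewrite modn_small; last by move: lt; clear; lia.
    by rewrite ltnS ltnS ltn0 subSS subSS subn0.
  have [e|e] : (i = D :> nat \/ i = D.+1 :> nat)%N by move: ge lt_i; clear; lia.
    rewrite e subnn (@modn_small D.+1); last by clear; lia.
    by rewrite -addn2 modnn.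
  by rewrite e -[D.+2]addn2 modnn modn_small ?subSnn //; clear; lia.
rewrite row_permE det_mulmx det_perm odd_permM addbb expr0 mul1r.
rewrite det_triangular ?size_beta // big1 // => i _; rewrite /beta.
by case: ifP => _; rewrite ?lead_coefM ?lead_coefXn ?mulr1.
Qed.

(* In the bases [1, X, .., X^(D-1), g, g X] and [1, X, X^2 - 4, .., (X^2 - 4) X^(D-1)] the
   form [u, v |-> L (u v)] has a triangular block structure, because [(X^2 - 4) g] is in
   its radical. *)
Lemma hankel_det : lead_coef g ^+ 2 * \det hankel_plus =
  - ((-1) ^+ D * \det hankel_minus * (L (g * ('X - 2%:P)) * L (g * ('X + 2%:P)))).
Proof.
have sa i : (size (alpha i) <= D + 2)%N by rewrite size_alpha.
have sb i : (size (beta' i) <= D + 2)%N.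
  rewrite /beta'; case: ltnP => [lt|ge].
    rewrite size_mulXn ?size_X24; last by rewrite -size_poly_gt0 size_X24.
    by rewrite addnC; lia.
  by rewrite size_polyXn; have := ltn_ord i; lia.
have := congr1 determinant (gramE sa sb).
rewrite !det_mulmx det_tr det_alpha det_beta mulr1 => <-.
pose E : 'M[k]_2 := \matrix_(i, j) L (g * 'X^(i + j)).
pose U : 'M[k]_(D, 2) := \matrix_(i, j) L 'X^(i + j).
have -> : gram alpha beta' = block_mx (- 1 *: hankel_minus) U 0 E.
  apply/matrixP => i j; rewrite -[i]splitK -[j]splitK mxE.
  case: (fintype.split i) => i'; case: (fintype.split j) => j' /=;
    rewrite ?(block_mxEul, block_mxEur, block_mxEdl, block_mxEdr) !mxE /alpha /beta' /=.
  - by rewrite !ltn_ord -LZ scaleN1r mulNr opprK exprD; congr L; ring.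
  - by rewrite ltn_ord ltnNge leq_addr /= addKn exprD.
  - rewrite ltn_ord ltnNge leq_addr /= addKn.
    have -> : g * 'X^i' * (('X^2 - 4%:P) * 'X^j') = ('X^2 - 4%:P) * g * ('X^i' * 'X^j') by ring.
    exact: Lg0.
  - by rewrite !ltnNge !leq_addr /= !addKn exprD; congr L; ring.
rewrite det_ublock detZ -mulrN; congr (_ * _).
rewrite (expand_det_row _ ord0) !big_ord_recl big_ord0 /cofactor !det_mx11 !mxE /=.
(* The radical relation reduces the 2 by 2 block to [4 L(g)^2 - L(g X)^2], a difference of
   squares. *)
have e4 : L (g * 'X^2) = 4%:R * L g.
  rewrite -LZ -mul_polyC -[LHS]addr0 -[in LHS](Lg0 (-1)) -LD; congr L.
  ring.
have eX (c : k) : L (g * ('X + c%:P)) = L (g * 'X^1) + c * L (g * 'X^0).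
  by rewrite -LZ -LD -mul_polyC; congr L; ring.
have g1 : L g = L (g * 'X^0) by rewrite expr0 mulr1.
rewrite -polyCN !eX /bump !leq0n -[(true + 0)%N]/1%N -[(0 + 0)%N]/0%N -[(0 + 1)%N]/1%N.
rewrite -[(1 + 1)%N]/2%N ?addn0 ?e4 ?g1 expr0 expr1.
ring.
Qed.

End Hankel.

(** * The Frobenius module and the trace *)

Section FrobeniusModule.
Variables (k K : finFieldType) (sigma : {rmorphism k -> K}) (n : nat).
Local Notation q := #|k|.
Hypothesis card_K : #|K| = (q ^ n)%N.
Hypothesis n_gt0 : (0 < n)%N.
Hypothesis q_pchar : [pchar K].-nat q.

Let q_gt1 : (1 < q)%N. Proof. exact: finNzRing_gt1. Qed.
Let q_gt0 : (0 < q)%N. Proof. exact: ltnW. Qed.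

Let frobD i (z w : K) : (z + w) ^+ (q ^ i) = z ^+ (q ^ i) + w ^+ (q ^ i).
Proof. by rewrite exprDn_pchar // pnatX q_pchar. Qed.

Let frob_sigma i (a : k) : sigma a ^+ (q ^ i) = sigma a.
Proof. by elim: i => [|i IH]; rewrite ?expr1 // expnSr exprM IH -rmorphXn expf_card. Qed.

(* The action of [k[X]] on [K] in which [X] acts as the [q]-Frobenius. *)
Definition act (c : {poly k}) (z : K) : K := \sum_(i < size c) sigma c`_i * z ^+ (q ^ i).

Lemma act_wide m (c : {poly k}) z : (size c <= m)%N -> act c z = \sum_(i < m) sigma c`_i * z ^+ (q ^ i).
Proof.
move=> le; rewrite /act (big_ord_widen m (fun i => sigma c`_i * z ^+ (q ^ i))) //.
rewrite big_mkcond; apply: eq_bigr => i _; case: ltnP => // le'.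
by rewrite nth_default // rmorph0 mul0r.
Qed.

Lemma actD a b z : act (a + b) z = act a z + act b z.
Proof.
pose m := maxn (size a) (size b).
rewrite (@act_wide m a) ?leq_maxl // (@act_wide m b) ?leq_maxr //.
rewrite (@act_wide m) ?size_polyD // -big_split; apply: eq_bigr => i _ /=.
by rewrite coefD rmorphD mulrDl.
Qed.

Lemma act0 z : act 0 z = 0.
Proof. by rewrite /act size_poly0 big_ord0. Qed.

Lemma actC c z : act c%:P z = sigma c * z.
Proof.
by rewrite (@act_wide 1) ?size_polyC_leq1 // big_ord1 coefC expn0 expr1.
Qed.

Lemma actZ s c z : act (s *: c) z = sigma s * act c z.
Proof.
rewrite (@act_wide (size c)) ?size_scale_leq // mulr_sumr; apply: eq_bigr => i _.
by rewrite coefZ rmorphM mulrA.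
Qed.

Lemma actN c z : act (- c) z = - act c z.
Proof. by apply/eqP; rewrite -addr_eq0 -actD addNr act0. Qed.

Lemma act_zD c z w : act c (z + w) = act c z + act c w.
Proof. by rewrite -big_split; apply: eq_bigr => i _ /=; rewrite frobD mulrDr. Qed.

Lemma act_z0 c : act c 0 = 0.
Proof. by have /eqP := act_zD c 0 0; rewrite addr0 -subr_eq0 opprD addNKr oppr_eq0 => /eqP. Qed.

Lemma act_zZ c s z : act c (sigma s * z) = sigma s * act c z.
Proof.
rewrite mulr_sumr; apply: eq_bigr => i _.
by rewrite exprMn frob_sigma mulrCA.
Qed.

Lemma act_zN c z : act c (- z) = - act c z.
Proof. by apply/eqP; rewrite -addr_eq0 -act_zD addNr act_z0. Qed.

Lemma act_MX c z : act (c * 'X) z = act c z ^+ q.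
Proof.
have [->|c0] := eqVneq c 0; first by rewrite mul0r act0 expr0n gtn_eqF.
rewrite /act size_mulX // big_ord_recl coefMX eqxx rmorph0 mul0r add0r.
have q1 : q = (q ^ 1)%N by rewrite expn1.
rewrite q1 (big_morph (fun z : K => z ^+ (q ^ 1)) (frobD 1) (id1 := 0)); last first.
  by rewrite expn1 expr0n gtn_eqF.
apply: eq_bigr => i _; rewrite coefMX /= exprMn frob_sigma -exprM.
by rewrite expn1 -expnSr.
Qed.

Lemma actM a b z : act (a * b) z = act a (act b z).
Proof.
elim/poly_ind: a => [|a c IH]; first by rewrite mul0r !act0.
rewrite mulrDl actD mul_polyC actZ mulrAC act_MX IH.
by rewrite actD actC act_MX.
Qed.

Lemma act1 z : act 1 z = z.
Proof. by rewrite -[1]/(1%:P) actC rmorph1 mul1r. Qed.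

Lemma actX z : act 'X z = z ^+ q.
Proof. by rewrite -[act 'X z]/(act 'X z) -['X]mul1r act_MX act1. Qed.

Lemma actXn i z : act 'X^i z = z ^+ (q ^ i).
Proof.
elim: i => [|i IH]; first by rewrite act1 expn0 expr1.
by rewrite exprSr act_MX IH -exprM -expnSr.
Qed.

Lemma act_cycle z : act ('X^n - 1) z = 0.
Proof. by rewrite actD actN act1 actXn -card_K expf_card subrr. Qed.

Lemma act_dvd d c z : d %| c -> act d z = 0 -> act c z = 0.
Proof. by move/dvdpP => [t ->] h; rewrite actM h act_z0. Qed.

Lemma fixedP z : z ^+ q = z -> exists a, z = sigma a.
Proof.
move=> zq; apply: contrapT => no.
have p0 : ('X^q - 'X : {poly K}) != 0.
  by rewrite -size_poly_eq0 size_polyDl ?size_polyXn // size_polyN size_polyX.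
have := max_poly_roots p0 (rs := z :: [seq sigma a | a <- enum k]).
rewrite /= size_map -cardE size_polyDl ?size_polyXn ?size_polyN ?size_polyX // ltnn => bad.
suff: false by []; apply: bad.
  rewrite /root !hornerE zq subrr eqxx /=; apply/allP => _ /mapP[a _ ->].
  by rewrite /root !hornerE -rmorphXn expf_card subrr.
rewrite map_inj_uniq ?enum_uniq ?andbT; last exact: fmorph_inj.
by apply/negP => /mapP[a _ e]; apply: no; exists a.
Qed.

Definition ker (c : {poly k}) : {set K} := [set z | act c z == 0].

(** The action of [c] is the evaluation of a linearized polynomial of degree [q ^ (size c).-1]. *)
Lemma card_ker_le c : c != 0 -> (#|ker c| <= q ^ (size c).-1)%N.
Proof.
move=> c0; pose P : {poly K} := \sum_(i < size c) sigma c`_i *: 'X^(q ^ i).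
have [m mE] : exists m, size c = m.+1.
  by move: c0; rewrite -size_poly_gt0; case: (size c) => // m _; exists m.
have lc : sigma c`_m != 0.
  by rewrite fmorph_eq0 -[m]/(m.+1.-1) -mE -lead_coefE lead_coef_eq0.
have sP : size P = (q ^ m).+1.
  rewrite /P mE big_ord_recr /= addrC size_polyDl size_scale // size_polyXn //.
  rewrite ltnS (leq_trans (size_sum _ _ _)) //; apply/bigmax_leqP => i _.
  by rewrite (leq_trans (size_scale_leq _ _)) // size_polyXn ltn_exp2l.
have P0 : P != 0 by rewrite -size_poly_eq0 sP.
have := max_poly_roots P0 (rs := enum (ker c)); rewrite sP mE -cardE ltnS; apply.
  apply/allP => z; rewrite mem_enum inE => /eqP h; rewrite /root horner_sum.
  by apply/eqP; rewrite -[RHS]h; apply: eq_bigr => i _; rewrite !hornerE.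
exact: enum_uniq.
Qed.

Lemma card_ker_im c : (#|K| <= #|[set act c z | z in K]| * #|ker c|)%N.
Proof.
rewrite -[#|K|]sum1_card (partition_big (act c) (fun w => w \in [set act c z | z in K])) /=; last first.
  by move=> z _; apply: imset_f.
rewrite -sum_nat_const; apply: leq_sum => w /imsetP[z0 _ ->].
rewrite sum1_card -(card_imset (ker c) (addIr z0)); apply/subset_leq_card/fintype.subsetP => z.
rewrite unfold_in /= => /eqP e; apply/imsetP; exists (z - z0); last by rewrite subrK.
by rewrite inE act_zD act_zN e subrr.
Qed.

Lemma size_cycle : size ('X^n - 1 : {poly k}) = n.+1.
Proof. exact: size_XnsubC. Qed.

Lemma cycle_neq0 : ('X^n - 1 : {poly k}) != 0.
Proof. by rewrite -size_poly_eq0 size_cycle. Qed.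

(** The image of [c] lies in the kernel of its cofactor; the two upper bounds for the kernels have
    product [#|K|], so both are attained. *)
Lemma card_ker c : c %| 'X^n - 1 -> #|ker c| = (q ^ (size c).-1)%N.
Proof.
move=> /dvdpP[e eE].
have ec0 : e * c != 0 by rewrite -eE cycle_neq0.
have [e0 c0] : e != 0 /\ c != 0 by move: ec0; rewrite mulf_eq0 negb_or => /andP[].
have szec : ((size e).-1 + (size c).-1 = n)%N.
  have := size_cycle; rewrite eE size_mul //; move: e0 c0; rewrite -!size_poly_gt0.
  by case: (size e) => // a _; case: (size c) => // b _ /=; lia.
apply/eqP; rewrite eqn_leq card_ker_le //=.
have im_sub : (#|[set act c z | z in K]| <= #|ker e|)%N.
  apply/subset_leq_card/fintype.subsetP => _ /imsetP[z _ ->].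
  by rewrite inE -actM -eE act_cycle.
have := card_ker_im c; rewrite card_K -szec expnD => h.
have qe : (0 < q ^ (size e).-1)%N by rewrite expn_gt0 q_gt0.
rewrite -(leq_pmul2l qe) (leq_trans h) // leq_mul2r; apply/orP; right.
exact: leq_trans im_sub (card_ker_le e0).
Qed.

Lemma multiplicity (pi c : {poly k}) : (1 < size pi)%N -> c != 0 ->
  exists m c', c = pi ^+ m * c' /\ ~~ (pi %| c').
Proof.
move=> pi1; have [N le] := ubnP (size c); elim: N => // N IH in c le *.
move=> c0; have [/dvdpP[t tE]|nd] := boolP (pi %| c); last first.
  by exists 0%N, c; rewrite expr0 mul1r.
have t0 : t != 0 by apply: contraNneq c0 => t0; rewrite tE t0 mul0r.
have pi0 : pi != 0 by rewrite -size_poly_gt0 ltnW.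
have arith A B l : (1 < B)%N -> ((A + B).-1 < l.+1)%N -> (A < l)%N by lia.
have [|m [c' [e nd]]] := IH t _ t0; last by exists m.+1, c'; rewrite exprS tE e; split=> //; ring.
by apply: arith pi1 _; move: le; rewrite tE size_mul.
Qed.

Lemma irreducible_factor (d : {poly k}) : (1 < size d)%N ->
  exists pi : {poly k}, [/\ (1 < size pi)%N, pi %| d & forall r : {poly k}, ~~ (pi %| r) -> coprimep pi r].
Proof.
move=> d1; pose Q N := `[< exists r : {poly k}, [/\ (1 < size r)%N, r %| d & size r = N] >].
have exQ : exists N, Q N by exists (size d); apply/asboolP; exists d.
case: (ex_minnP exQ) => N /asboolP[pi [pi1 pid <-]] pmin.
exists pi; split=> // r; apply: contraR => nco.
have pi0 : pi != 0 by rewrite -size_poly_gt0 ltnW.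
have g0 : gcdp pi r != 0 by rewrite gcdp_eq0 (negbTE pi0).
have g1 : (1 < size (gcdp pi r))%N.
  move: nco g0; rewrite /coprimep -size_poly_eq0.
  by case: (size (gcdp pi r)) => [|[|]].
have le : (size pi <= size (gcdp pi r))%N.
  apply: pmin; apply/asboolP; exists (gcdp pi r); split=> //.
  exact: dvdp_trans (dvdp_gcdl _ _) pid.
have := dvdp_size_eqp (dvdp_gcdl pi r).
rewrite eqn_leq le dvdp_leq ?dvdp_gcdl // => /esym/eqp_dvdl <-.
exact: dvdp_gcdr.
Qed.

(** Induction on [d], split as [pi ^+ m * d'] with [pi] irreducible and prime to [d']: an element
    with annihilator [pi ^+ m] is added to one with annihilator [d']. *)
Lemma annihilator_exists (d : {poly k}) : d %| 'X^n - 1 ->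
  exists2 z, act d z = 0 & forall c, act c z = 0 -> d %| c.
Proof.
have [N le] := ubnP (size d); elim: N => // N IH in d le *.
move=> dX; have d0 : d != 0 by apply: dvdpN0 dX cycle_neq0.
have [d1|d1] := leqP (size d) 1.
  exists 0; first exact: act_z0.
  move=> c _; rewrite (eqp_dvdl (d2 := 1)) ?dvd1p // -size_poly_eq1.
  by rewrite eqn_leq d1 size_poly_gt0.
have [pi [pi1 pid pico]] := irreducible_factor d1.
have [m [d' [dE nd']]] := multiplicity pi1 d0.
have pi0 : pi != 0 by rewrite -size_poly_gt0 ltnW.
have d'0 : d' != 0 by apply: contraNneq d0 => e; rewrite dE e mulr0.
have m0 : (0 < m)%N.
  by rewrite lt0n; apply: contraNneq nd' => m0; move: pid; rewrite dE m0 expr0 mul1r.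
have com : coprimep (pi ^+ m) d' by rewrite coprimep_expl // pico.
have d'X : d' %| 'X^n - 1 by apply: dvdp_trans dX; rewrite dE dvdp_mulIr.
have sz : (size d' < size d)%N.
  rewrite dE size_mul ?expf_neq0 //.
  have := size_exp pi m; move: pi1 m0 d'0; rewrite -size_poly_gt0.
  move: (size pi) (size d') (size (pi ^+ m)) => A B C; clear; nia.
have [|z' z'0 z'P] := IH d' _ d'X; first by move: sz le; clear; lia.
have pmX : pi ^+ m %| 'X^n - 1.
  by apply: dvdp_trans dX; rewrite dE dvdp_mulIl.
(* Otherwise two kernels of different cardinalities would be nested the wrong way. *)
have [z1 z1m z1n] : exists2 z, act (pi ^+ m) z = 0 & act (pi ^+ m.-1) z != 0.
  apply: contrapT => no.
  have : (#|ker (pi ^+ m)| <= #|ker (pi ^+ m.-1)|)%N.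
    apply/subset_leq_card/fintype.subsetP => z; rewrite !inE => /eqP h.
    by apply/negP => /negP h'; apply: no; exists z.
  have pm1X : pi ^+ m.-1 %| 'X^n - 1.
    by apply: dvdp_trans pmX; rewrite dvdp_exp2l // leq_pred.
  rewrite !card_ker // leq_exp2l // !size_exp.
  move: pi1 m0; move: (size pi) => A; case: m {dE com pmX pm1X no} => // l; clear; nia.
have ord1 c : act c z1 = 0 -> pi ^+ m %| c.
  move=> h; have [->|c0] := eqVneq c 0; first exact: dvdp0.
  have [j [c' [cE nc']]] := multiplicity pi1 c0.
  have [le_mj|lt] := leqP m j; first by rewrite cE dvdp_mulr // dvdp_exp2l.
  exfalso; move/eqP: z1n; apply.
  have co : coprimep c' (pi ^+ m) by rewrite coprimep_expr // coprimep_sym pico.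
  have [[u v] /= uv] := Bezout_eq1_coprimepP _ _ co.
  have -> : pi ^+ m.-1 = pi ^+ (m.-1 - j) * u * c + pi ^+ m.-1 * v * pi ^+ m.
    rewrite -[LHS]mulr1 -uv mulrDr mulrA mulrA cE; congr (_ + _).
    have -> : pi ^+ m.-1 = pi ^+ (m.-1 - j) * pi ^+ j.
      by rewrite -exprD subnK // -ltnS prednK.
    by rewrite -!mulrA; congr (_ * _); rewrite mulrCA.
  by rewrite actD !actM h z1m !act_z0 addr0.
exists (z1 + z') => [|c].
  by rewrite act_zD dE mulrC actM z1m act_z0 mulrC actM z'0 act_z0 addr0.
rewrite act_zD => h.
have dv1 : pi ^+ m %| c.
  have : pi ^+ m %| d' * c.
    apply: ord1; have := congr1 (act d') h; rewrite act_zD -!actM act_z0.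
    by rewrite [d' * c in X in _ + X]mulrC (actM c d') z'0 act_z0 addr0.
  by rewrite Gauss_dvdpr.
have h' : act c z' = 0 by move: h; rewrite (act_dvd dv1 z1m) add0r.
by rewrite dE Gauss_dvdp // dv1 z'P.
Qed.

(** An additive form of Hilbert 90: the image of [c] lies in the kernel of [d], and [card_ker] gives
    them the same size. *)
Lemma act_im_ker (d c : {poly k}) z : d * c = 'X^n - 1 -> act d z = 0 ->
  exists w, z = act c w.
Proof.
move=> dc dz.
have dX : d %| 'X^n - 1 by rewrite -dc dvdp_mulr.
have cX : c %| 'X^n - 1 by rewrite -dc dvdp_mull.
have [d0 c0] : d != 0 /\ c != 0.
  by have := cycle_neq0; rewrite -dc mulf_eq0 negb_or => /andP[].
have sub : [set act c w | w in K] \subset ker d.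
  by apply/fintype.subsetP => _ /imsetP[w _ ->]; rewrite inE -actM dc act_cycle.
have : [set act c w | w in K] == ker d.
  rewrite eqEcard sub /= -(leq_pmul2r (m := #|ker c|)).
    rewrite card_ker // card_ker // -expnD.
    have := card_ker_im c; rewrite card_K card_ker //; apply: leq_trans.
    rewrite leq_exp2l //; have := size_cycle; rewrite -dc size_mul //.
    move: d0 c0; rewrite -!size_poly_gt0; move: (size d) (size c) => A B; clear; lia.
  by rewrite card_ker // expn_gt0 q_gt0.
move/eqP/finset.setP/(_ z); rewrite [in RHS]inE dz eqxx => /imsetP[w _ ->].
by exists w.
Qed.

Lemma act_eq (t c d : {poly k}) z : c - d = t * ('X^n - 1) -> act c z = act d z.
Proof.
move=> e; apply/eqP; rewrite -subr_eq0 -actN -actD e actM.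
by rewrite act_cycle act_z0.
Qed.

Lemma actXn_inj i z : act 'X^i z = 0 -> z = 0.
Proof. by rewrite actXn => /eqP; rewrite expf_eq0 => /andP[_ /eqP]. Qed.

Local Notation cyc := (\sum_(i < n) 'X^i : {poly k}).

Lemma cyc_dvd : cyc %| 'X^n - 1.
Proof. by rewrite subrX1 dvdp_mull. Qed.

Lemma size_cyc : size cyc = n.
Proof.
have := size_cycle; rewrite subrX1 size_monicM ?monicXsubC //; last first.
  by apply: contraTneq cycle_neq0 => e; rewrite subrX1 e mulr0 eqxx.
by rewrite -polyC1 size_XsubC => -[].
Qed.

(** The trace from [K] to [k]. The sum of the conjugates is fixed by the Frobenius, so the default
    value is never taken. *)
Definition tr (z : K) : k := odflt 0 [pick a | sigma a == act cyc z].

Lemma sigma_tr z : sigma (tr z) = act cyc z.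
Proof.
rewrite /tr; case: pickP => [a /eqP //|no]; exfalso.
have [|a aE] := @fixedP (act cyc z); last by have := no a; rewrite -aE eqxx.
apply/eqP; rewrite -subr_eq0 -actX -[X in _ - X]act1 -actN -actD -actM.
by rewrite -subrX1 act_cycle.
Qed.

Lemma trD z w : tr (z + w) = tr z + tr w.
Proof. by apply: (fmorph_inj sigma); rewrite rmorphD !sigma_tr act_zD. Qed.

Lemma trZ s z : tr (sigma s * z) = s * tr z.
Proof. by apply: (fmorph_inj sigma); rewrite rmorphM !sigma_tr act_zZ. Qed.

Lemma tr0 : tr 0 = 0.
Proof. by apply: (fmorph_inj sigma); rewrite sigma_tr act_z0 rmorph0. Qed.

Lemma trN z : tr (- z) = - tr z.
Proof. by apply/eqP; rewrite -addr_eq0 -trD addNr tr0. Qed.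

Lemma tr_frob i z : tr (z ^+ (q ^ i)) = tr z.
Proof.
elim: i => [|i <-]; first by rewrite expn0 expr1.
rewrite expnSr exprM -actX; apply: (fmorph_inj sigma).
by rewrite !sigma_tr -actM act_MX -sigma_tr -rmorphXn expf_card.
Qed.

Lemma tr_nondegenerate z : (forall w, tr (z * w) = 0) -> z = 0.
Proof.
move=> h; apply/eqP; apply: contraT => z0.
have tr0 u : tr u = 0 by rewrite -(mulVKf z0 u) h.
have : (#|K| <= #|ker cyc|)%N.
  by apply/subset_leq_card/fintype.subsetP => u _; rewrite inE -sigma_tr tr0 rmorph0.
rewrite card_K card_ker ?cyc_dvd // size_cyc leq_exp2l //.
by move: n_gt0; clear; lia.
Qed.

(** The left side is the action of ['X - 1], whose kernel is the image of [k] and whose image is the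
    kernel of the trace. *)
Lemma card_artin_schreier c :
  #|[pred b : K | b ^+ q - b == c]| = (if tr c == 0%R then q else 0)%N.
Proof.
have E b : b ^+ q - b = act ('X - 1) b by rewrite actD actN actX act1.
have XE : cyc * ('X - 1) = 'X^n - 1 by rewrite mulrC -subrX1.
case: eqP => [h|h]; last first.
  apply: eq_card0 => b; rewrite !inE; apply/negP => /eqP e; apply: h.
  by apply: (fmorph_inj sigma); rewrite sigma_tr -e E -actM XE act_cycle rmorph0.
have [|b0 ->] := @act_im_ker cyc ('X - 1) c XE; first by rewrite -sigma_tr h rmorph0.
have X1 : 'X - 1 %| ('X^n - 1 : {poly k}) by rewrite -XE dvdp_mull.
have := card_ker X1; rewrite -[X in size ('X - X)]polyC1 size_XsubC expn1 => kX.
rewrite -[RHS]kX -(card_imset (ker ('X - 1)) (addIr b0)); apply: eq_card => b.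
rewrite !inE E; apply/eqP/imsetP => [e|[u]].
  by exists (b - b0); rewrite ?subrK // inE act_zD act_zN e subrr.
by rewrite inE => /eqP u0 ->; rewrite act_zD u0 add0r.
Qed.

Definition adjoint (c d : {poly k}) := forall z w, tr (act c z * w) = tr (z * act d w).

(** The trace is invariant under the Frobenius, and ['X^(n - i)] acts as the inverse of ['X^i]. *)
Lemma adjoint_Xn i : (i <= n)%N -> adjoint 'X^i 'X^(n - i).
Proof.
move=> le z w; rewrite -(tr_frob (n - i)) exprMn !actXn -exprM -expnD subnKC //.
by rewrite -card_K expf_card.
Qed.

Lemma adjointM a b c d : adjoint a b -> adjoint c d -> adjoint (a * c) (b * d).
Proof. by move=> ab cd z w; rewrite actM ab cd [b * d]mulrC actM. Qed.

Lemma adjointD a b c d : adjoint a b -> adjoint c d -> adjoint (a + c) (b + d).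
Proof. by move=> ab cd z w; rewrite !actD mulrDl mulrDr !trD ab cd. Qed.

Lemma adjointN a b : adjoint a b -> adjoint (- a) (- b).
Proof. by move=> ab z w; rewrite !actN mulNr mulrN !trN ab. Qed.

Lemma adjointC s : adjoint s%:P s%:P.
Proof. by move=> z w; rewrite !actC mulrCA -mulrA. Qed.

Lemma adjoint_comp (c y : {poly k}) : adjoint y y -> adjoint (c \Po y) (c \Po y).
Proof.
move=> yy; elim/poly_ind: c => [|c s IH].
  by rewrite comp_poly0 -polyC0; apply: adjointC.
rewrite comp_poly_MXaddC; apply: adjointD; last exact: adjointC.
exact: adjointM.
Qed.

(** The normal basis theorem: for an element with annihilator ['X^n - 1], polynomials of degree less
    than [n] act injectively, and there are as many of them as elements of [K]. *)
Lemma normal_element : exists theta,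
  (forall c, act c theta = 0 -> 'X^n - 1 %| c) /\ forall z, exists c, z = act c theta.
Proof.
have [theta _ th] := annihilator_exists (dvdpp ('X^n - 1)).
exists theta; split=> // z.
have inj : injective (fun v : 'rV[k]_n => act (rVpoly v) theta).
  move=> v w e; apply/eqP; rewrite -subr_eq0; apply/eqP; apply: (can_inj rVpolyK).
  have d : 'X^n - 1 %| rVpoly (v - w).
    by apply: th; rewrite raddfB actD actN e subrr.
  rewrite raddf0; apply/eqP; apply: contraT => nz.
  have := leq_trans (dvdp_leq nz d) (size_poly _ _).
  by rewrite size_cycle ltnn.
have := inj_card_onto inj; rewrite card_mx mul1n card_K leqnn => /(_ isT z).
by move=> /codomP[v ->]; exists (rVpoly v).
Qed.

End FrobeniusModule.

Lemma rVpolyE (k : fieldType) m (v : 'rV[k]_m) : rVpoly v = \sum_i v 0 i *: 'X^i.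
Proof. by rewrite /rVpoly poly_def; apply: eq_bigr => i _; rewrite valK. Qed.

Lemma hankel_form (k : fieldType) (L : {poly k} -> k) m s (a b : 'rV[k]_m) :
    (forall a u v, L (a *: u + v) = a * L u + L v) ->
  (a *m (\matrix_(i, j) L (s * 'X^(i + j))) *m b^T) 0 0 = L (s * (rVpoly a * rVpoly b)).
Proof.
move=> Llin.
have L0 : L 0 = 0 by have := Llin (-1) 0 0; rewrite scaler0 addr0 mulN1r addNr.
have LD u v : L (u + v) = L u + L v by rewrite -{1}(scale1r u) Llin mul1r.
have LZ c u : L (c *: u) = c * L u by rewrite -[c *: u]addr0 Llin L0 addr0.
transitivity (\sum_(j < m) \sum_(i < m) a 0 i * L (s * 'X^(i + j)) * b 0 j).
  by rewrite mxE; apply: eq_bigr => j _; rewrite !mxE mulr_suml; apply: eq_bigr => i _; rewrite mxE.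
rewrite !rVpolyE mulr_suml mulr_sumr (big_morph L LD L0) exchange_big.
apply: eq_bigr => i _ /=; rewrite !mulr_sumr (big_morph L LD L0); apply: eq_bigr => j _.
rewrite -scalerAl -!scalerAr -exprD !LZ.
by rewrite -mulrA [L _ * _]mulrC.
Qed.

(** * The trace form attached to a palindromic divisor of [X^n - 1] *)

Section QuadraticForm.
Variables (k K : finFieldType) (sigma : {rmorphism k -> K}) (n h D : nat).
Local Notation q := #|k|.
Hypothesis card_K : #|K| = (q ^ n)%N.
Hypothesis q_pchar : [pchar K].-nat q.
Hypothesis two_neq0 : 2%:R != 0 :> k.
Hypothesis nE : n = (2 * (h + D.+1))%N.

Let n_gt0 : (0 < n)%N. Proof. by rewrite nE; lia. Qed.

Local Notation "c ** z" := (act sigma c z) (at level 39, left associativity).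
Local Notation T := (tr sigma n).
Local Notation "c === d" := (forall z, c ** z = d ** z) (at level 70).
Local Notation Y := ('X + 'X^(n.-1) : {poly k}).
Local Notation Z := ('X - 'X^(n.-1) : {poly k}).
Local Notation adj := (adjoint sigma n).

Let actM := actM sigma q_pchar.
Let act_zD := act_zD sigma q_pchar.
Let act_zN := act_zN sigma q_pchar.
Let act_z0 := act_z0 sigma q_pchar.
Let actX := actX sigma q_pchar.
Let actXn := actXn sigma q_pchar.
Let act_eq := @act_eq k K sigma n card_K q_pchar.
Let act_cycle := act_cycle sigma card_K q_pchar.
Let trD := trD sigma card_K q_pchar.
Let trN := trN sigma card_K q_pchar.
Let trZ := trZ sigma card_K q_pchar.
Let tr0 := tr0 sigma card_K q_pchar.
Let sigma_tr := sigma_tr sigma card_K q_pchar.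

Let sM a b c d : a === b -> c === d -> a * c === b * d.
Proof. by move=> ab cd z; rewrite !actM cd ab. Qed.

Let XU : 'X * 'X^(n.-1) = 'X^n :> {poly k}.
Proof. by rewrite -exprS prednK. Qed.

Let ZZ : Z * Z === Y ^+ 2 - 4%:P.
Proof.
move=> z; apply: (@act_eq (- 4%:P)); rewrite -XU; move: ('X^(n.-1) : {poly k}) => U.
rewrite (_ : 4%:P = 4%:R) ?rmorph_nat //; ring.
Qed.

Let XZ : 'X * Z === 'X^2 - 1.
Proof. by move=> z; apply: (@act_eq (-1)); rewrite -XU; move: ('X^(n.-1) : {poly k}) => U; ring. Qed.

Let XYm : 'X * (Y - 2%:P) === ('X - 1) ^+ 2.
Proof.
move=> z; apply: (@act_eq 1); rewrite -XU; move: ('X^(n.-1) : {poly k}) => U.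
rewrite (_ : 2%:P = 2%:R) ?rmorph_nat //; ring.
Qed.

Let XYp : 'X * (Y + 2%:P) === ('X + 1) ^+ 2.
Proof.
move=> z; apply: (@act_eq 1); rewrite -XU; move: ('X^(n.-1) : {poly k}) => U.
rewrite (_ : 2%:P = 2%:R) ?rmorph_nat //; ring.
Qed.

Let aD := @adjointD k K sigma n card_K q_pchar.
Let aN := @adjointN k K sigma n card_K q_pchar.
Let aM := @adjointM k K sigma n q_pchar.
Let aC := @adjoint_comp k K sigma n card_K q_pchar.

Let adjX : adj 'X 'X^(n.-1).
Proof. by rewrite -subn1 -['X]expr1; apply: adjoint_Xn. Qed.

Let adjU : adj 'X^(n.-1) 'X.
Proof.
have := adjoint_Xn sigma card_K q_pchar (leq_pred n).
by rewrite (_ : (n - n.-1 = 1)%N) ?expr1 //; move: n_gt0; clear; lia.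
Qed.

Let adjY : adj Y Y.
Proof. by rewrite {2}addrC; exact: (aD adjX adjU). Qed.

Let adjZ : adj Z (- Z).
Proof.
by rewrite opprB; exact: (aD adjX (aN adjU)).
Qed.

Variables (ft e g P : {poly k}).
Hypothesis ftE : ft === 'X^h * (g \Po Y).
Hypothesis eE : e === 'X^D * (P \Po Y).
Hypothesis size_P : size P = D.+1.
Hypothesis size_ft : size ft = (2 * h).+1.
Hypothesis cycleE : ft * (('X^2 - 1) * e) = 'X^n - 1.

(** The exponent is [n / 2], and this power of ['X] is its own adjoint: multiplying [ft] by
    ['X^(D.+1)] makes it self-adjoint without changing its kernel. *)
Definition form_op : {poly k} := 'X^(h + D.+1) * (g \Po Y).

Let form_opE : form_op === 'X^(D.+1) * ft.
Proof.
move=> z; rewrite /form_op exprD [_ * 'X^(D.+1)]mulrC -mulrA.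
by rewrite actM -ftE -actM.
Qed.

Let adj_form : adj form_op form_op.
Proof.
apply: aM; last exact: (aC _ adjY).
have := @adjoint_Xn _ _ sigma n card_K q_pchar (h + D.+1).
by rewrite (_ : n - (h + D.+1) = h + D.+1)%N ?nE; [apply|]; lia.
Qed.

Let form_op_eq0 u : form_op ** u = 0 <-> ft ** u = 0.
Proof.
rewrite form_opE actM; split=> [h0|->]; last by rewrite act_z0.
by apply: actXn_inj h0.
Qed.

(** The power [h + D + 1] of ['X] is shared out: [h] for [ft], [D] for [e] and 1 for [s]. *)
Let form_fac s t : 'X * s === t -> form_op * ((P \Po Y) * s) === (ft * e) * t.
Proof.
move=> st z; have -> : form_op * ((P \Po Y) * s) =
    ('X^h * (g \Po Y)) * ('X^D * (P \Po Y)) * ('X * s).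
  by rewrite /form_op addnS exprS exprD; ring.
by apply: sM => // w; apply: sM => // w'; rewrite ?ftE ?eE.
Qed.

Let form_ZP z : (form_op * ((P \Po Y) * Z)) ** z = 0.
Proof.
rewrite (form_fac XZ) (_ : _ * _ = 'X^n - 1) ?act_cycle // -cycleE.
by move: ('X^2 - 1 : {poly k}) => s; ring.
Qed.

Let comp_X24 : ('X^2 - 4%:P) \Po Y = Y ^+ 2 - 4%:P.
Proof. by rewrite comp_polyB comp_Xn_poly comp_polyC. Qed.

Variable theta : K.
Hypothesis theta_ann : forall c, c ** theta = 0 -> 'X^n - 1 %| c.
Hypothesis theta_gen : forall z, exists c, z = c ** theta.

(** The moments of [Y] at [theta]. As [Y] is self-adjoint, the form on polynomials in [Y] depends
    only on products, which is what makes Gram matrices Hankel. *)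
Let L a := T (theta * (form_op * (a \Po Y)) ** theta).

Let Llin a u v : L (a *: u + v) = a * L u + L v.
Proof.
rewrite /L comp_polyD comp_polyZ mulrDr -scalerAr actD actZ mulrDr trD //.
by rewrite mulrCA trZ.
Qed.

Let LP u : L (('X^2 - 4%:P) * P * u) = 0.
Proof.
rewrite /L !comp_polyM comp_X24.
have -> : form_op * ((Y ^+ 2 - 4%:P) * (P \Po Y) * (u \Po Y)) =
  (form_op * (P \Po Y) * (u \Po Y)) * (Y ^+ 2 - 4%:P).
  by move: (Y ^+ 2 - 4%:P) => s; ring.
rewrite actM -ZZ -actM.
have -> : (form_op * (P \Po Y) * (u \Po Y)) * (Z * Z) =
  ((u \Po Y) * Z) * (form_op * ((P \Po Y) * Z)).
  by move: Z => s; ring.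
by rewrite actM form_ZP act_z0 mulr0 tr0.
Qed.

Let ring2 : 2%:P = 2%:R :> {poly k}. Proof. by rewrite rmorph_nat. Qed.

(* Up to squares of [k], the product is the square of the image of [theta] under
   [('X^n - 1) / ('X + 1)], an element of [K] which the Frobenius maps to its opposite. *)
Let nonsquare_L : exists2 s, s != 0 &
  exists2 w, nonsquare w & L (P * ('X - 2%:P)) * L (P * ('X + 2%:P)) = s ^+ 2 * w.
Proof.
have mn s t : (form_op * ((P * s) \Po Y)) ** theta = (ft * e * t) ** theta ->
    L (P * s) = T (theta * (ft * e * t) ** theta).
  by rewrite /L => ->.
have Lp : L (P * ('X + 2%:P)) = T (theta * (ft * e * ('X + 1) ^+ 2) ** theta).
  apply: mn; rewrite comp_polyM comp_polyD comp_polyX comp_polyC.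
  exact: form_fac.
have Lm : L (P * ('X - 2%:P)) = T (theta * (ft * e * ('X - 1) ^+ 2) ** theta).
  apply: mn; rewrite comp_polyM comp_polyB comp_polyX comp_polyC.
  exact: form_fac.
have n0 (c d : {poly k}) : (1 < size d)%N -> c * d = 'X^n - 1 -> c ** theta != 0.
  move=> d1 cd; apply: contraTneq isT => /theta_ann dv.
  have c0 : c != 0 by apply: contra_eq_neq cd => ->; rewrite mul0r eq_sym cycle_neq0.
  have d0 : d != 0 by rewrite -size_poly_gt0 ltnW.
  have := dvdp_leq c0 dv; rewrite -cd size_mul //.
  by move: c0 d1; rewrite -size_poly_gt0; move: (size c) (size d); clear; lia.
have cE : (ft * e * ('X + 1)) * ('X - 1) = 'X^n - 1.
  by rewrite -cycleE; ring.
have aE : (ft * e * ('X - 1)) * ('X + 1) = 'X^n - 1.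
  by rewrite -cycleE; ring.
have t0 := n0 _ _ _ cE; have w0 := n0 _ _ _ aE.
have {t0} t0 : (ft * e * ('X + 1)) ** theta != 0.
  by apply: t0; rewrite -polyC1 size_XsubC.
have {w0} w0 : (ft * e * ('X - 1)) ** theta != 0.
  by apply: w0; rewrite -polyC1 size_XaddC.
have C1 : ('X - 1 : {poly k}) != 0 by rewrite -polyC1 polyXsubC_eq0.
have C2 : ('X + 1 : {poly k}) != 0 by rewrite -size_poly_eq0 -polyC1 size_XaddC.
have cyE : ft * e * ('X + 1) = \sum_(i < n) 'X^i.
  by apply: (mulIf C1); rewrite cE subrX1 mulrC.
have n_even : ~~ odd n by rewrite nE mul2n odd_double.
have alE : ft * e * ('X - 1) = - \sum_(i < n) (- 'X) ^+ i.
  apply: (mulIf C2); rewrite aE; have := subrX1 (- 'X : {poly k}) n.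
  by rewrite exprNn -signr_odd (negbTE n_even) expr0 mul1r => ->; ring.
set t := T theta; set w := (ft * e * ('X - 1)) ** theta.
have tE : (ft * e * ('X + 1)) ** theta = sigma t by rewrite cyE sigma_tr.
have tn0 : t != 0 by apply: contraNneq t0 => t0; rewrite tE t0 rmorph0.
have wq : w ^+ q = - w.
  apply/eqP; rewrite -addr_eq0 -actX // -[X in _ + X](act1 sigma) -actD /w -actM.
  by rewrite [_ * (ft * _ * _)]mulrC aE act_cycle.
have wqi i : w ^+ (q ^ i) = (-1) ^+ i * w.
  elim: i => [|i IH]; first by rewrite expr1 mul1r.
  have sg : (-1) ^+ i = sigma ((-1) ^+ i) by rewrite rmorphXn rmorphN1.
  by rewrite expnSr exprM IH exprMn wq sg -rmorphXn expf_card -sg exprS mulrN mulN1r mulNr.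
have actS m (F : 'I_m -> {poly k}) z : (\sum_i F i) ** z = \sum_i F i ** z.
  by apply: (big_morph (fun c => c ** z)) => [c d|]; rewrite ?actD ?act0.
have wE : - w = \sum_(i < n) (- 'X) ^+ i ** theta by rewrite /w alE actN opprK actS.
(* The [i]-th conjugate of [w] is [(-1) ^+ i * w], so the trace is [w] times the alternating sum of
   the conjugates of [theta], which is [- w]. *)
have sw : sigma (T (theta * w)) = - w ^+ 2.
  rewrite sigma_tr actS expr2 -mulrN wE [RHS]big_distrr /=.
  apply: eq_bigr => i _; rewrite actXn exprMn wqi (exprNn 'X).
  have -> : (-1) ^+ i * 'X^i = (-1) ^+ i *: 'X^i :> {poly k}.
    by rewrite -mul_polyC rmorphXn rmorphN1.
  by rewrite actZ actXn rmorphXn rmorphN1; ring.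
have LmE : L (P * ('X - 2%:P)) = - 2%:R * T (theta * w).
  rewrite Lm expr2 mulrA [_ * ('X - 1)]mulrC actM -/w actD actN act1 actX // wq.
  rewrite -[in RHS]trZ; congr T; rewrite rmorphN rmorph_nat; ring.
have LpE : L (P * ('X + 2%:P)) = 2%:R * t * t.
  rewrite Lp expr2 mulrA [_ * ('X + 1)]mulrC actM tE actD act1 actX // -rmorphXn expf_card.
  rewrite -[in RHS]trZ; congr T; rewrite rmorphM rmorph_nat; ring.
exists (2%:R * t); first by rewrite mulf_neq0.
exists (- T (theta * w)); last by rewrite LmE LpE; ring.
(* A square root in [k] would put [w] in [k], fixed by the Frobenius, which sends it to its
   opposite. *)
move=> b; apply/eqP => bE; have : w ^+ 2 = sigma b ^+ 2 by rewrite -rmorphXn -bE rmorphN sw opprK.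
move/eqP; rewrite eqf_sqr => wb; have wqw : w ^+ q = w.
  case/orP: wb => /eqP ->; first by rewrite -rmorphXn expf_card.
  by rewrite -rmorphN -rmorphXn expf_card.
move: wq; rewrite wqw => /eqP; rewrite -addr_eq0 -mulr2n -mulr_natl mulf_eq0 (negbTE w0) orbF.
by rewrite -(rmorph_nat sigma) fmorph_eq0 (negbTE two_neq0).
Qed.

Let skew_eq0 c : adj c (- c) -> T (theta * c ** theta) = 0.
Proof.
move=> /(_ theta theta); rewrite mulrC actN mulrN trN // => /eqP.
by rewrite -addr_eq0 -mulr2n -mulr_natl mulf_eq0 (negbTE two_neq0) => /eqP.
Qed.

Let adj_self (a : {poly k}) : adj (a \Po Y) (a \Po Y).
Proof. exact: (aC a adjY). Qed.

(** The cross terms are given by a skew-adjoint operator, a product of commuting self-adjoint ones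
    and a single [Z], and vanish by [skew_eq0]. *)
Let form_poly (a b a' b' : {poly k}) :
  T (((a \Po Y) + Z * (b \Po Y)) ** theta * form_op ** (((a' \Po Y) + Z * (b' \Po Y)) ** theta))
  = L (1 * (a * a')) + L (- ('X^2 - 4%:P) * (b * b')).
Proof.
have adjA : adj ((a \Po Y) + Z * (b \Po Y)) ((a \Po Y) + - Z * (b \Po Y)).
  exact: (aD (adj_self a) (aM adjZ (adj_self b))).
have skew (u v : {poly k}) : T (theta * (form_op * Z * (u \Po Y) * (v \Po Y)) ** theta) = 0.
  apply: skew_eq0; rewrite -mulNr -mulNr -mulrN.
  exact: (aM (aM (aM adj_form adjZ) (adj_self u)) (adj_self v)).
rewrite adjA -!actM -mulrA.
have -> : ((a \Po Y) + - Z * (b \Po Y)) * (form_op * ((a' \Po Y) + Z * (b' \Po Y))) =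
   form_op * ((a * a') \Po Y) + (form_op * Z * (a \Po Y) * (b' \Po Y)
   - form_op * Z * (b \Po Y) * (a' \Po Y)) + (form_op * - ((b * b') \Po Y)) * (Z * Z).
  by rewrite !comp_polyM; move: Z => s; ring.
rewrite !actD actN !(mulrDr theta) (mulrN theta) !trD trN !skew subr0 addr0 mul1r; congr (_ + _).
have cN : - ('X^2 - 4%:P) \Po Y = - (Y ^+ 2 - 4%:P) by rewrite raddfN /= comp_X24.
rewrite actM ZZ -actM /L [in RHS]comp_polyM cN.
congr (T (theta * act sigma _ theta)); move: (Y ^+ 2 - 4%:P) => s; ring.
Qed.

Local Notation R := ((D + 2) + D)%N.

(* [Y] is self-adjoint and [Z] skew-adjoint, so that the images of [theta] under the
   polynomials in [Y] are orthogonal to its images under [Z] times such polynomials. *)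
Definition gram : 'M[k]_R := block_mx (hankel_plus L D) 0 0 (hankel_minus L D).

Let phi (v : 'rV[k]_R) : K :=
  (((rVpoly (lsubmx v)) \Po Y) + Z * ((rVpoly (rsubmx v)) \Po Y)) ** theta.

Let phiB v w : phi (v - w) = phi v - phi w.
Proof.
have lB : lsubmx (v - w) = lsubmx v - lsubmx w by apply/matrixP => i j; rewrite !mxE.
have rB : rsubmx (v - w) = rsubmx v - rsubmx w by apply/matrixP => i j; rewrite !mxE.
rewrite /phi lB rB !(raddfB rVpoly) !comp_polyB -actN -actD; congr (act sigma _ theta).
by move: Z => s; ring.
Qed.

Let phi_form v w : T (phi v * form_op ** phi w) = (v *m gram *m w^T) 0 0.
Proof.
rewrite form_poly -!(hankel_form _ _ _ Llin) -{3}(hsubmxK v) -{3}(hsubmxK w).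
have hp : \matrix_(i, j) L (1 * 'X^(i + j)) = hankel_plus L D.
  by apply/matrixP => i j; rewrite !mxE mul1r.
by rewrite hp mul_row_block !mulmx0 addr0 add0r tr_row_mx mul_row_col [RHS]mxE.
Qed.

Let rad_l u w : ft ** u = 0 -> T (u * form_op ** w) = 0.
Proof. by move=> u0; rewrite -adj_form (form_op_eq0 u).2 // mul0r tr0. Qed.

Let rad_r u w : ft ** u = 0 -> T (w * form_op ** u) = 0.
Proof. by move=> u0; rewrite (form_op_eq0 u).2 // mulr0 tr0. Qed.

(** Such expressions are stable under multiplication by [X = (Y + Z) / 2], because
    [Z^2 = Y^2 - 4]. *)
Let span_YZ (c : {poly k}) : exists a b, c === (a \Po Y) + Z * (b \Po Y).
Proof.
elim/poly_ind: c => [|c s [a [b ab]]].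
  by exists 0, 0 => z; rewrite !comp_poly0 mulr0 addr0.
pose i2 : {poly k} := (2%:R^-1)%:P.
have i22 : i2 * 2%:R = 1 by rewrite -ring2 -polyCM mulVf.
exists (i2 * (a * 'X + ('X^2 - 4%:P) * b) + s%:P), (i2 * (a + b * 'X)) => z.
rewrite !comp_polyD !comp_polyM !comp_polyD !comp_polyM !comp_polyC !comp_polyX comp_X24.
have XE : 'X = i2 * (Y + Z) by rewrite -[LHS]mul1r -i22; ring.
have -> : (i2 * ((a \Po Y) * Y + (Y ^+ 2 - 4%:P) * (b \Po Y)) + s%:P +
   Z * (i2 * ((a \Po Y) + (b \Po Y) * Y))) = i2 * (b \Po Y) * (Y ^+ 2 - 4%:P) +
   (i2 * ((a \Po Y) * Y) + Z * (i2 * ((a \Po Y) + (b \Po Y) * Y)) + s%:P).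
  by move: Z (Y ^+ 2 - 4%:P) => t u; ring.
rewrite [RHS]actD [in RHS]actM -ZZ -[in RHS]actM -[RHS]actD.
rewrite [LHS]actD [c * 'X]mulrC actM ab -actM -[LHS]actD; congr (act sigma _ z).
rewrite {1}XE; move: Z Y => t u; ring.
Qed.

(** The part in [Y] is divided by [(Y^2 - 4) P(Y)], the part with [Z] by [P(Y)]. The multiples lie
    in the radical by [form_ZP], and the remainders have the sizes [D + 2] and [D] of the two
    blocks. *)
Let phi_surj z : exists v u, ft ** u = 0 /\ z = phi v + u.
Proof.
have [c ->] := theta_gen z; have [a [b cE]] := span_YZ c.
pose P4 := ('X^2 - 4%:P) * P.
have P0 : P != 0 by rewrite -size_poly_gt0 size_P.
have s4 : size ('X^2 - 4%:P : {poly k}) = 3 by rewrite size_XnsubC.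
have P40 : P4 != 0 by rewrite mulf_neq0 // -size_poly_gt0 s4.
have sP4 : size P4 = D.+3 by rewrite size_mul // -?size_poly_gt0 ?s4 // size_P.
exists (row_mx (poly_rV (a %% P4)) (poly_rV (b %% P))).
exists ((((a %/ P4) * P4) \Po Y + Z * ((b %/ P) * P \Po Y)) ** theta); split.
  apply/form_op_eq0; rewrite -actM mulrDr actD.
  rewrite comp_polyM [P4 \Po Y]comp_polyM comp_X24 comp_polyM.
  have -> : form_op * (((a %/ P4) \Po Y) * ((Y ^+ 2 - 4%:P) * (P \Po Y))) =
    (form_op * ((a %/ P4) \Po Y) * (P \Po Y)) * (Y ^+ 2 - 4%:P).
    by move: (Y ^+ 2 - 4%:P) => s; ring.
  rewrite actM -ZZ -actM.
  have -> : (form_op * ((a %/ P4) \Po Y) * (P \Po Y)) * (Z * Z) =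
    (((a %/ P4) \Po Y) * Z) * (form_op * ((P \Po Y) * Z)).
    by move: Z => s; ring.
  have -> : form_op * (Z * (((b %/ P) \Po Y) * (P \Po Y))) =
    ((b %/ P) \Po Y) * (form_op * ((P \Po Y) * Z)).
    by move: Z => s; ring.
  by rewrite actM [X in _ + X]actM !form_ZP !act_z0 addr0.
rewrite /phi row_mxKl row_mxKr !poly_rV_K; first last.
- by rewrite -ltnS addn2 -sP4 ltn_modp.
- by rewrite -ltnS -size_P ltn_modp.
rewrite cE -actD; congr (act sigma _ theta).
by rewrite {1}(divp_eq a P4) {1}(divp_eq b P) !comp_polyD; move: Z => s; ring.
Qed.

Let Phi (vu : 'rV[k]_R * K) := phi vu.1 + vu.2.
Let domain := finset.setX [set: 'rV[k]_R] (ker sigma ft).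

Let Phi_im : Phi @: domain = [set: K].
Proof.
apply/finset.setP => z; rewrite [RHS]finset.in_setT; apply/imsetP.
have [v [u [u0 ->]]] := phi_surj z; exists (v, u) => //.
by rewrite finset.in_setX finset.in_setT inE u0 eqxx.
Qed.

Let card_ker_ft : #|ker sigma ft| = (q ^ (2 * h))%N.
Proof. by rewrite (card_ker sigma card_K n_gt0 q_pchar) ?size_ft // -cycleE dvdp_mulr. Qed.

(** Surjectivity is enough: the domain has [q ^ (2 D + 2) * q ^ (2 h) = q ^ n] elements. *)
Let Phi_inj : {in domain &, injective Phi}.
Proof.
apply/imset_injP; rewrite Phi_im cardsX !cardsT card_mx mul1n card_ker_ft card_K.
by rewrite -expnD nE; apply/eqP; congr expn; lia.
Qed.

Let gram_det : \det gram != 0.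
Proof.
apply/negP => /det0P[v v0 vg]; case/negP: v0.
have kv : ft ** phi v = 0.
  apply/form_op_eq0/(@tr_nondegenerate k K sigma n card_K n_gt0 q_pchar) => z.
  have [w [u [u0 ->]]] := phi_surj z.
  by rewrite adj_form act_zD (mulrDr (phi v)) trD (rad_r _ u0) phi_form vg mul0mx mxE addr0.
have := @Phi_inj (v, 0) (0, phi v); rewrite !finset.in_setX !finset.in_setT !inE /= act_z0 kv eqxx.
have p0 : phi 0 = 0 by have := phiB 0 0; rewrite !subrr.
by rewrite /Phi /= p0 addr0 add0r => /(_ isT isT erefl)[->].
Qed.

(** [hankel_det] expresses the first block determinant by the second, whose square then factors out;
    the sign there cancels that of the discriminant, and [nonsquare_L] provides the remaining
    class. *)
Let gram_nonsquare : nonsquare ((-1) ^+ D.+1 * \det gram).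
Proof.
have [s s0 [w w_ns sw]] := nonsquare_L.
have := hankel_det Llin size_P LP; rewrite sw.
have l0 : lead_coef P != 0 by rewrite lead_coef_eq0 -size_poly_gt0 size_P.
have := gram_det; rewrite /gram det_ublock mulf_eq0 negb_or => /andP[_ d0].
set dp := \det (hankel_plus L D); set d := \det (hankel_minus L D).
move=> e1; have -> : (-1) ^+ D.+1 * (dp * d) = (d * s / lead_coef P) ^+ 2 * w.
  have -> : dp = (lead_coef P ^+ 2 * dp) / lead_coef P ^+ 2 by field.
  rewrite e1 exprS; have := sqrr_sign k D; move: ((-1) ^+ D) => o o2.
  by transitivity (o ^+ 2 * ((d * s / lead_coef P) ^+ 2 * w)); [field|rewrite o2 mul1r].
rewrite mulrC nonsquare_mul_square // !mulf_neq0 // invr_eq0 //.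
Qed.

Let gram_sym : gram^T = gram.
Proof.
rewrite /gram tr_block_mx !trmx0; congr block_mx; apply/matrixP => i j;
by rewrite !mxE addnC.
Qed.

(** [K] is the sum of the radical and of a complement with Gram matrix [gram], so each zero of the
    nondegenerate part is counted once for every element of the radical. *)
Lemma card_form_zeros :
  (#|[pred z : K | (T (z * form_op ** z) == 0)%R]| + q ^ (2 * h) * (q.-1 * q ^ D)
   = q ^ (2 * h) * q ^ (2 * D).+1)%N.
Proof.
have dimE : (D + 2 + D = 2 * D.+1)%N by lia.
rewrite -(elliptic_zeros two_neq0 dimE gram_sym gram_nonsquare) mulnDr; congr addn.
pose zeros : {set 'rV[k]_R} := [set v | (v *m gram *m v^T) 0 0 == 0].
have <- : #|zeros| = #|[pred v : 'rV[k]_R | ((v *m gram *m v^T) 0 0 == 0)%R]|.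
  by rewrite /zeros cardsE.
rewrite [RHS]mulnC -card_ker_ft.
rewrite -cardsX -(card_in_imset (f := Phi)); last first.
  apply: sub_in2 Phi_inj => -[v u]; rewrite !finset.in_setX finset.in_setT.
  by case/andP.
apply: eq_card => z; rewrite !inE; apply/eqP/imsetP => [z0|[[v u]]].
  have : z \in Phi @: domain by rewrite Phi_im finset.in_setT.
  move=> /imsetP[[v u]]; rewrite finset.in_setX !inE /= => /eqP u0 zE.
  exists (v, u) => //; rewrite finset.in_setX !inE u0 eqxx andbT.
  move: z0; rewrite zE /Phi /= mulrDl trD (rad_l _ u0) act_zD (mulrDr (phi v)) trD (rad_r _ u0).
  by rewrite phi_form !addr0 => ->.
rewrite finset.in_setX !inE => /andP[/eqP v0 /eqP u0] ->.
rewrite /Phi /= mulrDl trD (rad_l _ u0) act_zD (mulrDr (phi v)) trD (rad_r _ u0).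
by rewrite phi_form v0 !addr0.
Qed.

End QuadraticForm.

(** * Palindromic polynomials *)

Section Reversal.
Variable k : fieldType.
Implicit Types c d : {poly k}.

(* [X^s c(1/X)], when [size c <= s.+1]. *)
Definition reversal s c : {poly k} := \sum_(i < s.+1) c`_i *: 'X^(s - i).

Lemma reversalD s c d : reversal s (c + d) = reversal s c + reversal s d.
Proof. by rewrite -big_split; apply: eq_bigr => i _ /=; rewrite coefD scalerDl. Qed.

Lemma reversalZ s b c : reversal s (b *: c) = b *: reversal s c.
Proof. by rewrite scaler_sumr; apply: eq_bigr => i _; rewrite coefZ scalerA. Qed.

Lemma reversal0 s : reversal s 0 = 0.
Proof. by rewrite -{1}[0](scale0r (0 : {poly k})) reversalZ scale0r. Qed.

Lemma reversalN s c : reversal s (- c) = - reversal s c.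
Proof. by apply/eqP; rewrite -addr_eq0 -reversalD addNr reversal0. Qed.

Lemma reversalXn s i : (i <= s)%N -> reversal s 'X^i = 'X^(s - i).
Proof.
move=> le; have lt : (i < s.+1)%N by [].
rewrite /reversal (bigD1 (Ordinal lt)) //= coefXn eqxx scale1r big1 ?addr0 // => j ne.
by rewrite coefXn (negbTE (ne : nat_of_ord j != i)) scale0r.
Qed.

Lemma coefK_wide s c : (size c <= s.+1)%N -> c = \sum_(i < s.+1) c`_i *: 'X^i.
Proof.
move=> le; rewrite -(poly_def s.+1 (fun i => c`_i)); apply/polyP => i; rewrite coef_poly.
by case: ltnP => // ge; rewrite nth_default // (leq_trans le).
Qed.

Lemma reversalM s t c d : (size c <= s.+1)%N -> (size d <= t.+1)%N ->
  reversal (s + t) (c * d) = reversal s c * reversal t d.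
Proof.
move=> sc sd; rewrite {1}(coefK_wide sc) {1}(coefK_wide sd) mulr_suml.
have D := reversalD (s + t); have Z := reversal0 (s + t).
rewrite (big_morph _ D Z) /reversal [RHS]mulr_suml -/(reversal _ _).
apply: eq_bigr => i _; rewrite !mulr_sumr -/(reversal _ _) (big_morph _ D Z).
apply: eq_bigr => j _.
rewrite -!scalerAl -!scalerAr !reversalZ -exprD reversalXn; last first.
  by rewrite leq_add // -ltnS.
rewrite -exprD; congr (_ *: (_ *: 'X^_)).
by have := ltn_ord i; have := ltn_ord j; lia.
Qed.

Lemma coef0_reversal s c : (reversal s c)`_0 = c`_s.
Proof.
rewrite coef_sum big_ord_recr big1 => [|i _] /=.
  by rewrite add0r coefZ subnn coefXn eqxx mulr1.
rewrite coefZ coefXn (_ : (0 == s - i)%N = false) ?mulr0 //.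
by have := ltn_ord i; lia.
Qed.

Lemma horner_reversal s c x : (size c <= s.+1)%N -> ~~ odd s -> x ^+ 2 = 1 ->
  (reversal s c).[x] = c.[x].
Proof.
move=> sc s_even x2; rewrite (horner_coef_wide _ sc) horner_sum; apply: eq_bigr => i _.
rewrite hornerZ hornerXn; congr (_ * _).
have x2i : x ^+ i * x ^+ i = 1 by rewrite -exprMn -expr2 x2 expr1n.
have xs : x ^+ s = 1 by rewrite -(even_halfK s_even) -mul2n exprM x2 expr1n.
by rewrite -[LHS]mulr1 -x2i mulrA -exprD subnK -1?ltnS // xs mul1r.
Qed.

Lemma reversal_cyclic n : (0 < n)%N -> reversal n ('X^n - 1) = - ('X^n - 1 : {poly k}).
Proof.
move=> n0; by rewrite -(expr0 'X) reversalD reversalN !reversalXn // subnn subn0 opprB.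
Qed.

Lemma reversal_sqr2 : reversal 2 ('X^2 - 1) = - ('X^2 - 1 : {poly k}).
Proof. exact: reversal_cyclic. Qed.

(* A palindromic polynomial is [X^h g(X + 1/X)]; [1/X] is ['X^(n.-1)] modulo ['X^n - 1]. *)
Lemma palindrome n h c : (0 < n)%N -> (size c <= (2 * h).+1)%N -> reversal (2 * h) c = c ->
  exists g t : {poly k}, [/\ (size g <= h.+1)%N, g`_h = c`_(2 * h) &
    c - 'X^h * (g \Po ('X + 'X^(n.-1))) = t * ('X^n - 1)].
Proof.
move=> n0; elim: h c => [|h IH] c sc rc.
  exists c, 0; split=> //; rewrite mul0r expr0 mul1r.
  by rewrite (size1_polyC sc) comp_polyC subrr.
(* Modulo ['X^n - 1], [v] is the power [h.+1] of [X (X + 1/X)]. Subtracting [b *: v] kills the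
   leading coefficient and by symmetry the constant one, and leaves ['X] times a shorter
   palindrome. *)
pose b := c`_(2 * h.+1); pose v : {poly k} := ('X^2 + 1) ^+ h.+1.
have v2 : ('X^2 + 1 : {poly k}) \is monic by rewrite -polyC1 monicXnaddC.
have sv : size v = (2 * h.+1).+1.
  have := size_exp ('X^2 + 1 : {poly k}) h.+1.
  rewrite -{1}polyC1 size_XnaddC //= => e.
  by rewrite /v -(prednK (n := size _)) ?e // size_poly_gt0 monic_neq0 ?monic_exp.
have rv : reversal (2 * h.+1) v = v.
  have r2 : reversal 2 ('X^2 + 1) = ('X^2 + 1 : {poly k}).
    by rewrite reversalD -(expr0 'X) !reversalXn // addrC.
  rewrite /v; elim: {sc rc b v sv} h.+1 => [|m IHm].
    by rewrite muln0 expr0 -(expr0 'X) reversalXn.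
  rewrite exprS mulnS reversalM ?IHm ?r2 // -1?polyC1 ?size_XnaddC //.
  have := size_exp ('X^2 + 1%:P : {poly k}) m; rewrite size_XnaddC //=.
  by case: (size _) => //= s ->.
pose w := c - b *: v.
have rw : reversal (2 * h.+1) w = w by rewrite reversalD reversalN reversalZ rv rc.
have wb : w`_(2 * h.+1) = 0.
  have : v`_(2 * h.+1) = 1.
    by rewrite -[(2 * h.+1)%N]/(2 * h.+1).+1.-1 -sv -lead_coefE; apply/monicP/monic_exp.
  by rewrite coefB coefZ => ->; rewrite mulr1 subrr.
have sw : (size w <= 2 * h.+1)%N.
  apply/leq_sizeP => j; rewrite leq_eqVlt => /orP[/eqP <- //|lt].
  rewrite coefB coefZ !nth_default ?mulr0 ?subrr // ?sv //.
  exact: leq_trans sc lt.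
have /factor_theorem[c'] : root w 0.
  by rewrite /root horner_coef0 -rw coef0_reversal wb.
rewrite subr0 => wE.
have sc' : (size c' <= (2 * h).+1)%N.
  have [->|c'0] := eqVneq c' 0; first by rewrite size_poly0.
  by move: sw; rewrite wE size_mulX // mulnS ltnS.
have rc' : reversal (2 * h) c' = c'.
  apply: (mulIf (negbT (polyX_eq0 k))).
  have rX : reversal 2 'X = 'X by rewrite -[LHS]/(reversal 2 'X^1) reversalXn.
  have h2 : (2 * h.+1 = 2 + 2 * h)%N by rewrite mulnS.
  have e2 := @reversalM 2 (2 * h) 'X c'; rewrite size_polyX in e2.
  move: rw; rewrite wE h2 [X in reversal _ X]mulrC e2 // rX => e3.
  by rewrite mulrC e3.
have [g [t [sg gh gE]]] := IH c' sc' rc'.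
have [t1 t1E] : exists t1, v - ('X * ('X + 'X^(n.-1))) ^+ h.+1 = t1 * ('X^n - 1).
  rewrite /v subrXX; set s := \sum_(_ < _) _; exists (- s).
  have <- : 'X * 'X^(n.-1) = 'X^n :> {poly k} by rewrite -exprS prednK.
  by move: s ('X^(n.-1)) => s u; ring.
exists (b *: 'X^(h.+1) + g), (b%:P * t1 + 'X * t); split.
- rewrite (leq_trans (size_polyD _ _)) // geq_max (leq_trans (size_scale_leq _ _)) ?size_polyXn //.
  exact: leqW.
- by rewrite coefD coefZ coefXn eqxx mulr1 nth_default ?addr0.
rewrite comp_polyD comp_polyZ comp_Xn_poly.
have cE : c = b *: v + c' * 'X by rewrite -wE addrC subrK.
have -> : 'X^(h.+1) * (b *: ('X + 'X^(n.-1)) ^+ h.+1 + (g \Po ('X + 'X^(n.-1)))) =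
    b *: ('X * ('X + 'X^(n.-1))) ^+ h.+1 + 'X * ('X^h * (g \Po ('X + 'X^(n.-1)))).
  by rewrite mulrDr -scalerAr exprMn exprS mulrA.
move: t1E gE; move: (('X * ('X + 'X^(n.-1))) ^+ h.+1 : {poly k}) => U t1E.
move: ('X^h * (g \Po ('X + 'X^(n.-1))) : {poly k}) => W gE.
rewrite cE -mul_polyC (_ : v = t1 * ('X^n - 1) + U); last by rewrite -t1E subrK.
rewrite (_ : c' = t * ('X^n - 1) + W); last by rewrite -gE subrK.
by rewrite -mul_polyC; ring.
Qed.

(* The cofactor of a palindromic divisor of ['X^m - 1] is antipalindromic of even degree,
   so that it vanishes at [1] and [-1]. *)
Lemma palindrome_cofactor m r (f : {poly k}) : 2%:R != 0 :> k -> (0 < m)%N -> ~~ odd m ->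
    size f = (2 * r).+1 -> reversal (2 * r) f = f -> f %| 'X^m - 1 ->
  exists D (e : {poly k}), [/\ m = (2 * (r + D.+1))%N, f * (('X^2 - 1) * e) = 'X^m - 1,
    size e = (2 * D).+1 & reversal (2 * D) e = e].
Proof.
move=> two0 m0 m_even sf rf /dvdpP[c cE].
have f0 : f != 0 by rewrite -size_poly_gt0 sf.
have X0 : 'X^m - 1 != 0 :> {poly k} by rewrite -size_poly_gt0 size_XnsubC.
have c0 : c != 0 by apply: contra_neq X0 => c0; rewrite cE c0 mul0r.
have [s sc] : exists s, size c = s.+1.
  by move: c0; rewrite -size_poly_gt0; case: (size c) => // s _; exists s.
have mE : (m = s + 2 * r)%N.
  have := size_XnsubC (1 : k) m0; rewrite polyC1 cE size_mul // sc sf addnS addSn.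
  by move=> [].
have s_even : ~~ odd s by move: m_even; rewrite mE oddD mul2n odd_double addbF.
have rc : reversal s c = - c.
  apply: (mulIf f0); have := reversal_cyclic m0.
  by rewrite cE {1}mE reversalM ?sc ?sf // rf mulNr.
have root_c x : x ^+ 2 = 1 -> c.[x] = 0.
  move=> x2; have := @horner_reversal s c x; rewrite sc rc hornerN => /(_ (leqnn _) s_even x2) /eqP.
  rewrite eq_sym -addr_eq0 -mulr2n -mulr_natl mulf_eq0 (negbTE two0) => /eqP //.
have /factor_theorem[c1 c1E] : root c 1 by rewrite /root root_c ?expr1n.
have : c.[-1] = 0 by rewrite root_c // sqrrN expr1n.
rewrite c1E hornerM hornerXsubC => /eqP; rewrite mulf_eq0 -opprD oppr_eq0 (negbTE two0) orbF.
move=> /factor_theorem[e eE].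
have ce : c = ('X^2 - 1) * e by rewrite c1E eE rmorphN; ring.
have e0 : e != 0 by apply: contra_neq c0 => e0; rewrite ce e0 mulr0.
have sX2 : size ('X^2 - 1 : {poly k}) = 3 by rewrite size_XnsubC.
have X20 : 'X^2 - 1 != 0 :> {poly k} by rewrite -size_poly_gt0 sX2.
have se : (size e).+1 = s.
  have := sc; rewrite ce size_mul // sX2; move: (size e); clear; lia.
have [t st] : exists t, size e = t.+1.
  by move: e0; rewrite -size_poly_gt0; case: (size e) => // t _; exists t.
have tE : (t = 2 * t./2)%N.
  by rewrite mul2n even_halfK //; move: s_even; rewrite -se st /= negbK.
exists t./2, e; split.
- by rewrite mE -se st {1}tE; lia.
- by rewrite -ce mulrC -cE.
- by rewrite st -tE.
rewrite -tE; apply: (mulfI X20); apply: oppr_inj.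
rewrite -mulNr -reversal_sqr2 -reversalM ?sX2 ?st // -ce -rc; congr (reversal _ _).
by rewrite -se st.
Qed.

End Reversal.

(** * The minimal curve *)

Section TraceForm.
Variables (k K : finFieldType) (sigma : {rmorphism k -> K}) (n m J r : nat) (f : {poly k}).
Local Notation q := #|k|.
Hypothesis card_K : #|K| = (q ^ n)%N.
Hypothesis q_pchar : [pchar K].-nat q.
Hypothesis two_neq0 : 2%:R != 0 :> k.
Hypotheses (m_gt0 : (0 < m)%N) (m_even : ~~ odd m) (J_gt0 : (0 < J)%N).
Hypothesis nE : n = (m * (2 * J))%N.
Hypotheses (size_f : size f = (2 * r).+1) (f_pal : reversal (2 * r) f = f).
Hypothesis f_dvd : f %| 'X^m - 1.

Let n_gt0 : (0 < n)%N. Proof. by rewrite nE !muln_gt0 m_gt0. Qed.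

Local Notation E := (\sum_(i < 2 * J) ('X^m) ^+ i : {poly k}).
Local Notation Y := ('X + 'X^(n.-1) : {poly k}).
Local Notation shifted_f := ('X^(m./2 - r) * f).
Local Notation T := (tr sigma n).

Definition trace_op z : K := \sum_(j < J) act sigma (('X^m) ^+ j * shifted_f) z.

Let mulE : ('X^m - 1) * E = 'X^n - 1.
Proof. by rewrite -subrX1 -exprM -nE. Qed.

Let X_neq0 i : (0 < i)%N -> 'X^i - 1 != 0 :> {poly k}.
Proof. by move=> i0; rewrite -polyC1 -size_poly_gt0 size_XnsubC. Qed.

Let m2 : (2 * m./2 = m)%N. Proof. by rewrite mul2n even_halfK. Qed.

(** Half the degree [n - m] of [E], which is [(X^n - 1) / (X^m - 1)]. *)
Let hE := (m./2 * (2 * J).-1)%N.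

Let hEE : (m + 2 * hE = n)%N.
Proof. by rewrite /hE mulnA m2 nE -mulnS prednK // muln_gt0. Qed.

Let size_E : size E = (2 * hE).+1.
Proof.
have E0 : E != 0 by apply: contraNneq (X_neq0 n_gt0) => e; rewrite -mulE e mulr0.
have := congr1 (fun c : {poly k} => size c) mulE.
rewrite size_mul ?X_neq0 // -polyC1 !size_XnsubC // -hEE.
by rewrite addSn /= => e; apply/eqP; rewrite -(eqn_add2l m) e addnS.
Qed.

Let E_pal : reversal (2 * hE) E = E.
Proof.
apply: (mulfI (X_neq0 m_gt0)); apply: oppr_inj.
rewrite -mulNr -reversal_cyclic // -reversalM ?size_E //; last first.
  by rewrite -polyC1 size_XnsubC.
by rewrite mulE hEE reversal_cyclic.
Qed.

Let act_mod (c d : {poly k}) t z : c - d = t * ('X^n - 1) -> act sigma c z = act sigma d z.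
Proof. exact: act_eq. Qed.

Let actM := actM sigma q_pchar.

Let tr_sum l (F : 'I_l -> K) : T (\sum_i F i) = \sum_i T (F i).
Proof.
apply: (big_morph T (id1 := 0)) => [u v|]; first exact: trD.
exact: tr0.
Qed.

Let act_sum l (F : 'I_l -> {poly k}) z : act sigma (\sum_i F i) z = \sum_i act sigma (F i) z.
Proof. by apply: (big_morph (fun c => act sigma c z)) => [c d|]; rewrite ?actD ?act0. Qed.

(** The [i]-th summand on the left acts as [X^(m i + m/2) g(X + 1/X)], whose adjoint is the summand
    of index [2 J - 1 - i]. The two halves of the sum thus have equal traces, and one of them is
    [trace_op]. *)
Lemma tr_trace_op z : (r <= m./2)%N ->
  T (z * act sigma (shifted_f * E) z) = 2%:R * T (z * trace_op z).
Proof.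
move=> le_r.
pose t i := T (z * act sigma (('X^m) ^+ i * shifted_f) z).
have sf2 : (size f <= (2 * r).+1)%N by rewrite size_f.
have [g [u [_ _ gE]]] := palindrome n_gt0 sf2 f_pal.
have symY : adjoint sigma n (g \Po Y) (g \Po Y).
  apply: adjoint_comp => //; rewrite {2}addrC; apply: adjointD => //.
    by rewrite -subn1 -['X]expr1; apply: adjoint_Xn.
  have := @adjoint_Xn _ _ sigma n card_K q_pchar n.-1 (leq_pred n).
  by rewrite (_ : (n - n.-1 = 1)%N) ?expr1 //; move: n_gt0; clear; lia.
have tE i : t i = T (z * act sigma ('X^(m * i + m./2) * (g \Po Y)) z).
  congr (T (z * _)); apply: (@act_mod _ _ ('X^(m * i + (m./2 - r)) * u)).
  by rewrite -[RHS]mulrA -gE mulrBr !mulrA -exprM -!exprD -addnA subnK.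
have sym (i : 'I_(2 * J)) : t (rev_ord i) = t i.
  rewrite !tE.
  have le : (m * i + m./2 <= n)%N.
    have := ltn_ord i; rewrite nE; move: m2; move: (m./2) (nat_of_ord i) => a b; clear; nia.
  have ad := adjointM q_pchar (adjoint_Xn sigma card_K q_pchar le) symY.
  suff -> : (m * rev_ord i + m./2 = n - (m * i + m./2))%N by rewrite -ad mulrC.
  have := ltn_ord i; rewrite nE /=; move: m2; move: (m./2) (nat_of_ord i) => a b.
  clear; nia.
transitivity (\sum_(i < 2 * J) t i).
  rewrite [shifted_f * _]big_distrr /= act_sum [z * _]big_distrr /= tr_sum.
  apply: eq_bigr => i _.
  by rewrite /t [('X^m) ^+ i * _]mulrC.
rewrite /trace_op [z * _]big_distrr /= tr_sum.
have eJ : (2 * J = J + J)%N by rewrite mul2n addnn.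
rewrite (eq_bigr (fun i : 'I_J => t i)) => [|i _ //].
transitivity (\sum_(i < J + J) t i); first by rewrite -eJ.
rewrite big_split_ord /= mulr_natl mulr2n; congr (_ + _).
rewrite (reindex_inj rev_ord_inj); apply: eq_bigr => i _ /=.
have lt : (i < 2 * J)%N by have := ltn_ord i; lia.
rewrite -(sym (Ordinal lt)) /=; congr t.
by have := ltn_ord i; lia.
Qed.

(** [card_form_zeros] is applied to [ft = f * E]; both factors are palindromic, and the cofactor in
    ['X^n - 1] is that of [f] in ['X^m - 1]. *)
Lemma card_trace_zeros (h := (n./2 - m./2 + r)%N) :
  exists D, [/\ n = (2 * (h + D.+1))%N, (m./2 - r = D.+1)%N, (r <= h)%N &
   (#|[pred z : K | (T (z * trace_op z) == 0)%R]| + q ^ (2 * h) * (q.-1 * q ^ D)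
   = q ^ (2 * h) * q ^ (2 * D).+1)%N].
Proof.
have [D [e [mE cE se e_pal]]] := palindrome_cofactor two_neq0 m_gt0 m_even size_f f_pal f_dvd.
have mh : m./2 = (r + D.+1)%N by move: m2; rewrite mE; lia.
have n2 : n./2 = (m * J)%N by rewrite nE mulnCA mul2n doubleK.
have mJ : (m <= m * J)%N by rewrite leq_pmulr.
have hE' : h = (r + hE)%N.
  have n22 : n = (2 * n./2)%N by rewrite n2 nE mulnCA.
  rewrite /h; move: hEE n22 mJ m2; rewrite -n2; move: (n./2) (m./2) hE => u v w; clear; lia.
have nhD : n = (2 * (h + D.+1))%N.
  by rewrite hE' -hEE mE; lia.
exists D; split=> //; first by rewrite mh; lia.
  by rewrite hE' leq_addr.
have le s (c : {poly k}) : size c = s -> (size c <= s)%N by move=> ->.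
have [g1 [t1 [_ _ g1E]]] := palindrome n_gt0 (le _ _ size_f) f_pal.
have [g2 [t2 [_ _ g2E]]] := palindrome n_gt0 (le _ _ size_E) E_pal.
have [P [t3 [sP PD PE]]] := palindrome n_gt0 (le _ _ se) e_pal.
have size_P : size P = D.+1.
  apply/eqP; rewrite eqn_leq sP ltnNge; apply/negP => /leq_sizeP/(_ D (leqnn _)) /eqP.
  by rewrite PD -[(2 * D)%N]/((2 * D).+1.-1) -se -lead_coefE lead_coef_eq0 -size_poly_eq0 se.
have ftE z : act sigma (f * E) z = act sigma ('X^h * ((g1 * g2) \Po Y)) z.
  have -> : 'X^h * ((g1 * g2) \Po Y) = ('X^r * (g1 \Po Y)) * ('X^hE * (g2 \Po Y)).
    by rewrite comp_polyM hE' exprD mulrACA.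
  by rewrite (actM f) (act_mod _ g1E) (act_mod _ g2E) -actM.
have eE z : act sigma e z = act sigma ('X^D * (P \Po Y)) z := act_mod z PE.
have size_ft : size (f * E) = (2 * h).+1.
  rewrite size_mul -?size_poly_gt0 ?size_f ?size_E // hE' mulnDr addSn /=; lia.
have cycleE : (f * E) * (('X^2 - 1) * e) = 'X^n - 1.
  by rewrite -mulE -cE; move: E => s; ring.
have [theta [ann gen]] := normal_element sigma card_K n_gt0 q_pchar.
rewrite -(card_form_zeros card_K q_pchar two_neq0 nhD ftE eE size_P size_ft cycleE ann gen).
congr addn; apply: eq_card => z; rewrite !inE.
have -> : act sigma (form_op n h D (g1 * g2)) z = act sigma (shifted_f * E) z.
  rewrite -mulrA mh addKn actM ftE -actM /form_op addnC exprD mulrA //.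
rewrite tr_trace_op; last by rewrite mh leq_addr.
by rewrite mulf_eq0 (negbTE two_neq0).
Qed.

End TraceForm.

Lemma size_sum_last (R : nzRingType) l (F : 'I_l -> {poly R}) (c : {poly R}) :
  (forall i, (size (F i) < size c)%N) -> size (\sum_i F i + c) = size c.
Proof.
case: l F => [|l] F lt; first by rewrite big_ord0 add0r.
rewrite addrC size_polyDl // (leq_ltn_trans (size_sum _ _ _)) //.
have := lt ord0; case: (size c) lt => // s lt _; rewrite ltnS.
by apply/bigmax_leqP => i _; apply: lt.
Qed.

(** * The right-hand side of the equation of the curve *)

Section CurvePolynomial.
Variables (k : finFieldType) (n m r : nat) (a : nat -> k).
Local Notation q := #|k|.
Hypothesis a_sym : forall i : nat, (1 <= i <= r)%N -> a (r - i)%N = a (r + i)%N.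
Hypothesis le_r : (r <= m./2)%N.

Local Notation f := (\poly_(i < (2 * r).+1) a i).
Local Notation J := (n %/ (2 * m))%N.

(** The symmetry of [a] exhibits [G_poly] as the linearized polynomial attached to
    ['X^(m./2 - r) * f]. *)
Lemma G_polyE : G_poly q m r a = \sum_(i < (2 * r).+1) a i *: 'X^(q ^ (i + (m./2 - r))).
Proof.
pose F i : {poly k} := a i *: 'X^(q ^ (i + (m./2 - r))).
rewrite -(big_mkord xpredT F) (@big_cat_nat _ _ _ r) //=; last by lia.
rewrite (@big_ltn _ _ _ r) /=; last by lia.
rewrite /G_poly -addrA; congr (_ + (_ + _)).
- rewrite big_add1 big_nat_rev /=; apply: eq_big_nat => i /andP[_ lt].
  have e : (0 + r - i.+1).+1 = (r - i)%N by move: lt; clear; lia.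
  have ri : (1 <= r - i <= r)%N by rewrite subn_gt0 lt leq_subr.
  rewrite e -a_sym // subKn ?(ltnW lt) //; congr (_ *: 'X^(q ^ _)).
  by move: lt le_r; clear; lia.
- by rewrite /F subnKC.
rewrite -[r.+1]add1n big_addn (_ : ((2 * r).+1 - r = r.+1)%N); last by lia.
apply: eq_big_nat => i _; rewrite /F [(i + r)%N]addnC; congr (_ *: 'X^(q ^ _)).
by rewrite -addnA [(i + _)%N]addnC addnA subnKC.
Qed.

Lemma size_S_poly : (0 < J)%N -> a (2 * r)%N != 0 ->
  size (S_poly q n m r a) = (q ^ (m./2 + r + J.-1 * m)).+1.
Proof.
move=> J0 a0.
have q1 : (1 < q)%N := finNzRing_gt1 k.
have sG : size (G_poly q m r a) = (q ^ (m./2 + r)).+1.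
  have eE : (2 * r + (m./2 - r) = m./2 + r)%N by lia.
  have sl : size (a (2 * r)%N *: 'X^(q ^ (2 * r + (m./2 - r)))) = (q ^ (m./2 + r)).+1.
    by rewrite size_scale // size_polyXn eE.
  rewrite G_polyE big_ord_recr /= size_sum_last ?sl // => i.
  rewrite (leq_ltn_trans (size_scale_leq _ _)) // size_polyXn ltnS ltn_exp2l //.
  by have := ltn_ord i; lia.
have sGj j : size (G_poly q m r a ^+ (q ^ (j * m))) = (q ^ (m./2 + r + j * m)).+1.
  have := size_exp (G_poly q m r a) (q ^ (j * m)); rewrite sG /= -expnD => e.
  by rewrite -e prednK // size_poly_gt0 expf_neq0 // -size_poly_gt0 sG.
have [m0|m0] := posnP m.
  by move: J0; rewrite m0 muln0 divn0.
have [J' JE] : exists J', J = J'.+1 by exists J.-1; rewrite prednK.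
rewrite /S_poly JE big_mkord big_ord_recr /= size_sum_last ?sGj // => i.
by rewrite !sGj ltnS ltn_exp2l // ltn_add2l ltn_pmul2r.
Qed.

Lemma S_poly_horner (K : finFieldType) (sigma : {rmorphism k -> K}) z : [pchar K].-nat q ->
  (map_poly sigma (S_poly q n m r a)).[z] = trace_op sigma m J r f z.
Proof.
move=> q_pchar; rewrite /S_poly big_mkord rmorph_sum horner_sum; apply: eq_bigr => j _.
rewrite rmorphXn horner_exp -exprM actM // actXn // mulnC; congr (_ ^+ _).
rewrite G_polyE rmorph_sum horner_sum poly_def mulr_sumr.
rewrite (big_morph (fun c => act sigma c z) (id1 := 0) (op1 := +%R)); last exact: act0; last first.
  by move=> c d; apply: actD.
apply: eq_bigr => i _; rewrite /= map_polyZ map_polyXn !hornerE.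
by rewrite -scalerAr -exprD actZ actXn // addnC.
Qed.

End CurvePolynomial.

(** Above each abscissa, [card_artin_schreier] gives [q] points or none according to a trace. *)
Lemma card_affine_points (k K : finFieldType) (sigma : {rmorphism k -> K}) n (beta : {poly K}) :
    #|K| = (#|k| ^ n)%N -> (0 < n)%N -> [pchar K].-nat #|k| ->
  #|affine_points #|k| beta| = (#|k| * #|[pred z : K | tr sigma n beta.[z] == 0%R]|)%N.
Proof.
move=> card_K n_gt0 q_pchar; pose Q z b := b ^+ #|k| - b == beta.[z].
transitivity (\sum_z \sum_(b | Q z b) 1)%N.
  by rewrite -sum1_card pair_big_dep; apply: eq_bigl => ab; rewrite inE.
under eq_bigr => z _ do rewrite sum1_card (card_artin_schreier sigma card_K n_gt0 q_pchar).
by rewrite -big_mkcond sum_nat_const mulnC.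
Qed.

Theorem theorem8 (p m q n k r : nat) (Fq Fqn : finFieldType)
    (sigma : {rmorphism Fq -> Fqn}) (a : nat -> Fq)
    (F : fieldType) (iota : {rmorphism Fqn -> F}) (x y : F)
    (p_prime : prime p) (p_odd : odd p) (m_gt0 : (0 < m)%N)
    (q_def : q = (p ^ m)%N)
    (card_Fq : #|Fq| = q) (card_Fqn : #|Fqn| = (q ^ n)%N)
    (n_ge2 : (2 <= n)%N) (n_even : ~~ odd n)
    (k_gt0 : (0 < k)%N) (k_dvd : (k %| n./2)%N) (k_mod4 : k = 2 %[mod 4])
    (r_ge1 : (1 <= r)%N)
    (f_dvd : \poly_(i < (2 * r).+1) a i %| 'X^k - 1)
    (a_sym : forall i : nat, (1 <= i <= r)%N -> a (r - i)%N = a (r + i)%N)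
    (curve : is_curve_function_field iota q
               (map_poly sigma (S_poly q n k r a)) x y) :
  minimal_curve iota.
Proof.
have pK : p \in [pchar Fqn].
  by apply: (@card_finPcharP _ p (m * n)) => //; rewrite card_Fqn q_def expnM.
have pk : p \in [pchar Fq] by apply: (@card_finPcharP _ p m) => //; rewrite card_Fq.
have q_odd : odd q by rewrite q_def oddX p_odd orbT.
subst q; set q := #|Fq| in card_Fq card_Fqn curve q_odd.
rewrite -card_Fq in curve card_Fqn q_odd.
have q_pchar : [pchar Fqn].-nat q by rewrite card_Fq pnatX pnatE // pK.
have two_neq0 : 2%:R != 0 :> Fq.
  rewrite -(dvdn_pcharf pk) dvdn_prime2 //; apply: contraTneq p_odd => ->.
  by [].
have k_even : ~~ odd k.
  have : odd (k %% 4) = odd (2 %% 4) by rewrite k_mod4.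
  by rewrite (modn_def k 4); case: edivnP => u v -> _ /= vE; rewrite oddD oddM andbF vE.
have n_gt0 : (0 < n)%N by apply: ltn_trans n_ge2.
have [J nJ] : exists J, n = (k * (2 * J))%N.
  have /dvdnP[J JE] := k_dvd; exists J.
  by rewrite -[LHS](even_halfK n_even) JE -mul2n; clear; lia.
have J_gt0 : (0 < J)%N by move: n_gt0; rewrite nJ; case: (J) => //; rewrite !muln0.
have JE : (n %/ (2 * k) = J)%N by rewrite nJ mulnCA mulnA mulKn // muln_gt0.
set f := \poly_(i < (2 * r).+1) a i in f_dvd.
have a_pal j : (j < (2 * r).+1)%N -> a (2 * r - j)%N = a j.
  move=> le; have [jr|jr|->] := ltngtP j r.
  - have := a_sym (r - j)%N; rewrite subKn ?(ltnW jr) // subn_gt0 jr leq_subr => ->//.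
    by congr a; move: jr; clear; lia.
  - have := a_sym (j - r)%N; rewrite subnKC ?(ltnW jr) // => <-.
      by congr a; move: jr; clear; lia.
    by move: le jr; clear; lia.
  by congr a; clear; lia.
(* A zero constant term would make ['X^k - 1] vanish at 0. By symmetry [a (2 * r)] is nonzero too,
   so [f] has exact degree [2 * r]. *)
have a0 : a 0 != 0.
  apply/eqP => a0; have /dvdpP[c cE] := f_dvd.
  have := congr1 (fun c : {poly Fq} => c.[0]) cE.
  rewrite hornerM !hornerE (_ : f.[0] = 0) ?mulr0; last by rewrite horner_coef0 coef_poly a0.
  by move/eqP; rewrite expr0n gtn_eqF // sub0r oppr_eq0 oner_eq0.
have a2r : a (2 * r)%N != 0 by rewrite -(a_pal (2 * r)%N) // subnn.
have size_f : size f = (2 * r).+1 by rewrite size_poly_eq.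
have f_pal : reversal (2 * r) f = f.
  rewrite /reversal [RHS]poly_def (reindex_inj rev_ord_inj); apply: eq_bigr => i _ /=.
  by rewrite subSS subKn -1?ltnS // coef_poly ltnS leq_subr a_pal.
set h := (n./2 - k./2 + r)%N.
have [D [nE kr rh zeros]] :=
  card_trace_zeros sigma card_Fqn q_pchar two_neq0 k_gt0 k_even J_gt0 nJ size_f f_pal f_dvd.
rewrite -/h in nE rh zeros.
have le_r : (r <= k./2)%N by move: kr; clear; lia.
have h_gt0 : (0 < h)%N := leq_trans r_ge1 rh.
have q_gt1 : (1 < q)%N := finNzRing_gt1 Fq.
have size_S : size (map_poly sigma (S_poly q n k r a)) = (q ^ h).+1.
  rewrite size_map_poly size_S_poly // ?JE //; congr (_ ^ _).+1.
  have e2 : n./2 = (k * J)%N by rewrite nJ mulnCA mul2n doubleK.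
  have e3 : (2 * k./2 = k)%N by rewrite mul2n even_halfK.
  rewrite /h e2; move: e3 J_gt0; case: (J) => // j; move: (k./2) => u; clear; nia.
set S := map_poly sigma _ in curve size_S.
have S0 : S != 0 by rewrite -size_poly_gt0 size_S.
have [x_tr gen eqn] := curve.
have C : as_curve iota q (q ^ h).+1 (S * 'X) x y.
  split=> //.
  - rewrite -(coprime_pexpl _ _ h_gt0); exact: coprimenS.
  - by rewrite size_mulX // size_S.
  - have := card_artin_schreier sigma card_Fqn n_gt0 q_pchar 0.
    rewrite (tr0 sigma card_Fqn q_pchar) eqxx => cq; rewrite -[RHS]cq.
    by apply: eq_card => b; rewrite !inE subr_eq0.
  - by exists n.
  by rewrite rmorphM /= map_polyX hornerMX mulrC.
(* The halving is exact, [q] being odd. *)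
pose g := (q.-1 * q ^ h)./2.
have gE : (2 * g = q.-1 * q ^ h)%N.
  rewrite mul2n even_halfK // oddM negb_and; apply/orP; left.
  by rewrite -oddS prednK // ltnW.
exists g, #|affine_points q (S * 'X)|.+1; split.
- have := curve_genus C h_gt0 erefl gE; exact.
- exact: rational_points_card C.
have card_aff := card_affine_points sigma (S * 'X) card_Fqn n_gt0 q_pchar.
set Z := #|[pred z : Fqn | _]| in card_aff.
have ZE : (Z + q ^ (2 * h) * (q.-1 * q ^ D) = q ^ (2 * h) * q ^ (2 * D).+1)%N.
  rewrite -zeros; congr addn; apply: eq_card => z; rewrite !inE hornerMX mulrC.
  by rewrite S_poly_horner ?JE.
(* Minimality in natural numbers: as [n] is [2 * (h + D.+1)], the power [q ^ (h + D.+1)] is the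
   square root of [q ^ n]. *)
have N_eq : (#|affine_points q (S * 'X)|.+1 + 2 * g * q ^ (h + D.+1) = q ^ n + 1)%N.
  rewrite card_aff gE nE -/q; have := congr1 (muln q) ZE.
  have -> : (q * (q ^ (2 * h) * q ^ (2 * D).+1) = q ^ (2 * (h + D.+1)))%N.
    have e2 : ((2 * h + (2 * D).+1).+1 = 2 * (h + D.+1))%N by clear; lia.
    by rewrite -expnD -expnS e2.
  have -> : (q ^ (2 * h) = q ^ h * q ^ h)%N by rewrite -expnD addnn mul2n.
  rewrite expnD expnS mulnDr.
  by move: (q ^ h)%N (q ^ D)%N (q ^ _)%N => u v w <-; clear; lia.
rewrite card_Fqn nE mulnC expnM natrX sqrCK ?ler0n //.
rewrite -natrX -expnM mulnC -nE; have /(congr1 (fun l => l%:R : algC)) := N_eq.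
rewrite !natrD !natrM => <-; by rewrite addrK.
Qed.
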